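(* Let $n\ge 1$, let $\mathbb{A}_n$ be the linearly oriented quiver $n\to n-1\to\cdots\to 2\to 1$, let $\widehat{\mathbb{A}}_n$ be its biframed quiver and let $\mathcal{C}_{\mathbb{A}_n}$ be the cluster category of $\mathbb{A}_n$. Then the cluster variables of the cluster algebra with coefficients associated to the biframed quiver $\widehat{\mathbb{A}}_n$ (with initial seed $(\widehat{\mathbb{A}}_n,\{x_1,\dots,x_n,y_1,\dots,y_n,z_1,\dots,z_n\})$) are precisely the cluster characters with coefficients $X_V$, where $V$ runs over the indecomposable rigid objects of $\mathcal{C}_{\mathbb{A}_n}$.
   Context: Let $k$ be an algebraically closed field. **Ice quivers, seeds, cluster algebras.** A cluster quiver is a finite quiver without loops and 2-cycles. An ice quiver of type $(n,m)$ is a cluster quiver with vertex set $\{1,\dots,m\}$ whose vertices $n+1,\dots,m$ are called frozen. The mutation $\mu_r$ at a non-frozen vertex $r$: (i) for each path $i\to r\to j$ add an arrow $i\to j$; (ii) reverse all arrows with source or target $r$; (iii) delete all 2-cycles created. (Arrows between two frozen vertices play no role and are disregarded.) A seed is a pair $(Q,u)$ with $Q$ an ice quiver of type $(n,m)$ and $u=\{u_1,\dots,u_m\}$ algebraically independent over $\mathbb{Q}$. Its mutation at $r$ is $(\mu_r(Q),u\setminus\{u_r\}\cup\{u_r'\})$ with $u_ru_r'=\prod_{v\to r}u_v+\prod_{r\to v}u_v$ (products over arrows of $Q$). Cluster variables are the elements attached to non-frozen vertices in seeds obtained from the initial seed by finite sequences of mutations; the coefficients are the variables attached to the frozen vertices.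 The cluster algebra is generated by the cluster variables over the polynomial ring in the coefficients. **Biframed quiver.** For a quiver $Q$ with vertices $1,\dots,n$, the biframed quiver $\widehat{Q}$ is the ice quiver of type $(n,3n)$ whose arrows are those of $Q$ together with arrows $2n+i\to i$ and $i\to n+i$ for $i=1,\dots,n$. The initial variables are $x_i$ at vertex $i$, $y_i$ at vertex $n+i$, $z_i$ at vertex $2n+i$. **Cluster category.** $\mathcal{C}_Q$ is the orbit category of $\mathcal{D}^b(\mathrm{mod}\,kQ)$ by $\tau^{-1}[1]$. An object $T$ is rigid if $\mathrm{Ext}^1_{\mathcal{C}_Q}(T,T)=0$. $P_i$ is the indecomposable projective module at vertex $i$; for $\mathbb{A}_n$ the linearly oriented quiver $n\to n-1\to\cdots\to 2\to 1$, $P_1$ is simple. The indecomposable objects of $\mathcal{C}_Q$ are the indecomposable $kQ$-modules and the shifts $P_i[1]$. **Cluster character with coefficients.** $X_?:\mathrm{obj}\,\mathcal{C}_Q\to\mathbb{Q}(x_1,\dots,x_n,y_1,\dots,y_n,z_1,\dots,z_n)$ is the map with $X_{M\oplus N}=X_MX_N$, $X_{P_i[1]}=x_i$, and for an indecomposable $kQ$-module $V$ with dimension vector $d=(d_1,\dots,d_n)$, $$X_V=\sum_{0\le e\le d}\chi(\mathrm{Gr}_e(V))\prod_{r=1}^n x_r^{-\langle e,\alpha_r\rangle-\langle\alpha_r,d-e\rangle}\,y_r^{e_r}z_r^{d_r-e_r},$$ where $\mathrm{Gr}_e(V)$ is the Grassmannian of submodules of $V$ of dimension vector $e$, $\chi$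 the Euler characteristic, $\alpha_r$ the dimension vector of the simple $S_r$, and $\langle\ ,\ \rangle$ the Euler form. *)

(* Defs.v *)
From Stdlib Require Import ClassicalEpsilon.
From HB Require Import structures.
From mathcomp Require Import all_boot all_order all_algebra.
From mathcomp Require Import mpoly.

Set Implicit Arguments.
Unset Strict Implicit.
Unset Printing Implicit Defensive.

Import GRing.Theory.
Local Open Scope ring_scope.

(* [Q i j] is the number of arrows from [i] to [j]. *)
Definition quiver (m : nat) := 'I_m -> 'I_m -> nat.

(* n -> n-1 -> ... -> 2 -> 1; the vertex called r in the literature is the
   ordinal of value r - 1. *)
Definition linearA (n : nat) : quiver n :=
  fun i j => nat_of_bool (i == j.+1 :> nat).
Arguments linearA : clear implicits.

(* The truncated subtraction deletes a maximal set of 2-cycles.  The term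
   [Q i r * Q r j] vanishes if [i] or [j] is [r], as there are no loops. *)
Definition mutq (m : nat) (r : 'I_m) (Q : quiver m) : quiver m :=
  let Q1 : quiver m := fun i j => (Q i j + Q i r * Q r j)%N in
  let Q2 : quiver m :=
    fun i j => if (i == r) || (j == r) then Q1 j i else Q1 i j in
  fun i j => (Q2 i j - Q2 j i)%N.

(* An ice quiver of type (n, n + f): the non-frozen vertices are the
   [lshift f i], the frozen ones the [rshift n j].  Arrows between frozen
   vertices are not removed; they influence neither the other arrows nor the
   exchange relations. *)
Record seed (K : fieldType) (n f : nat) := Seed {
  seed_quiver : quiver (n + f);
  seed_var : 'I_(n + f) -> K }.

Definition mut_seed (K : fieldType) (n f : nat) (S : seed K n f) (r0 : 'I_n) :
    seed K n f :=
  let r := lshift f r0 in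
  let Q := seed_quiver S in
  let u := seed_var S in
  Seed (mutq r Q)
    (fun v => if v == r
              then (\prod_w u w ^+ Q w r + \prod_w u w ^+ Q r w) / u r
              else u v).

Definition cluster_variable (K : fieldType) (n f : nat) (S : seed K n f)
    (x : K) : Prop :=
  exists (rs : seq 'I_n) (i : 'I_n),
    x = seed_var (foldl (@mut_seed K n f) S rs) (lshift f i).

(* Vertices of the biframed quiver: [i], [n + i], [2n + i] are
   [vx i], [vy i], [vz i]. *)
Definition vx (n : nat) (i : 'I_n) : 'I_(n + (n + n)) := lshift (n + n) i.
Definition vy (n : nat) (i : 'I_n) : 'I_(n + (n + n)) := rshift n (lshift n i).
Definition vz (n : nat) (i : 'I_n) : 'I_(n + (n + n)) := rshift n (rshift n i).

Definition biframed (n : nat) (Q : quiver n) : quiver (n + (n + n)) :=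
  fun a b =>
  match split a, split b with
  | inl i, inl j => Q i j
  | inl i, inr b' => if split b' is inl j then nat_of_bool (i == j) else 0%N
  | inr a', inl j => if split a' is inr i then nat_of_bool (i == j) else 0%N
  | inr _, inr _ => 0%N
  end.

(* Q(x_1..x_n, y_1..y_n, z_1..z_n); the variables are indexed by the vertices
   of the biframed quiver. *)
Definition ratfun (n : nat) : fieldType := {fraction {mpoly rat[n + (n + n)]}}.
Definition rvar (n : nat) (v : 'I_(n + (n + n))) : ratfun n := FracField.tofrac 'X_v.

Definition biframed_seed (n : nat) (Q : quiver n) : seed (ratfun n) n (n + n) :=
  Seed (biframed Q) (@rvar n).

(* Vectors are rows: the arrow [a : i -> j] acts by [v |-> v *m rmap a]. *)
Record rep (k : fieldType) (n : nat) (Q : quiver n) := Rep {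
  rdim : 'I_n -> nat;
  rmap : forall i j : 'I_n, 'I_(Q i j) -> 'M[k]_(rdim i, rdim j) }.
Arguments Rep {k n Q} rdim rmap.
Arguments rmap {k n Q} r {i j} _.

Section Reps.
Context {k : fieldType} {n : nat} {Q : quiver n}.
Implicit Types M N : rep k Q.

Definition family M N := forall i : 'I_n, 'M[k]_(rdim M i, rdim N i).

Definition is_mor M N (f : family M N) : Prop :=
  forall i j (a : 'I_(Q i j)), rmap M a *m f j = f i *m rmap N a.

Record mor M N := Mor {
  mfun :> forall i : 'I_n, 'M[k]_(rdim M i, rdim N i);
  mfunP : is_mor mfun }.

Definition comp_fam M N L (f : family M N) (g : family N L) : family M L :=
  fun i => f i *m g i.

Definition is_zero M : Prop := forall i, rdim M i = 0%N.

Definition rep_iso M N : Prop :=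
  exists (f : mor M N) (g : mor N M),
    forall i, f i *m g i = 1%:M /\ g i *m f i = 1%:M.

Definition dsum M N : rep k Q :=
  Rep (fun i => (rdim M i + rdim N i)%N)
      (fun i j a => block_mx (rmap M a) 0 0 (rmap N a)).

Definition indecomposable M : Prop :=
  ~ is_zero M /\
  (forall A B, rep_iso M (dsum A B) -> is_zero A \/ is_zero B).

Definition epi M N (g : mor M N) : Prop := forall i, row_full (g i).

Definition projective P : Prop :=
  forall M N (g : mor M N) (f : mor P N), epi g ->
    exists h : mor P M, forall i, h i *m g i = f i.

Definition zero_rep : rep k Q := Rep (fun _ => 0%N) (fun _ _ _ => 0).

Lemma mor0P M N : is_mor (fun i => 0 : 'M[k]_(rdim M i, rdim N i)).
Proof. by move=> i j a; rewrite mulmx0 mul0mx. Qed.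

Definition mor0 M N : mor M N := Mor (@mor0P M N).

Lemma oppmorP M N (f : mor M N) : is_mor (fun i => - f i).
Proof. by move=> i j a; rewrite mulmxN mulNmx (mfunP f). Qed.

Definition oppmor M N (f : mor M N) : mor M N := Mor (oppmorP f).

End Reps.

Record cpx (k : fieldType) (n : nat) (Q : quiver n) := Cpx {
  cobj : int -> rep k Q;
  cdiff : forall p : int, mor (cobj p) (cobj (p + 1));
  cdiffK : forall p i, cdiff p i *m cdiff (p + 1) i = 0;
  cbound : exists N : nat, forall p, (N < `|p|)%N -> is_zero (cobj p) }.

Section Derived.
Context {k : fieldType} {n : nat} {Q : quiver n}.
Implicit Types X Y Z : cpx k Q.

Definition is_chain_map X Y (f : forall p, mor (cobj X p) (cobj Y p)) : Prop :=
  forall p i, f p i *m cdiff Y p i = cdiff X p i *m f (p + 1) i.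

Record cmap X Y := CMap {
  cfun :> forall p, mor (cobj X p) (cobj Y p);
  cfunP : is_chain_map cfun }.

Lemma comp_morP (L M N : rep k Q) (f : mor L M) (g : mor M N) :
  is_mor (comp_fam (mfun f) (mfun g)).
Proof. by move=> i j a; rewrite /comp_fam mulmxA (mfunP f) -!mulmxA (mfunP g). Qed.

Definition comp_mor (L M N : rep k Q) (f : mor L M) (g : mor M N) : mor L N :=
  Mor (comp_morP f g).

Lemma comp_cmapP X Y Z (f : cmap X Y) (g : cmap Y Z) :
  is_chain_map (fun p => comp_mor (f p) (g p)).
Proof.
by move=> p i; rewrite /= /comp_fam -mulmxA (cfunP g) mulmxA (cfunP f) mulmxA.
Qed.

Definition comp_cmap X Y Z (f : cmap X Y) (g : cmap Y Z) : cmap X Z :=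
  CMap (comp_cmapP f g).

Definition null_homotopic X Y (f : cmap X Y) : Prop :=
  exists h : forall p, mor (cobj X (p + 1)) (cobj Y p),
    forall p i, f (p + 1) i =
      h p i *m cdiff Y p i + cdiff X (p + 1) i *m h (p + 1) i.

(* Bijectivity of [H^(p+1)(f)] at every vertex, for every [p]. *)
Definition quasi_iso X Y (f : cmap X Y) : Prop :=
  forall p i,
  (forall v : 'rV_(rdim (cobj X (p + 1)) i), v *m cdiff X (p + 1) i = 0 ->
     (exists w, v *m f (p + 1) i = w *m cdiff Y p i) ->
     exists u, v = u *m cdiff X p i)
  /\
  (forall w : 'rV_(rdim (cobj Y (p + 1)) i), w *m cdiff Y (p + 1) i = 0 ->
     exists v : 'rV_(rdim (cobj X (p + 1)) i), v *m cdiff X (p + 1) i = 0 /\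
     exists u, w = v *m f (p + 1) i + u *m cdiff Y p i).

(* The morphisms X -> Y of D^b(mod kQ) are represented by the roofs
   X <-- Z --> Y whose left leg is a quasi-isomorphism. *)
Record roof X Y := Roof {
  apex : cpx k Q;
  left_leg : cmap apex X;
  left_qis : quasi_iso left_leg;
  right_leg : cmap apex Y }.

Definition roof_zero X Y (r : roof X Y) : Prop :=
  exists (Z : cpx k Q) (t : cmap Z (apex r)),
    quasi_iso t /\ null_homotopic (comp_cmap t (right_leg r)).

Definition derived_hom_zero X Y : Prop := forall r : roof X Y, roof_zero r.

(* A roof is invertible in D^b(mod kQ) iff its right leg is a
   quasi-isomorphism as well. *)
Definition derived_iso X Y : Prop :=
  exists r : roof X Y, quasi_iso (right_leg r).

Lemma shiftK X p i :
  oppmor (cdiff X (p + 1)) i *m oppmor (cdiff X (p + 1 + 1)) i = 0.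
Proof. by rewrite /= mulmxN mulNmx opprK cdiffK. Qed.

Lemma shift_bound X :
  exists N : nat, forall p : int, (N < `|p|)%N -> is_zero (cobj X (p + 1)).
Proof.
have [N HN] := cbound X; exists N.+1 => p Hp; apply: HN.
have := leqD_dist (p + 1) 0 1; rewrite addrK subr0 sub0r abszN addn1 => le_p.
exact: leq_trans Hp le_p.
Qed.

Definition shift X : cpx k Q :=
  Cpx (cobj := fun p => cobj X (p + 1))
      (cdiff := fun p => oppmor (cdiff X (p + 1)))
      (shiftK X) (shift_bound X).

Lemma stalkK (M : rep k Q) (p : int) i :
  let C := fun p : int => if p == 0 then M else zero_rep in
  mor0 (C p) (C (p + 1)) i *m mor0 (C (p + 1)) (C (p + 1 + 1)) i = 0.
Proof. exact: mul0mx. Qed.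

Lemma stalk_bound (M : rep k Q) :
  exists N : nat, forall p : int, (N < `|p|)%N ->
    is_zero (if p == 0 then M else zero_rep).
Proof. by exists 0%N => p; rewrite absz_gt0 => /negbTE ->. Qed.

Definition stalk (M : rep k Q) : cpx k Q :=
  Cpx (cobj := fun p => if p == 0 then M else zero_rep)
      (cdiff := fun p => mor0 _ _) (stalkK M) (stalk_bound M).

End Derived.

Section LinearA.
Context {k : fieldType} {n : nat}.
Local Notation Q := (linearA n).
Implicit Types X Y : cpx k Q.

(* [P_l] has the paths l -> j as a basis at the vertex [j]: one path if
   j <= l, none otherwise.  [const_mx 1] is the 1 x 1 identity matrix or an
   empty matrix. *)
Definition proj_mod (l : 'I_n) : rep k Q :=
  Rep (fun j => nat_of_bool (j <= l)%N) (fun _ _ _ => const_mx 1).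

(* The map P_l -> P_j, for an arrow j -> l, that precomposes paths with this
   arrow. *)
Definition proj_incl (j l : 'I_n) : family (proj_mod l) (proj_mod j) :=
  fun i => const_mx 1.

(* [N] is the complex obtained from [P] by applying in each degree the Nakayama
   functor nu = D Hom(-, kQ), where kQ = (+)_j P_j, so that
   (nu M)_j = D Hom(M, P_j).  The space [N^p_j] is identified with the dual of
   [Hom(P^p, P_j)] by means of a perfect pairing, which is compatible with the
   arrows and with the differentials. *)
Definition nakayama (P N : cpx k Q) : Prop :=
  exists b : forall p (j : 'I_n), family (cobj P p) (proj_mod j) ->
               'rV[k]_(rdim (cobj N p) j) -> k,
  [/\ forall p j c (phi psi : family (cobj P p) (proj_mod j)) y,
        is_mor phi -> is_mor psi ->
        b p j (fun i => c *: phi i + psi i) y = c * b p j phi y + b p j psi y,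
      forall p j c (phi : family (cobj P p) (proj_mod j)) y z,
        is_mor phi -> b p j phi (c *: y + z) = c * b p j phi y + b p j phi z,
      forall p j,
        (forall y, (forall phi, is_mor phi -> b p j phi y = 0) -> y = 0) /\
        (forall phi, is_mor phi -> (forall y, b p j phi y = 0) ->
           forall i, phi i = 0),
      forall p j l (a : 'I_(Q j l)) (phi : family (cobj P p) (proj_mod l)) y,
        is_mor phi ->
        b p l phi (y *m rmap (cobj N p) a)
        = b p j (comp_fam phi (@proj_incl j l)) y
    & forall p j (phi : family (cobj P (p + 1)) (proj_mod j)) y,
        is_mor phi ->
        b (p + 1) j phi (y *m cdiff N p j)
        = b p j (comp_fam (mfun (cdiff P p)) phi) y].

(* Y is isomorphic to tau X, where tau = nu[-1] on complexes of projectives. *)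
Definition is_tau X Y : Prop :=
  exists P N : cpx k Q,
    [/\ forall p, projective (cobj P p), derived_iso P X,
        nakayama P N & derived_iso N (shift Y)].

(* Y is isomorphic to F X, where F = tau^-1 [1]. *)
Definition is_F X Y : Prop := is_tau Y (shift X).

(* [orb i] is F^i Y; it is determined by [Y] up to isomorphism, as F is an
   auto-equivalence. *)
Definition F_orbit Y (orb : int -> cpx k Q) : Prop :=
  orb 0 = Y /\ forall i, is_F (orb i) (orb (i + 1)).

(* In the orbit category Hom(X, Y) is the direct sum over the integers i of the
   spaces Hom(X, F^i Y) of D^b(mod kQ). *)
Definition cluster_hom_zero X Y : Prop :=
  exists orb, F_orbit Y orb /\ forall i, derived_hom_zero X (orb i).

(* Ext^1(T, T) = Hom(T, T[1]) vanishes in the cluster category. *)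
Definition rigid (T : cpx k Q) : Prop := cluster_hom_zero T (shift T).

End LinearA.

(* The indecomposable objects of the cluster category, up to isomorphism. *)
Inductive cobject (k : fieldType) (n : nat) :=
| CMod (V : rep k (linearA n)) of indecomposable V
| CShift (i : 'I_n).
Arguments CShift {k n} i.

Definition cobject_cpx (k : fieldType) (n : nat) (T : cobject k n) :
    cpx k (linearA n) :=
  match T with
  | CMod V _ => stalk V
  | CShift i => shift (stalk (proj_mod i))
  end.

(* A (reduced) variety over an algebraically closed field, seen as its set of
   closed points with the Zariski open subsets and, on each of them, the
   regular functions. *)
Record variety (k : fieldType) := Variety {
  pt :> Type;
  is_open : (pt -> Prop) -> Prop;
  regular : (pt -> Prop) -> (pt -> k) -> Prop }.

(* The Euler characteristic is the alternating sum of the dimensions of the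
   etale cohomology spaces with coefficients in F_l, for a prime l invertible
   in k.  On a quasi-projective variety etale cohomology is Cech cohomology,
   the colimit over all etale coverings.  The alternating sum is the same for
   l-adic cohomology, and it does not depend on l. *)
Section EulerChar.
Variables (k : fieldType) (l : nat) (X : variety k).
Local Notation F := ('F_l).

(* Polynomials whose coefficients are regular functions on [D]. *)
Definition reg_poly (D : X -> Prop) (P : X -> {poly k}) : Prop :=
  (exists N : nat, forall x, D x -> (size (P x) <= N)%N) /\
  (forall a, regular D (fun x => (P x)`_a)).

Definition reg_mpoly (m : nat) (D : X -> Prop) (P : X -> {mpoly k[m]}) : Prop :=
  (exists N : nat, forall x, D x -> (msize (P x) <= N)%N) /\
  (forall a : 'X_{1..m}, regular D (fun x => (P x)@_a)).

(* Every etale morphism to X is, locally on its source, of the following form: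
   {(x, t) | x in D, P(x, t) = 0, (dP/dt)(x, t) <> 0, G(x, t) <> 0} --> X. *)
Record chart := Chart {
  chart_dom : X -> Prop;
  chart_pol : X -> {poly k};
  chart_loc : X -> {poly k};
  chart_open : is_open chart_dom;
  chart_polP : reg_poly chart_dom chart_pol;
  chart_locP : reg_poly chart_dom chart_loc }.

Definition on_chart (c : chart) (x : X) (t : k) : Prop :=
  [/\ chart_dom c x, root (chart_pol c x) t, ~~ root (chart_pol c x)^`() t
    & ~~ root (chart_loc c x) t].

(* A finite etale covering; its total space is the disjoint union of the
   charts, with points (x, (c, t)). *)
Record covering := Covering {
  cov_size : nat;
  cov_chart : 'I_cov_size -> chart;
  cov_surj : forall x, exists c t, on_chart (cov_chart c) x t }.

Definition cov_coord (U : covering) : Type := ('I_(cov_size U) * k)%type.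

Definition over (U : covering) (x : X) (s : cov_coord U) : Prop :=
  on_chart (cov_chart s.1) x s.2.

(* Points of the (p+1)-fold fibre product of U over X. *)
Definition simplex (U : covering) (p : nat) :=
  {ffun 'I_p.+1 -> 'I_(cov_size U) * k}.

Definition in_nerve (U : covering) p (x : X) (s : simplex U p) : Prop :=
  forall a, over x (s a : cov_coord U).

(* Only the values at the points of [in_nerve] matter. *)
Definition cochain (U : covering) (p : nat) := X -> simplex U p -> F.

Definition locally_constant (U : covering) p (phi : cochain U p) : Prop :=
  forall x (s : simplex U p), in_nerve x s ->
  exists (D : X -> Prop) (H : X -> {mpoly k[p.+1]}),
    [/\ is_open D, reg_mpoly D H, D x, (H x).@[fun a => (s a).2] != 0
      & forall y (s' : simplex U p),
          D y -> in_nerve y s' -> (forall a, (s' a).1 = (s a).1) ->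
          (H y).@[fun a => (s' a).2] != 0 -> phi y s' = phi x s].

Definition face (U : covering) p (a : 'I_p.+2) (s : simplex U p.+1) :
    simplex U p := [ffun b => s (lift a b)].

Definition cech_diff (U : covering) p (phi : cochain U p) : cochain U p.+1 :=
  fun x s => \sum_(a < p.+2) (-1) ^+ a * phi x (face a s).

Definition cocycle (U : covering) p (phi : cochain U p) : Prop :=
  locally_constant phi /\
  (forall x s, in_nerve x s -> cech_diff phi x s = 0).

Definition coboundary (U : covering) p : cochain U p -> Prop :=
  match p return cochain U p -> Prop with
  | 0%N => fun phi => forall x s, in_nerve x s -> phi x s = 0
  | q.+1 => fun phi => exists psi : cochain U q, locally_constant psi /\
              forall x s, in_nerve x s -> phi x s = cech_diff psi x s
  end.

(* Morphisms of coverings over X: the chart c of V is sent into the chart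
   [ref_idx c] of U by the regular function t |-> num(x, t) / den(x, t). *)
Record refinement (V U : covering) := Refinement {
  ref_idx : 'I_(cov_size V) -> 'I_(cov_size U);
  ref_num : 'I_(cov_size V) -> X -> {poly k};
  ref_den : 'I_(cov_size V) -> X -> {poly k};
  ref_numP : forall c, reg_poly (chart_dom (cov_chart c)) (ref_num c);
  ref_denP : forall c, reg_poly (chart_dom (cov_chart c)) (ref_den c);
  ref_den_neq0 : forall c x t, on_chart (cov_chart c) x t ->
    (ref_den c x).[t] != 0;
  ref_map := fun x (s : cov_coord V) =>
    (ref_idx s.1, (ref_num s.1 x).[s.2] / (ref_den s.1 x).[s.2]);
  ref_over : forall x (s : cov_coord V), over x s ->
    over x (ref_map x s : cov_coord U) }.

Definition pullback (V U : covering) (r : refinement V U) p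
    (phi : cochain U p) : cochain V p :=
  fun x s => phi x [ffun a => ref_map r x (s a)].

(* Equality of classes in the colimit over all coverings. *)
Definition cohomologous p (U V : covering) (phi : cochain U p)
    (psi : cochain V p) : Prop :=
  exists (W : covering) (r : refinement W U) (r' : refinement W V),
    coboundary (fun x s => pullback r phi x s - pullback r' psi x s).

(* H^p(X, F_l) is of dimension b: there is a basis, whose elements may be
   represented on the same covering. *)
Definition betti (p b : nat) : Prop :=
  exists (U : covering) (phi : 'I_b -> cochain U p),
    [/\ forall i, cocycle (phi i),
        forall (V : covering) (psi : cochain V p), cocycle psi ->
          exists c : 'I_b -> F,
            cohomologous psi (fun x s => \sum_i c i * phi i x s)
      & forall c : 'I_b -> F,
          cohomologous (fun x s => \sum_i c i * phi i x s)
                       ((fun _ _ => 0) : cochain U p) ->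
          forall i, c i = 0].

Definition is_euler_char (chi : int) : Prop :=
  exists (N : nat) (b : nat -> nat),
    [/\ forall p, betti p (b p), forall p, (N < p)%N -> b p = 0%N
      & chi = \sum_(p < N.+1) (-1) ^+ p * (b p)%:Z].

(* The cohomology of a projective variety is finite dimensional, hence
   [is_euler_char] holds for exactly one integer. *)
Definition euler_char : int := epsilon (inhabits (0 : int)) is_euler_char.

End EulerChar.

Section Grassmannian.
Context {k : fieldType} {n : nat} {Q : quiver n}.
Variables (V : rep k Q) (e : 'I_n -> nat).

Definition subspaces := {dffun forall r : 'I_n, {vspace 'rV[k]_(rdim V r)}}.

Definition is_subrep (W : subspaces) : bool :=
  [forall i, forall j, forall a : 'I_(Q i j),
     (linfun (mulmxr (rmap V a)) @: W i <= W j)%VS].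

Definition gr_pt :=
  {W : subspaces | is_subrep W && [forall r, \dim (W r) == e r]}.

(* A choice of bases: the rows of [A r] form a basis of the subspace at [r]. *)
Definition frame := forall r : 'I_n, 'M[k]_(e r, rdim V r).

Definition frame_of (A : frame) (W : gr_pt) : Prop :=
  forall r, val W r = <<[seq row a (A r) | a <- enum 'I_(e r)]>>%VS.

Definition frame_var := {r : 'I_n & ('I_(e r) * 'I_(rdim V r))%type}.

Definition frame_eval (h : {mpoly k[#|{: frame_var}|]}) (A : frame) : k :=
  h.@[fun s => let v := enum_val s in A (tag v) (tagged v).1 (tagged v).2].

(* The Grassmannian is the quotient of the variety of frames by the product of
   the groups GL_(e r): open subsets and regular functions are those which are
   so after pullback to the frames. *)
Definition gr_open (D : gr_pt -> Prop) : Prop :=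
  forall W A, D W -> frame_of A W ->
  exists h, frame_eval h A != 0 /\
    forall W' A', frame_of A' W' -> frame_eval h A' != 0 -> D W'.

Definition gr_regular (D : gr_pt -> Prop) (f : gr_pt -> k) : Prop :=
  forall W A, D W -> frame_of A W ->
  exists g h, frame_eval h A != 0 /\
    forall W' A', D W' -> frame_of A' W' -> frame_eval h A' != 0 ->
      f W' = frame_eval g A' / frame_eval h A'.

Definition quiver_grassmannian : variety k := Variety gr_open gr_regular.

End Grassmannian.

Definition euler_form (n : nat) (Q : quiver n) (a b : 'I_n -> int) : int :=
  \sum_i a i * b i - \sum_i \sum_j (Q i j)%:Z * (a i * b j).

Definition simple_dim (n : nat) (r : 'I_n) : 'I_n -> int :=
  fun i => (i == r)%:Z.

Definition char_module (k : fieldType) (n : nat) (Q : quiver n) (l : nat)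
    (V : rep k Q) : ratfun n :=
  let d := rdim V in
  \sum_(e : {dffun forall r : 'I_n, 'I_(d r).+1})
    (euler_char l (quiver_grassmannian V (fun r => nat_of_ord (e r))))%:~R *
    \prod_(r < n)
      (rvar (vx r) ^
         (- euler_form Q (fun i => (e i)%:Z) (simple_dim r)
          - euler_form Q (simple_dim r) (fun i => (d i)%:Z - (e i)%:Z))
       * rvar (vy r) ^+ e r * rvar (vz r) ^+ (d r - e r)).

Definition cluster_character (k : fieldType) (n l : nat) (T : cobject k n) :
    ratfun n :=
  match T with
  | CMod V _ => char_module l V
  | CShift i => rvar (vx i)
  end.

(* Main.v *)
Require Import Defs.
From Stdlib Require Import ClassicalEpsilon.
From mathcomp Require Import all_boot all_order all_algebra.
From mathcomp Require Import mpoly.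
From mathcomp Require Import zify ring.

(** Both sides of the equivalence are computed explicitly: they consist of the
    x_i and of one Laurent polynomial for each interval [a, b) of vertices.

    The vertices are numbered from 0 to n - 1.

    _The cluster characters._  Let V be an indecomposable representation of the
    linear quiver.  Choose a the lowest vertex with V_a <> 0, a linear form on
    V_a, and b the highest vertex on which the transported form is nonzero;
    the interval module between a and b is then a direct summand of V, hence is
    V ([indecomposable_interval]).  The Grassmannian of submodules of a given
    dimension vector e of an interval module is a point if e is the indicator
    function of a lower part [a, c), and is empty otherwise.  On such a variety
    the Cech complexes can be computed on a single covering, so that the Euler
    characteristic is 1 or 0 ([euler_char_point], [euler_char_empty]), and the
    cluster character is a sum of b - a + 1 monomials
    ([char_module_interval]).

    _Rigidity._  All indecomposable objects are rigid ([interval_rigid]).  The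
    interval module [a, b) is resolved by the projectives P_(a-1) -> P_(b-1),
    and the Nakayama functor sends this resolution to I_(a-1) -> I_(b-1); this
    computes the functor F = tau^-1 [1] on intervals, and the whole orbit of
    T[1].  A morphism T -> F^i (T[1]) is represented by a chain map from the
    two-term resolution of T, and this chain map is already zero, since its
    components take values in spaces of dimension 0.

    _The cluster variables._  The vertices 0, ..., n + 2 of a polygon are used
    to index the diagonals (p, q).  Put lambda (0, q) = x_(q-2) (with the value
    1 if (0, q) is a side of the polygon), and lambda (p, q) = lambda (0, p)
    lambda (0, q) (S_q - S_p), where S_q is a partial sum of a series of Laurent
    monomials: these elements satisfy the Ptolemy relations.  Each frozen
    variable f comes with an integral function g_f on diagonals which satisfies
    the tropical Ptolemy relations
    g(ac) + g(bd) = min (g(ab) + g(cd), g(ad) + g(bc)), and the element attached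
    to (p, q) is lambda (p, q) divided by the product of the f ^ g_f(p, q).
    Seeds correspond to triangulations.  For a diagonal ac in the quadrilateral
    abcd the number of arrows to a vertex w, frozen or not, minus the number of
    arrows from w is the tropical cross-ratio
    g_w(ab) + g_w(cd) - g_w(ad) - g_w(bc), where g_w for a non-frozen w is the
    indicator function of the diagonal w.  Mutations are flips:
    [triangulated_flip] shows that this description is preserved, because the
    tropical relation accounts for the mutation of the arrows and the usual
    relation for the exchange relation.
    The initial seed is the fan of the diagonals (0, q), and successive flips
    lead from it to each diagonal (p, q) ([cluster_variable_chord]).  The
    element attached to (a + 1, b + 2) is the cluster character of [a, b). *)

Set Implicit Arguments.
Unset Strict Implicit.
Unset Printing Implicit Defensive.

Import Order.TTheory GRing.Theory Num.Theory.
Local Open Scope ring_scope.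

(** * Matrices of size at most one, and representations of the linear quiver *)

(** Case analysis on a boolean that may occur in the dimension of a matrix,
    where it must not be abstracted. *)
Lemma bool_or_not (b : bool) : b \/ ~~ b.
Proof. by case: b; [left|right]. Qed.

Section EntrySum.
Variable k : fieldType.

(** For matrices with at most one row and one column the sum of the entries is
    an injective and multiplicative invariant; it replaces an equation between
    matrices, whose dimensions are not syntactically 0 or 1, by an equation
    between scalars. *)
Definition entry_sum m n (A : 'M[k]_(m, n)) : k := \sum_i \sum_j A i j.

Lemma entry_sumD m n (A B : 'M[k]_(m, n)) : entry_sum (A + B) = entry_sum A + entry_sum B.
Proof.
rewrite /entry_sum -big_split; apply: eq_bigr => i _; rewrite -big_split.
by apply: eq_bigr => j _; rewrite mxE.
Qed.

Lemma entry_sumZ m n c (A : 'M[k]_(m, n)) : entry_sum (c *: A) = c * entry_sum A.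
Proof.
rewrite /entry_sum mulr_sumr; apply: eq_bigr => i _; rewrite mulr_sumr.
by apply: eq_bigr => j _; rewrite mxE.
Qed.

Lemma entry_sum0 m n : entry_sum (0 : 'M[k]_(m, n)) = 0.
Proof. by rewrite -(scale0r 0) entry_sumZ mul0r. Qed.

Lemma entry_sum_const m n c : entry_sum (const_mx c : 'M[k]_(m, n)) = c *+ (m * n).
Proof.
rewrite /entry_sum; under eq_bigr do under eq_bigr do rewrite mxE.
by rewrite !sumr_const !card_ord -mulrnA mulnC.
Qed.

Lemma entry_sum_const1 m n c : m = 1%N -> n = 1%N ->
  entry_sum (const_mx c : 'M[k]_(m, n)) = c.
Proof. by move=> -> ->; rewrite entry_sum_const. Qed.

(** If the middle dimension is 0, both sides vanish. *)
Lemma entry_sumM m s n (A : 'M[k]_(m, s)) (B : 'M[k]_(s, n)) :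
  (s <= 1)%N -> entry_sum (A *m B) = entry_sum A * entry_sum B.
Proof.
case: s A B => [|[|//]] A B _.
  by rewrite (flatmx0 B) mulmx0 !entry_sum0 mulr0.
rewrite /entry_sum mulr_suml; apply: eq_bigr => i _.
rewrite big_ord1 big_ord1 mulr_sumr; apply: eq_bigr => j _.
by rewrite mxE big_ord1.
Qed.

Lemma entry_sum_inj m n (A B : 'M[k]_(m, n)) :
  (m <= 1)%N -> (n <= 1)%N -> entry_sum A = entry_sum B -> A = B.
Proof.
case: m A B => [|[|//]] A B _; first by rewrite (flatmx0 A) (flatmx0 B).
case: n A B => [|[|//]] A B _; first by rewrite (thinmx0 A) (thinmx0 B).
rewrite /entry_sum !big_ord1 => AB; apply/matrixP => i j.
by rewrite !ord1.
Qed.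

Lemma const_mulmx m s n :
  (const_mx 1 : 'M[k]_(m, s)) *m (const_mx 1 : 'M[k]_(s, n)) = const_mx s%:R.
Proof.
apply/matrixP => i j; rewrite !mxE.
under eq_bigr do rewrite !mxE mulr1.
by rewrite sumr_const card_ord.
Qed.

Lemma empty_row m n (A : 'M[k]_(m, n)) : m = 0%N -> A = 0.
Proof. by move=> m0; move: A; rewrite m0 => A; rewrite (flatmx0 A). Qed.

Lemma empty_col m n (A : 'M[k]_(m, n)) : n = 0%N -> A = 0.
Proof. by move=> n0; move: A; rewrite n0 => A; rewrite (thinmx0 A). Qed.

Lemma const_mul_eq0 m s n (A : 'M[k]_(s, n)) :
  (const_mx 1 : 'M_(m, s)) *m A = 0 -> (0 < m)%N -> (s <= 1)%N -> A = 0.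
Proof.
case: m => // m; case: s A => [|[|//]] A; first by rewrite (flatmx0 A).
move=> /matrixP A0 _ _; apply/matrixP => i j; have := A0 ord0 j.
by rewrite !mxE big_ord1 mxE mul1r (ord1 i).
Qed.

Lemma scalar_const m : m = 1%N -> (1%:M : 'M[k]_m) = const_mx 1.
Proof. by move=> ->; apply/matrixP => i j; rewrite !ord1 !mxE. Qed.

Lemma entry_sum1 m : m = 1%N -> entry_sum (1%:M : 'M[k]_m) = 1.
Proof. by move=> m1; rewrite scalar_const // entry_sum_const1. Qed.

Lemma ord_true (c : bool) (i : 'I_c) : c.
Proof. by case: c i => // -[]. Qed.

End EntrySum.

Section LinearReps.
Context {k : fieldType} {n : nat}.
Local Notation Q := (linearA n).
Implicit Types (V M N L : rep k Q) (S T : nat -> bool).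

(** Summing over the arrows gives a matrix for every pair of vertices, without
    naming an arrow; there is at most one arrow between two vertices. *)
Definition arrow_mx V (i j : 'I_n) : 'M[k]_(rdim V i, rdim V j) :=
  \sum_(a < linearA n i j) rmap V a.

Lemma arrow_mxE V i j (a : 'I_(linearA n i j)) : rmap V a = arrow_mx V i j.
Proof.
rewrite /arrow_mx (bigD1 a) //= big1 ?addr0 // => b /eqP[]; apply/ord_inj.
have le1 : (linearA n i j <= 1)%N := leq_b1 _.
by have := ltn_ord a; have := ltn_ord b; lia.
Qed.

Lemma arrow_exists (i j : 'I_n) : i = j.+1 :> nat -> inhabited 'I_(Q i j).
Proof. by move=> ij; rewrite /linearA ij eqxx; exact: inhabits ord0. Qed.

Lemma is_morE M N (f : Defs.family M N) :
  is_mor f <-> forall i j : 'I_n, i = j.+1 :> nat ->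
    arrow_mx M i j *m f j = f i *m arrow_mx N i j.
Proof.
split=> [fP i j /arrow_exists[a]|fP i j a].
  by rewrite -!(arrow_mxE _ a) fP.
rewrite !arrow_mxE; apply: fP; have := ltn_ord a.
by rewrite {2}/linearA; case: eqP.
Qed.

(** All modules and complexes that have to be constructed have dimension at
    most one at each vertex; S is the set of vertices of dimension one. *)
Definition thin S : rep k Q :=
  Rep (fun j => nat_of_bool (S j)) (fun _ _ _ => const_mx 1).

Lemma arrow_mx_thin S (i j : 'I_n) : i = j.+1 :> nat ->
  arrow_mx (thin S) i j = const_mx 1.
Proof. by move=> /arrow_exists[a]; rewrite -(arrow_mxE _ a). Qed.

Lemma thin_const_mor S T :
  (forall j, S j.+1 -> T j -> S j = T j.+1) ->
  is_mor (M := thin S) (N := thin T) (fun _ => const_mx 1).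
Proof.
move=> ST; apply/is_morE => i j ij; rewrite !arrow_mx_thin // !const_mulmx /=.
have := ST j; rewrite -ij => STj; apply/matrixP => a b; rewrite !mxE.
by rewrite /= STj // ?(ord_true a) ?(ord_true b).
Qed.

Lemma row_mor S L (w : forall j, 'rV[k]_(rdim L j)) :
  (forall i j : 'I_n, i = j.+1 :> nat -> S i ->
     w i *m arrow_mx L i j = (S j)%:R *: w j) ->
  is_mor (M := thin S) (N := L) (fun j => const_mx 1 *m w j).
Proof.
move=> wP; apply/is_morE => i j ij.
rewrite arrow_mx_thin // mulmxA const_mulmx -mulmxA /=.
have [Si|nSi] := boolP (S i); last by rewrite !(@empty_row _ _ _ (_ *m _)) //= (negbTE nSi).
rewrite wP // -scalemxAr scalemxAl; congr (_ *m _).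
by apply/matrixP=> a b; rewrite !mxE mulr1.
Qed.

Lemma col_mor S V (u : forall j, 'cV[k]_(rdim V j)) :
  (forall i j : 'I_n, i = j.+1 :> nat -> S j ->
     arrow_mx V i j *m u j = (S i)%:R *: u i) ->
  is_mor (M := V) (N := thin S) (fun j => u j *m const_mx 1).
Proof.
move=> uP; apply/is_morE => i j ij.
rewrite arrow_mx_thin // -mulmxA const_mulmx mulmxA /=.
have [Sj|nSj] := boolP (S j); last by rewrite !(@empty_col _ _ _ (_ *m _)) //= (negbTE nSj).
rewrite uP // -scalemxAl scalemxAr; congr (_ *m _).
by apply/matrixP=> a b; rewrite !mxE mulr1.
Qed.

(** Yoneda: a vector at the vertex t is transported along the paths starting
    at t, and so defines a morphism from the projective P_t. *)
Lemma path_rows L (t : 'I_n) (v : 'rV[k]_(rdim L t)) :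
  exists w : forall j, 'rV[k]_(rdim L j), w t = v /\
    forall i j : 'I_n, i = j.+1 :> nat -> (i <= t)%N -> w i *m arrow_mx L i j = w j.
Proof.
case: t v => t; elim: t => [|t IH] tn v.
  exists (dfwith (fun j => 0 : 'rV[k]_(rdim L j)) v); split; first by rewrite dfwith_in.
  by move=> i j -> .
have [w [wt wP]] := IH (ltnW tn) (v *m arrow_mx L _ _).
exists (dfwith w v); split; first by rewrite dfwith_in.
move=> i j ij /= it.
have nj : Ordinal tn != j by apply/eqP=> /(congr1 val) /= ?; lia.
rewrite [RHS]dfwith_out //.
have [Ei|ni] := eqVneq (Ordinal tn) i.
  subst i; rewrite dfwith_in; suff -> : j = Ordinal (ltnW tn) by rewrite wt.
  by apply/val_inj => /=; move: ij => /=; lia.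
rewrite dfwith_out // wP //.
have : val i <> t.+1 by move=> H; move/eqP: ni; apply; apply/val_inj.
by move=> /=; lia.
Qed.

(** Dually, a linear form at t is transported to the vertices above t; the
    bound d serves for the induction. *)
Lemma path_cols_upto V (t : 'I_n) (v : 'cV[k]_(rdim V t)) (d : nat) :
  exists u : forall j, 'cV[k]_(rdim V j), u t = v /\
    forall i j : 'I_n, i = j.+1 :> nat -> (t <= j < d)%N -> arrow_mx V i j *m u j = u i.
Proof.
elim: d => [|d [u [ut uP]]].
  exists (dfwith (fun j => 0 : 'cV[k]_(rdim V j)) v); split; first by rewrite dfwith_in.
  by move=> i j _ ; rewrite ltn0 andbF.
have [/andP[td dn]|ntd] := boolP ((t <= d) && (d.+1 < n))%N; last first.
  exists u; split=> // i j ij tj; apply: uP => //.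
  by have := ltn_ord i; lia.
pose dj : 'I_n := Ordinal (ltnW dn); pose di : 'I_n := Ordinal dn.
exists (dfwith u (arrow_mx V di dj *m u dj)); split.
  by rewrite dfwith_out //; apply/eqP => /(congr1 val) /=; lia.
move=> i j ij tj.
have nj : di != j by apply/eqP=> /(congr1 val) /= ?; lia.
rewrite dfwith_out //.
have [Ei|ni] := eqVneq di i.
  subst i; rewrite dfwith_in; suff -> : j = dj by [].
  by apply/val_inj => /=; move: ij => /=; lia.
rewrite dfwith_out // uP //.
have : val i <> d.+1 by move=> H; move/eqP: ni; apply; apply/val_inj.
by move=> /=; lia.
Qed.

(** The arrows of P_t are isomorphisms, so the value of a morphism at i + 1
    determines its value at i. *)
Lemma thin_mor_eq0 (t : 'I_n) S L (f : Defs.family (thin S) L) :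
  (forall j, S j = (j <= t)%N) -> is_mor f -> f t = 0 -> forall i, f i = 0.
Proof.
move=> St /is_morE fP ft i.
have [it|ti] := leqP i t; last by apply: empty_row; rewrite /= St leqNgt ti.
have [d Hd] : exists d, (t = i + d :> nat)%N by exists (t - i)%N; lia.
elim: d i it Hd => [|d IH] i it Hd.
  suff -> : i = t by [].
  by apply/val_inj; rewrite /= Hd addn0.
have it' : (i.+1 <= t)%N by lia.
pose i' : 'I_n := Ordinal (leq_ltn_trans it' (ltn_ord t)).
have fi' : f i' = 0 by apply: IH; rewrite //= addSnnS.
have := fP i' i erefl; rewrite fi' mul0mx.
rewrite arrow_mx_thin // => /const_mul_eq0; apply; last exact: leq_b1.
by rewrite /= St it'.
Qed.

End LinearReps.

(** * The Nakayama functor on two-term complexes of projectives *)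

Section ThinComplexes.
Context {k : fieldType} {n : nat}.
Local Notation Q := (linearA n).
Implicit Types (V M N L : rep k Q) (X Y Z : cpx k Q).

Section ThinComplex.
Variable S : int -> nat -> bool.
Hypothesis S_mor : forall p j, S p j.+1 -> S (p + 1) j -> S p j = S (p + 1) j.+1.
Hypothesis S_diff : forall p j, S p j -> S (p + 1) j -> S (p + 1 + 1) j -> False.
Hypothesis S_bound : exists B : nat, forall p : int, (B < `|p|)%N -> forall j, S p j = false.

Let thin_diff p : mor (thin (k := k) (n := n) (S p)) (thin (S (p + 1))) :=
  Mor (thin_const_mor (S_mor (p := p))).

Lemma thin_diffK p i : thin_diff p i *m thin_diff (p + 1) i = 0.
Proof.
rewrite /= const_mulmx; apply/matrixP => a c; rewrite !mxE.
case E: (S (p + 1) i) => //.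
case: (S_diff (ord_true a) E (ord_true c)).
Qed.

Lemma thin_bound :
  exists B : nat, forall p : int, (B < `|p|)%N -> is_zero (thin (k := k) (n := n) (S p)).
Proof. by have [B HB] := S_bound; exists B => p Hp i; rewrite /= HB. Qed.

Definition thin_cpx : cpx k Q := Cpx thin_diffK thin_bound.
End ThinComplex.

(** The shape of a complex with two consecutive terms; the value l + 1 stands
    for P_l or I_l and the value 0 for the zero module. *)
Definition two_term (q : int) (a b : nat) (p : int) : nat :=
  if p == q then a else if p == q + 1 then b else 0%N.

Section Resolution.
Variables (q : int) (a b : nat).
Hypothesis ab : (a < b <= n)%N.

Local Notation m := (two_term q a b).

Lemma two_term_bound :
  exists B : nat, forall p : int, (B < `|p|)%N -> m p = 0%N.
Proof.
exists (`|q| + 2)%N => p; rewrite /two_term.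
by case: (p =P q) => ?; [lia|case: (p =P q + 1) => ?; lia].
Qed.

Lemma two_term_spec p :
  [\/ [/\ p = q, m p = a, m (p + 1) = b & m (p + 1 + 1) = 0%N],
      [/\ p = q + 1, m p = b & m (p + 1) = 0%N],
      [/\ p + 1 = q, m p = 0%N & m (p + 1) = a]
    | [/\ m p = 0%N, m (p + 1) = 0%N, p <> q & p <> q + 1]].
Proof.
rewrite /two_term.
case: (p =P q) => [->|npq].
  constructor 1; split=> //.
    by case: (q + 1 =P q) => ?; [lia|rewrite eqxx].
  by case: (q + 1 + 1 =P q) => ?; [lia|case: (q + 1 + 1 =P q + 1) => ? //; lia].
case: (p =P q + 1) => [->|npq1].
  constructor 2; split=> //.
  by case: (q + 1 + 1 =P q) => ?; [lia|case: (q + 1 + 1 =P q + 1) => ? //; lia].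
case: (p + 1 =P q) => [E|npq2]; first by constructor 3.
by constructor 4; split=> //; case: (p + 1 =P q + 1) => ? //; lia.
Qed.

Lemma two_term_le p s t : m p = s.+1 -> m (p + 1) = t.+1 -> (s <= t)%N.
Proof. by case: (two_term_spec p) => -[]; lia. Qed.

Definition proj_set p (j : nat) := (j < m p)%N.
Definition inj_set p (j : nat) := (0 < m p <= j.+1)%N.

Lemma proj_set_mor p j :
  proj_set p j.+1 -> proj_set (p + 1) j -> proj_set p j = proj_set (p + 1) j.+1.
Proof. by rewrite /proj_set; case: (two_term_spec p) => -[]; lia. Qed.

Lemma proj_set_diff p j :
  proj_set p j -> proj_set (p + 1) j -> proj_set (p + 1 + 1) j -> False.
Proof. by rewrite /proj_set; case: (two_term_spec p) => -[]; lia. Qed.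

Lemma proj_set_bound : exists B : nat, forall p : int, (B < `|p|)%N ->
  forall j, proj_set p j = false.
Proof.
have [B HB] := two_term_bound; exists B => p /HB Hp j.
by rewrite /proj_set Hp.
Qed.

Definition proj_cpx : cpx k Q :=
  thin_cpx proj_set_mor proj_set_diff proj_set_bound.

Lemma inj_set_mor p j :
  inj_set p j.+1 -> inj_set (p + 1) j -> inj_set p j = inj_set (p + 1) j.+1.
Proof. by rewrite /inj_set; case: (two_term_spec p) => -[]; lia. Qed.

Lemma inj_set_diff p j :
  inj_set p j -> inj_set (p + 1) j -> inj_set (p + 1 + 1) j -> False.
Proof. by rewrite /inj_set; case: (two_term_spec p) => -[]; lia. Qed.

Lemma inj_set_bound : exists B : nat, forall p : int, (B < `|p|)%N ->
  forall j, inj_set p j = false.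
Proof.
have [B HB] := two_term_bound; exists B => p /HB Hp j.
by rewrite /inj_set Hp.
Qed.

Definition inj_cpx : cpx k Q :=
  thin_cpx inj_set_mor inj_set_diff inj_set_bound.

Lemma two_term_top p : m p = 0%N \/ exists t : 'I_n, m p = t.+1.
Proof.
case E: (m p) => [|t]; [by left|right].
have tn : (t < n)%N.
  by case: (two_term_spec p) => -[]; lia.
by exists (Ordinal tn).
Qed.

(** By Yoneda Hom(P_t, P_j) is the space of P_j at t, so that a morphism phi
    is identified with the scalar entry_sum (phi t); the space of I_t at j is
    then its dual, as both are nonzero exactly if t <= j. *)
Definition nu_pairing p (j : 'I_n) (phi : Defs.family (cobj proj_cpx p) (proj_mod j))
    (y : 'rV[k]_(rdim (cobj inj_cpx p) j)) : k :=
  (\sum_(t < n | m p == t.+1) entry_sum (phi t)) * entry_sum y.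

Lemma nu_pairing0 p j (phi : Defs.family (cobj proj_cpx p) (proj_mod j)) y :
  m p = 0%N -> nu_pairing phi y = 0.
Proof. by rewrite /nu_pairing => ->; rewrite big_pred0 ?mul0r. Qed.

Lemma nu_pairingE (t : 'I_n) p j (phi : Defs.family (cobj proj_cpx p) (proj_mod j)) y :
  m p = t.+1 -> nu_pairing phi y = entry_sum (phi t) * entry_sum y.
Proof.
move=> E; by rewrite /nu_pairing E (big_pred1 t) // => i; rewrite eqSS eq_sym.
Qed.

Lemma dim_top (t : 'I_n) p : m p = t.+1 -> rdim (cobj proj_cpx p) t = 1%N.
Proof. by move=> E; rewrite /= /proj_set E ltnSn. Qed.

Lemma dim_proj (i j : 'I_n) : (i <= j)%N -> rdim (proj_mod (k := k) j) i = 1%N.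
Proof. by move=> /= ->. Qed.

Lemma dim_inj (t j : 'I_n) p : m p = t.+1 ->
  rdim (cobj inj_cpx p) j = (t <= j)%N :> nat.
Proof. by move=> E; rewrite /= /inj_set E ltnS. Qed.

Lemma proj_mor_eq0 (t : 'I_n) p L (phi : Defs.family (cobj proj_cpx p) L) :
  m p = t.+1 -> is_mor phi -> phi t = 0 -> forall i, phi i = 0.
Proof. by move=> E; apply: thin_mor_eq0 => j; rewrite /proj_set E. Qed.

Lemma proj_mor_const (t s : 'I_n) p j (phi : Defs.family (cobj proj_cpx p) (proj_mod j)) :
  m p = t.+1 -> is_mor phi -> (s <= t <= j)%N -> entry_sum (phi s) = entry_sum (phi t).
Proof.
move=> E fP /andP[st tj].
pose psi : Defs.family (cobj proj_cpx p) (proj_mod j) :=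
  fun i => phi i - const_mx (entry_sum (phi t)).
have psiP : is_mor psi.
  apply/is_morE => i i' ii'; rewrite mulmxBr mulmxBl; congr (_ - _).
    by rewrite ((is_morE _).1 fP).
  rewrite -[entry_sum _]mulr1 -!(scalemx_const) -scalemxAl -scalemxAr; congr (_ *: _).
  have cP : is_mor (M := cobj proj_cpx p) (N := proj_mod j) (fun _ => const_mx 1).
    apply: (@thin_const_mor k n (proj_set p) (fun i => i <= j)%N) => u.
    by rewrite /proj_set E; lia.
  exact: ((is_morE _).1 cP).
have psi0 : psi t = 0.
  apply: entry_sum_inj; rewrite ?leq_b1 // entry_sumD -scaleN1r entry_sumZ entry_sum0.
  by rewrite entry_sum_const1 ?dim_top ?dim_proj // mulN1r subrr.
have := proj_mor_eq0 E psiP psi0 s => /(congr1 (@entry_sum _ _ _)).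
rewrite entry_sumD -scaleN1r entry_sumZ entry_sum0 entry_sum_const1 ?dim_proj ?(leq_trans st tj) //.
  by rewrite mulN1r => /eqP; rewrite subr_eq0 => /eqP.
by rewrite /= /proj_set E ltnS st.
Qed.

(** The verifications are the same in each case: for m p = t + 1 both arguments
    of the pairing are scalars, and they vanish together if t > j. *)
Lemma nakayama_proj_inj : nakayama proj_cpx inj_cpx.
Proof.
exists nu_pairing; split.
- move=> p j c phi psi y _ _; rewrite /nu_pairing mulrA -mulrDl; congr (_ * _).
  by rewrite mulr_sumr -big_split; apply: eq_bigr => i _ /=; rewrite entry_sumD entry_sumZ.
- by move=> p j c phi y z _; rewrite /nu_pairing entry_sumD entry_sumZ mulrDr mulrCA.
- move=> p j; have [E|[t E]] := two_term_top p.
    split=> [y _|phi _ _ i].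
      by apply: empty_col; rewrite /= /inj_set E.
    by apply: empty_row; rewrite /= /proj_set E.
  have [tj|jt] := leqP t j; last first.
    split=> [y _|phi phiP _ i].
      by apply: empty_col; rewrite /= /inj_set E; lia.
    by apply: proj_mor_eq0 E phiP _ _; apply: empty_col; rewrite /= leqNgt jt.
  split=> [y y0|phi phiP phi0 i].
    apply: entry_sum_inj; rewrite ?leq_b1 // entry_sum0.
    have := y0 (fun _ => const_mx 1); rewrite (nu_pairingE _ _ E) entry_sum_const1 ?dim_top
      ?dim_proj // mul1r; apply.
    by apply: (@thin_const_mor k n (proj_set p) (fun i => i <= j)%N) => i; rewrite /proj_set E; lia.
  apply: (proj_mor_eq0 E phiP); apply: entry_sum_inj; rewrite ?leq_b1 // entry_sum0.
  have := phi0 (const_mx 1); rewrite (nu_pairingE _ _ E) (@entry_sum_const1 _ _ (rdim _ _))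
    ?(dim_inj _ E) ?tj //.
  by rewrite mulr1.
- move=> p j l a0 phi y phiP; have [E|[t E]] := two_term_top p.
    by rewrite !nu_pairing0.
  have jl : j = l.+1 :> nat.
    by have := ltn_ord a0; rewrite {2}/linearA; case: eqP.
  rewrite !(nu_pairingE _ _ E) /comp_fam /proj_incl /= !entry_sumM ?leq_b1 // -mulrA.
  congr (_ * _); rewrite !entry_sum_const mulrC; congr (_ * _); congr (_ *+ _).
  by rewrite /inj_set E; lia.
- move=> p j phi y phiP; have [E|[t E]] := two_term_top (p + 1).
    rewrite nu_pairing0 //; have [E'|[t E']] := two_term_top p.
      by rewrite nu_pairing0.
    rewrite (nu_pairingE _ _ E') (_ : comp_fam _ _ _ = 0) ?entry_sum0 ?mul0r //.
    rewrite /comp_fam (_ : phi t = 0) ?mulmx0 //.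
    by apply: empty_row; rewrite /= /proj_set E.
  have [E'|[s E']] := two_term_top p.
    rewrite (nu_pairing0 _ _ E') (_ : y = 0) ?mul0mx ?/nu_pairing ?entry_sum0 ?mulr0 //.
    by apply: empty_col; rewrite /= /inj_set E'.
  have st : (s <= t)%N := two_term_le E' E.
  rewrite (nu_pairingE _ _ E) (nu_pairingE _ _ E') /comp_fam /= !entry_sumM ?leq_b1 //.
  rewrite (@entry_sum_const1 _ (proj_set p s)); try by rewrite /proj_set ?E ?E' ltnS ?st ?leqnn.
  rewrite mul1r (mulrC (entry_sum y)) mulrA; congr (_ * _).
  have [tj|jt] : (t <= j)%N \/ (j < t)%N by case: (leqP t j); [left|right].
    rewrite (@proj_mor_const _ s _ _ _ E phiP) ?st // entry_sum_const1 ?mulr1 //.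
      by rewrite /inj_set E'; lia.
    by rewrite /inj_set E; lia.
  have phi0 : phi t = 0 by apply: empty_col; rewrite /= leqNgt jt.
  by rewrite (proj_mor_eq0 E phiP phi0 s) phi0 !entry_sum0 !mul0r.
Qed.

End Resolution.
End ThinComplexes.

(** * Interval modules, their resolutions and coresolutions *)

Section QuasiIso.
Context {k : fieldType} {n : nat} {Q : quiver n}.
Implicit Types X Y Z : cpx k Q.

(** One of the implications of the two-out-of-three property. *)
Lemma quasi_iso_cancel X Y Z (f : cmap X Y) (g : cmap Y Z) :
  quasi_iso g -> quasi_iso (comp_cmap f g) -> quasi_iso f.
Proof.
move=> gP fgP p i; have [g1 g2] := gP p i; have [fg1 fg2] := fgP p i; split.
  move=> v vd [w vw]; apply: fg1 => //; exists (w *m g p i).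
  by rewrite /= /comp_fam mulmxA vw -!mulmxA (cfunP g).
move=> w wd; have wgd : w *m g (p + 1) i *m cdiff Z (p + 1) i = 0.
  by rewrite -mulmxA (cfunP g) mulmxA wd mul0mx.
have [v [vd [u wv]]] := fg2 _ wgd.
have rd : (w - v *m f (p + 1) i) *m cdiff Y (p + 1) i = 0.
  by rewrite mulmxBl wd -mulmxA (cfunP f) mulmxA vd mul0mx subrr.
have [|s ws] := g1 _ rd.
  by exists u; rewrite mulmxBl wv /= /comp_fam mulmxA [LHS]addrAC subrr add0r.
by exists v; split=> //; exists s; rewrite -ws [RHS]addrC subrK.
Qed.

Definition id_mor (M : rep k Q) : mor M M.
Proof. by exists (fun i => 1%:M) => i j a; rewrite mulmx1 mul1mx. Defined.

Definition id_cmap X : cmap X X.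
Proof. by exists (fun p => id_mor (cobj X p)) => p i /=; rewrite mulmx1 mul1mx. Defined.

Lemma quasi_iso_id X : quasi_iso (id_cmap X).
Proof.
move=> p i; split=> [v _ [w]|w wd]; first by rewrite /= mulmx1; exists w.
by exists w; split=> //; exists 0; rewrite /= mulmx1 mul0mx addr0.
Qed.

Lemma derived_iso_right X Y (f : cmap X Y) : quasi_iso f -> derived_iso X Y.
Proof. by move=> fP; exists (Roof (quasi_iso_id X) f). Qed.

Lemma derived_iso_left X Y (f : cmap Y X) : quasi_iso f -> derived_iso X Y.
Proof. by move=> fP; exists (Roof fP (id_cmap Y)); exact: quasi_iso_id. Qed.

End QuasiIso.

Section Intervals.
Context {k : fieldType} {n : nat}.
Local Notation Q := (linearA n).
Implicit Types (V M N L : rep k Q) (X Y Z : cpx k Q).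

(** The generator at t is lifted through the epimorphism, and its transport
    along the paths gives the lift; the two morphisms to be compared agree on
    the generator. *)
Lemma thin_projective (t : 'I_n) S : (forall j, S j = (j <= t)%N) ->
  projective (thin (k := k) (n := n) S).
Proof.
move=> St M N g f gP.
have /row_fullP[G Gg] := gP t.
have dt : rdim (thin (k := k) (n := n) S) t = 1%N by rewrite /= St leqnn.
have [w [wt wP]] := path_rows (const_mx 1 *m f t *m G).
have hP : is_mor (M := thin S) (fun j => const_mx 1 *m w j).
  apply: row_mor => i j ij; rewrite St => it.
  by rewrite wP // St (_ : (j <= t)%N) ?scale1r //; lia.
exists (Mor hP) => i; apply/eqP; rewrite -subr_eq0; apply/eqP.
move: i; apply: (thin_mor_eq0 St (f := fun i => const_mx 1 *m w i *m g i - f i)).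
  apply/is_morE => i j ij; rewrite mulmxBr mulmxBl; congr (_ - _).
    rewrite mulmxA ((is_morE _).1 hP) // -!mulmxA; congr (_ *m (_ *m _)).
    by rewrite ((is_morE _).1 (mfunP g)).
  by rewrite ((is_morE _).1 (mfunP f)).
rewrite wt -!mulmxA Gg mulmx1 mulmxA const_mulmx.
by rewrite -scalar_const // mul1mx subrr.
Qed.

Lemma zero_projective V : is_zero V -> projective V.
Proof.
move=> V0 M N g f _; exists (mor0 V M) => i.
by rewrite (empty_row (f i)) // mul0mx.
Qed.

Lemma proj_cpx_projective q a b (ab : (a < b <= n)%N) p :
  projective (cobj (proj_cpx (k := k) q ab) p).
Proof.
have [E|[t E]] := two_term_top q ab p.
  by apply: zero_projective => i; rewrite /= /proj_set E.
by apply: (@thin_projective t) => j; rewrite /proj_set E ltnS.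
Qed.

(** The rows w and the columns u are the coordinates of an isomorphism with the
    standard interval module [a, b).  In this form the property can be used
    without transporting complexes along isomorphisms. *)
Definition interval_rep V (a b : nat) : Prop :=
  (forall i : 'I_n, rdim V i = (a <= i < b)%N :> nat) /\
  exists (w : forall i, 'rV[k]_(rdim V i)) (u : forall i, 'cV[k]_(rdim V i)),
  [/\ forall i : 'I_n, (a <= i < b)%N -> w i *m u i = 1%:M,
      forall i j : 'I_n, i = j.+1 :> nat -> (a <= j)%N -> (i < b)%N ->
        w i *m arrow_mx V i j = w j
    & forall i j : 'I_n, i = j.+1 :> nat -> (a <= j)%N -> (i < b)%N ->
        arrow_mx V i j *m u j = u i].

Lemma interval_thin S a b : (forall j, (j < n)%N -> S j = (a <= j < b)%N) ->
  interval_rep (thin (k := k) (n := n) S) a b.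
Proof.
move=> Sab; split=> [i|]; first by rewrite /= Sab.
have D (i : 'I_n) : (a <= i < b)%N -> rdim (thin (k := k) (n := n) S) i = 1%N.
  by rewrite /= Sab // => ->.
exists (fun i => const_mx 1), (fun i => const_mx 1); split.
- move=> i /D di; rewrite const_mulmx di; apply/matrixP => x y; rewrite !mxE.
  by rewrite !ord1.
- move=> i j ij aj ib; rewrite arrow_mx_thin // const_mulmx.
  by apply/matrixP => x y; rewrite !mxE D //; lia.
- move=> i j ij aj ib; rewrite arrow_mx_thin // const_mulmx.
  by apply/matrixP => x y; rewrite !mxE D //; lia.
Qed.

Definition stalk_interval X (d : int) a b : Prop :=
  (forall p, p <> d -> is_zero (cobj X p)) /\ interval_rep (cobj X d) a b.

Lemma stalk_interval_shift X d a b :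
  stalk_interval X (d + 1) a b -> stalk_interval (shift X) d a b.
Proof.
move=> [X0 Xd]; split=> // p pd; apply: X0 => pd1; apply: pd.
exact: (addIr _ pd1).
Qed.

Lemma stalk_bound_at V (d : int) :
  exists N : nat, forall p : int, (N < `|p|)%N ->
    is_zero (if p == d then V else zero_rep).
Proof.
by exists `|d|%N => p pd; case: eqP => // pE; rewrite pE ltnn in pd.
Qed.

Definition stalk_at V (d : int) : cpx k Q :=
  Cpx (cobj := fun p => if p == d then V else zero_rep)
      (cdiff := fun p => mor0 _ _) (fun p i => mul0mx _ _) (stalk_bound_at V d).

Lemma stalk_interval_stalk_at V d a b :
  interval_rep V a b -> stalk_interval (stalk_at V d) d a b.
Proof.
move=> Vab; split=> [p /eqP /negbTE pd i|]; first by rewrite /= pd.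
by rewrite (_ : cobj _ _ = V) //= eqxx.
Qed.

Lemma stalk_interval_stalk V a b :
  interval_rep V a b -> stalk_interval (stalk V) 0 a b.
Proof.
move=> Vab; split=> [p /eqP /negbTE pd i|]; first by rewrite /= pd.
by rewrite (_ : cobj _ _ = V) //= eqxx.
Qed.

Section Resolve.
Variables (q : int) (a b : nat).
Hypothesis ab : (a < b <= n)%N.
Local Notation P := (proj_cpx (k := k) q ab).
Local Notation I := (inj_cpx (k := k) q ab).
Local Notation m := (two_term q a b).

(** P_(a-1) -> P_(b-1) is injective with cokernel the interval module [a, b), so
    a chain map to this module only has to be nonzero on the cokernel. *)
Lemma quasi_iso_from_proj X (g : cmap P X) :
  stalk_interval X (q + 1) a b ->
  (forall i : 'I_n, (a <= i < b)%N -> entry_sum (g (q + 1) i) <> 0) -> quasi_iso g.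
Proof.
move=> [X0 [Xdim _]] gne p i.
have [pq|npq] := eqVneq p q; last first.
  have Xp : rdim (cobj X (p + 1)) i = 0%N.
    by apply: X0 => H; move/eqP: npq; apply; exact: (addIr _ H).
  split=> [v vd _|w _]; last first.
    by exists 0; rewrite mul0mx; split=> //; exists 0; rewrite (empty_col w) // !mul0mx addr0.
  exists 0; rewrite mul0mx; apply: entry_sum_inj; rewrite ?leq_b1 // entry_sum0.
  have /(congr1 (@entry_sum _ _ _)) := vd.
  rewrite /= entry_sumM ?leq_b1 // entry_sum0 entry_sum_const /proj_set.
  case: (two_term_spec q ab p) => -[] H1 H2 H3 => [_|||_].
  - by rewrite H1 eqxx in npq.
  - move=> _; rewrite (empty_col v) ?entry_sum0 //.
    by rewrite /= /proj_set H3.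
  - have [ia|ai] := bool_or_not (i < a)%N.
      suff -> : ((i < m (p + 1)%R) * (i < m (p + 1 + 1)%R))%N = 1%N by rewrite mulr1.
      case: (two_term_spec q ab (p + 1)) => -[] //; try lia.
      move=> _ _ H4 _; rewrite H3 H4 ia; lia.
    move=> _; rewrite (empty_col v) ?entry_sum0 //.
    by rewrite /= /proj_set H3; move/negbTE: ai => ->.
  - move=> _; rewrite (empty_col v) ?entry_sum0 //.
    by rewrite /= /proj_set H2.
subst p.
have [ma mb m0] : [/\ m q = a, m (q + 1) = b & m (q + 1 + 1) = 0%N].
  by case: (two_term_spec q ab q) => -[] //; lia.
have Xq u : u *m cdiff X q i = 0.
  by rewrite (empty_row (cdiff X q i)) ?mulmx0 //; apply: X0; lia.
have Xi := Xdim i.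
have X1 : (rdim (cobj X (q + 1)%R) i <= 1)%N by rewrite Xi leq_b1.
split=> [v vd [w]|w _].
  rewrite Xq => vg.
  have [ib|bi] := bool_or_not (i < b)%N.
    have [ai|ia] : (a <= i)%N \/ (i < a)%N by case: (leqP a i); [left|right].
      exists 0; rewrite mul0mx; apply: entry_sum_inj; rewrite ?leq_b1 // entry_sum0.
      have /(congr1 (@entry_sum _ _ _)) := vg; rewrite entry_sumM ?leq_b1 // entry_sum0.
      by move/eqP; rewrite mulf_eq0 => /orP[/eqP //|/eqP/gne[]]; rewrite ai.
    exists (const_mx (entry_sum v)); apply: entry_sum_inj; rewrite ?leq_b1 //.
    have dq : rdim (cobj P q) i = 1%N by rewrite /= /proj_set ma ia.
    have dq1 : rdim (cobj P (q + 1)) i = 1%N by rewrite /= /proj_set mb ib.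
    by rewrite entry_sumM ?leq_b1 // !entry_sum_const1 // mulr1.
  exists 0; rewrite mul0mx; apply: empty_col.
  by rewrite /= /proj_set mb; move/negbTE: bi => ->.
have [iab|niab] := bool_or_not (a <= i < b)%N.
  exists (const_mx (entry_sum w / entry_sum (g (q + 1) i))); split.
    by rewrite (empty_col (cdiff P _ i)) ?mulmx0 //= /proj_set m0.
  exists 0; rewrite mul0mx addr0; apply: entry_sum_inj => //.
  rewrite entry_sumM ?leq_b1 // entry_sum_const1 //; last by rewrite /= /proj_set mb; lia.
  by rewrite divfK //; apply/eqP/gne.
exists 0; rewrite !mul0mx; split=> //; exists 0.
by rewrite mul0mx addr0; apply: empty_col; rewrite Xi; move/negbTE: niab => ->.
Qed.


Lemma two_term_mid : [/\ m q = a, m (q + 1) = b & m (q + 1 + 1) = 0%N].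
Proof. by case: (two_term_spec q ab q) => -[] //; lia. Qed.

Lemma two_term_out p : m p = 0%N \/ p = q \/ p = q + 1.
Proof. by case: (two_term_spec q ab p) => -[]; tauto. Qed.

(** By Yoneda a chain map from the complex P is given by the images w1 and w0 of
    the two generators, transported along the paths. *)
Lemma cmap_from_proj X (w1 : forall i, 'rV[k]_(rdim (cobj X q) i))
    (w0 : forall i, 'rV[k]_(rdim (cobj X (q + 1)) i)) :
  (forall i j : 'I_n, i = j.+1 :> nat -> (i < a)%N ->
     w1 i *m arrow_mx (cobj X q) i j = w1 j) ->
  (forall i j : 'I_n, i = j.+1 :> nat -> (i < b)%N ->
     w0 i *m arrow_mx (cobj X (q + 1)) i j = w0 j) ->
  (forall i : 'I_n, (i < a)%N -> w1 i *m cdiff X q i = w0 i) ->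
  (forall i : 'I_n, (i < b)%N -> w0 i *m cdiff X (q + 1) i = 0) ->
  exists g : cmap P X, (forall i, g q i = const_mx 1 *m w1 i) /\
                       (forall i, g (q + 1) i = const_mx 1 *m w0 i).
Proof.
move=> w1P w0P w1d w0d; have [ma mb m0] := two_term_mid.
pose T p := forall i, 'rV[k]_(rdim (cobj X p) i).
pose w : forall p, T p := dfwith (dfwith (fun p i => 0 : 'rV_(rdim (cobj X p) i)) w1) w0.
have wq1 : w (q + 1) = w0 by rewrite /w dfwith_in.
have wq : w q = w1.
  by rewrite /w dfwith_out ?dfwith_in //; apply/eqP; lia.
have wq2 i : w (q + 1 + 1) i = 0.
  by rewrite /w dfwith_out ?dfwith_out //; apply/eqP; lia.
have fP p : is_mor (M := cobj P p) (N := cobj X p) (fun i => const_mx 1 *m w p i).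
  apply: row_mor => i j ij; rewrite /proj_set => im.
  have jm : (j < m p)%N by lia.
  rewrite jm scale1r; have [E|[E|E]] := two_term_out p; first by rewrite E in im.
    by subst p; rewrite wq w1P // -ma.
  by subst p; rewrite wq1 w0P // -mb.
have gP : is_chain_map (fun p => Mor (fP p)).
  move=> p i /=; have [E|[E|E]] := two_term_out p.
  - by apply: etrans (esym _); apply: empty_row; rewrite /= /proj_set E.
  - subst p; rewrite wq wq1 mulmxA const_mulmx -mulmxA.
    have [ia|ai] := bool_or_not (i < a)%N.
      have d1 : proj_set q a b (q + 1) i = true by rewrite /proj_set mb; lia.
      by rewrite w1d // d1.
    by apply: etrans (esym _); apply: empty_row; rewrite /= /proj_set ma; move/negbTE: ai => ->.
  - subst p; rewrite wq1 wq2 !mulmx0 -mulmxA.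
    have [ib|bi] := bool_or_not (i < b)%N.
      by rewrite w0d // mulmx0.
    by apply: empty_row; rewrite /= /proj_set mb; move/negbTE: bi => ->.
by exists (CMap gP); split=> i /=; rewrite ?wq ?wq1.
Qed.

Lemma proj_resolution X : stalk_interval X (q + 1) a b ->
  exists g : cmap P X, quasi_iso g.
Proof.
move=> Xab; have [X0 [Xd [w [u [wu wP uP]]]]] := Xab.
have [|i j ij ib|i ia|i ib|g [_ gq1]] := @cmap_from_proj X (fun i => 0) w.
- by move=> i j _ _; rewrite mul0mx.
- have [aj|ja] := leqP a j; first exact: wP.
  by apply: etrans (esym _); apply: empty_col; rewrite Xd; lia.
- by rewrite mul0mx; apply: esym; apply: empty_col; rewrite Xd; lia.
- by apply: empty_col; apply: X0; lia.
exists g; apply: quasi_iso_from_proj => // i iab; rewrite gq1 entry_sumM //.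
have [_ mb _] := two_term_mid.
rewrite entry_sum_const1 ?mul1r //; last by rewrite /= /proj_set mb; case/andP: iab => _ ->.
move=> w0; have /(congr1 (@entry_sum _ _ _)) := wu i iab.
rewrite entry_sumM ?Xd ?leq_b1 // w0 mul0r => /eqP.
by rewrite entry_sum1 // eq_sym oner_eq0.
Qed.

(** I_(a-1) -> I_(b-1) is surjective with kernel [a-1, b-1), which sits in the
    lower degree; for a = 0 the complex is I_(b-1) = [b-1, n) in the upper
    degree. *)
Lemma inj_coresolution X d c e :
  [/\ (0 < a)%N, d = q, c = a.-1 & e = b.-1] \/
  [/\ a = 0%N, d = q + 1, c = b.-1 & e = n] ->
  stalk_interval X d c e -> exists g : cmap X I, quasi_iso g.
Proof.
move=> Hcase [X0 [Xd [w [u [wu wP uP]]]]]; have [ma mb m0] := two_term_mid.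
have Id (i : 'I_n) : (c <= i < e)%N -> inj_set q a b d i /\ ~~ inj_set q a b (d + 1) i.
  have := ltn_ord i; rewrite /inj_set.
  by case: Hcase => -[? -> ? ?]; rewrite ?ma ?mb ?m0; lia.
have Iprev (p : int) : p + 1 = d -> m p = 0%N.
  case: Hcase => -[a0 -> _ _] pd; case: (two_term_spec q ab p) => -[]; lia.
have Inext (p : int) (i : 'I_n) : inj_set q a b (p + 1) i -> ~ (p + 1 = d /\ (c <= i < e)%N) ->
    inj_set q a b p i || inj_set q a b (p + 1 + 1) i.
  have := ltn_ord i; rewrite /inj_set.
  case: (two_term_spec q ab p) => -[]; case: (two_term_spec q ab (p + 1)) => -[];
  by case: Hcase => -[]; lia.
pose T p := forall i, 'cV[k]_(rdim (cobj X p) i).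
pose x : forall p, T p := dfwith (fun p i => 0 : 'cV_(rdim (cobj X p) i)) u.
have xd : x d = u by rewrite /x dfwith_in.
have xout p : p <> d -> x p = fun i => 0.
  by move=> /eqP pd; rewrite /x dfwith_out // eq_sym.
have fP p : is_mor (M := cobj X p) (N := cobj I p) (fun i => x p i *m const_mx 1).
  have [E|pd] := eqVneq p d; last first.
    by apply: col_mor => i j _ _; rewrite xout ?mulmx0 ?scaler0 //; apply/eqP.
  subst p; apply: col_mor => i j ij Ij; rewrite xd.
  have [iab|niab] := bool_or_not (c <= i < e)%N.
    rewrite (proj1 (Id i iab)) scale1r uP //; last by case/andP: iab.
    move: Ij; rewrite /inj_set.
    by case: Hcase => -[? -> ? ?]; rewrite ?ma ?mb; lia.
  by apply: etrans (esym _); apply: empty_row; rewrite Xd; move/negbTE: niab => ->.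
have Xdiff p i : cdiff X p i = 0.
  have [E|/eqP pd] := eqVneq p d; last by apply: empty_row; apply: X0.
  by apply: empty_col; apply: X0; lia.
have gP : is_chain_map (fun p => Mor (fP p)).
  move=> p i /=; rewrite Xdiff mul0mx.
  have [E|/eqP pd] := eqVneq p d; last by apply: empty_row; apply: X0.
  subst p; have [iab|niab] := bool_or_not (c <= i < e)%N.
    by apply: empty_col; move/negbTE: (proj2 (Id i iab)) => /= ->.
  by apply: empty_row; rewrite Xd; move/negbTE: niab => ->.
exists (CMap gP) => p i.
have gd (j : 'I_n) : (c <= j < e)%N -> entry_sum (Mor (fP d) j) <> 0.
  move=> jab; rewrite /= xd entry_sumM // entry_sum_const1 ?mulr1 //;
    last by rewrite (proj1 (Id j jab)).
  move=> u0; have /(congr1 (@entry_sum _ _ _)) := wu j jab.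
  rewrite entry_sumM ?Xd ?leq_b1 // u0 mulr0 => /eqP.
  by rewrite entry_sum1 // eq_sym oner_eq0.
split=> [v _ [z vz]|z zd].
  exists 0; rewrite mul0mx.
  have [E|/eqP pd] := eqVneq (p + 1) d; last by apply: empty_col; apply: X0.
  have [iab|niab] := bool_or_not (c <= i < e)%N.
    have z0 : z *m cdiff I p i = 0.
      by rewrite (empty_col z) ?mul0mx //= /inj_set Iprev.
    move: vz; rewrite z0 => /(congr1 (@entry_sum _ _ _)).
    subst d; rewrite entry_sumM ?Xd ?leq_b1 // entry_sum0 => /eqP; rewrite mulf_eq0.
    case/orP=> /eqP; last by move=> g0; case: (gd i iab).
    by move=> v0; apply: entry_sum_inj; rewrite ?Xd ?leq_b1 // entry_sum0.
  by apply: empty_col; subst d; rewrite Xd; move/negbTE: niab => ->.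
have [[E iab]|nd] : (p + 1 = d /\ (c <= i < e)%N) \/ ~ (p + 1 = d /\ (c <= i < e)%N).
    have [->|/eqP pd] := eqVneq (p + 1) d; last by right=> -[].
    by case: (c <= i < e)%N; [left|right=> -[]].
  subst d; exists (const_mx (entry_sum z / entry_sum (Mor (fP (p + 1)) i))).
  rewrite Xdiff mulmx0; split=> //; exists 0; rewrite mul0mx addr0.
  apply: entry_sum_inj; rewrite ?leq_b1 // entry_sumM ?Xd ?leq_b1 // entry_sum_const1 ?Xd ?iab //.
  by rewrite divfK //; apply/eqP/gd.
exists 0; rewrite !mul0mx; split=> //.
have [Ip|nIp] : inj_set q a b (p + 1) i \/ ~~ inj_set q a b (p + 1) i.
    by case: (inj_set q a b (p + 1) i); [left|right].
  case/orP: (Inext p i Ip nd) => H.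
    exists (const_mx (entry_sum z)); rewrite add0r.
    apply: entry_sum_inj; rewrite ?leq_b1 // entry_sumM ?leq_b1 // !entry_sum_const1 ?mulr1 //=
      ?H ?Ip //.
  exists 0; rewrite mul0mx addr0; apply: entry_sum_inj; rewrite ?leq_b1 // entry_sum0.
  have /(congr1 (@entry_sum _ _ _)) := zd; rewrite entry_sumM ?leq_b1 // entry_sum0.
  by rewrite /= (@entry_sum_const1 _ (inj_set _ _ _ _ _)) ?mulr1 ?H ?Ip.
exists 0; rewrite mul0mx addr0; apply: empty_col.
by rewrite /=; move/negbTE: nIp => ->.
Qed.

End Resolve.
End Intervals.

(** * Interval modules are rigid in the cluster category *)

Section Rigidity.
Context {k : fieldType} {n : nat}.
Local Notation Q := (linearA n).
Implicit Types (V M N L : rep k Q) (X Y Z : cpx k Q).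

(** Two transported vectors correspond to each other under a morphism as soon as
    their sources do; the bound c allows w to be compatible only from c on. *)
Lemma mor_path V M (f : mor V M) (t : 'I_n) (v : forall i, 'rV[k]_(rdim V i))
    (w : forall i, 'rV[k]_(rdim M i)) c :
  (forall i j : 'I_n, i = j.+1 :> nat -> (i <= t)%N -> v i *m arrow_mx V i j = v j) ->
  (forall i j : 'I_n, i = j.+1 :> nat -> (c <= j)%N -> (i <= t)%N -> w i *m arrow_mx M i j = w j) ->
  v t *m f t = w t -> forall i : 'I_n, (c <= i <= t)%N -> v i *m f i = w i.
Proof.
move=> vP wP vt i /andP[ci it].
have [d Hd] : exists d, (t = i + d :> nat)%N by exists (t - i)%N; lia.
elim: d i ci it Hd => [|d IH] i ci it Hd.
  suff -> : i = t by [].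
  by apply/val_inj; rewrite /= Hd addn0.
have it' : (i.+1 <= t)%N by lia.
pose i' : 'I_n := Ordinal (leq_ltn_trans it' (ltn_ord t)).
rewrite -(vP i' i) // -mulmxA ((is_morE _).1 (mfunP f)) // mulmxA IH ?wP //=.
  exact: ltnW.
by rewrite addSnnS.
Qed.

(** In a roof X <- Z -> Y the quasi-isomorphism to X admits a lift of the
    projective resolution P of X: the generator of X lifts to a cocycle v0 of Z,
    the transport of v0 to a - 1, if a > 0, is the boundary of some v1, and
    (v1, v0) is a chain map P -> Z.  It is a quasi-isomorphism, and its
    composite with Z -> Y is zero on both generators, because Y vanishes
    there. *)
Lemma derived_hom_zero_interval (q : int) a b X Y : (a < b <= n)%N ->
  stalk_interval X (q + 1) a b ->
  (forall i : 'I_n, i.+1 = b -> rdim (cobj Y (q + 1)) i = 0%N) ->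
  (forall i : 'I_n, i.+1 = a -> rdim (cobj Y q) i = 0%N) ->
  derived_hom_zero X Y.
Proof.
move=> ab Xab Y1 Y0 [Z s sq f].
have [X0 [Xd [w [u [wu wP uP]]]]] := Xab.
have tn : (b.-1 < n)%N by lia.
pose t : 'I_n := Ordinal tn.
have tb : t.+1 = b by rewrite /=; lia.
have Xq0 i : rdim (cobj X q) i = 0%N by apply: X0; lia.
have [v [vd [z wv]]] : exists v : 'rV_(rdim (cobj Z (q + 1)) t),
    v *m cdiff Z (q + 1) t = 0 /\ exists z, w t = v *m s (q + 1) t + z *m cdiff X q t.
  have [_] := sq q t; apply; apply: empty_col; apply: X0; lia.
have {z}wv : v *m s (q + 1) t = w t.
  by rewrite wv (empty_row (cdiff X q t)) // mulmx0 addr0.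
have [v0 [v0t v0P]] := path_rows v.
have v0d (i : 'I_n) : (i < b)%N -> v0 i *m cdiff Z (q + 1) i = 0.
  move=> ib; apply: (@mor_path _ _ (cdiff Z (q + 1)) t v0 (fun i => 0) 0) => //.
  - by move=> *; rewrite mul0mx.
  - by rewrite v0t.
  - by lia.
have v0s (i : 'I_n) : (i < b)%N -> v0 i *m s (q + 1) i = if (a <= i)%N then w i else 0.
  move=> ib; case: leqP => ai; last by apply: empty_col; rewrite Xd; lia.
  apply: (@mor_path _ _ (s (q + 1)) t v0 w a) => //.
  - by move=> i' j' ij aj it; apply: wP => //; lia.
  - by rewrite v0t.
  - by lia.
have [v1 [v1P v1d]] : exists v1 : forall i, 'rV[k]_(rdim (cobj Z q) i),
   (forall i j : 'I_n, i = j.+1 :> nat -> (i < a)%N -> v1 i *m arrow_mx (cobj Z q) i j = v1 j) /\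
   (forall i : 'I_n, (i < a)%N -> v1 i *m cdiff Z q i = v0 i).
  have [a0|a0] := posnP a; first by exists (fun i => 0); split=> i; rewrite a0.
  have an : (a.-1 < n)%N by lia.
  pose t' : 'I_n := Ordinal an.
  have [y yv] : exists y, v0 t' = y *m cdiff Z q t'.
    have [H _] := sq q t'; apply: H; first by apply: v0d => /=; lia.
    exists 0; rewrite mul0mx; apply: empty_col; rewrite Xd /=; lia.
  have [v1 [v1t v1P]] := path_rows y.
  exists v1; split=> [i j ij ia|i ia]; first by apply: v1P => //=; lia.
  apply: (@mor_path _ _ (cdiff Z q) t' v1 v0 0) => //.
  - by move=> i' j' ij _ /= it; apply: v0P => //=; lia.
  - by rewrite v1t yv.
  - by rewrite /=; lia.
have [|||T [T1 T0]] := @cmap_from_proj k n q a b ab Z v1 v0 v1P.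
- by move=> i j ij ib; apply: v0P => //=; lia.
- exact: v1d.
- exact: v0d.
exists (proj_cpx q ab), T; split.
  apply: (quasi_iso_cancel sq); apply: quasi_iso_from_proj => // i iab.
  rewrite /= /comp_fam T0 -mulmxA v0s; last by lia.
  case/andP: (iab) => -> _; rewrite entry_sumM // entry_sum_const1 //; last first.
    by rewrite /= /proj_set; case: (two_term_mid q ab) => _ -> _; lia.
  rewrite mul1r => w0; have /(congr1 (@entry_sum _ _ _)) := wu i iab.
  rewrite entry_sumM ?Xd ?leq_b1 // w0 mul0r => /eqP.
  by rewrite entry_sum1 // eq_sym oner_eq0.
exists (fun p => mor0 _ _) => p i; rewrite /= mul0mx mulmx0 addr0.
have [Pp|[tp Pp]] := two_term_top q ab (p + 1).
  by apply: empty_row; rewrite /= /proj_set Pp.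
apply: (proj_mor_eq0 Pp (mfunP (comp_cmap T f (p + 1)))).
apply: empty_col; have [E|[E|E]] := two_term_out q ab (p + 1).
- by rewrite E in Pp.
- rewrite E; apply: Y0; rewrite -Pp E; by case: (two_term_mid q ab).
- rewrite E; apply: Y1; rewrite -Pp E; by case: (two_term_mid q ab).
Qed.

(** P and I are exchanged by the Nakayama functor; P resolves Y, and I is
    quasi-isomorphic to X [2]. *)
Lemma is_F_interval (q d : int) a b c e X Y : (a < b <= n)%N ->
  [/\ (0 < a)%N, d = q, c = a.-1 & e = b.-1] \/
  [/\ a = 0%N, d = q + 1, c = b.-1 & e = n] ->
  stalk_interval Y (q + 1) a b -> stalk_interval (shift (shift X)) d c e ->
  is_F X Y.
Proof.
move=> ab H Yab Xce; exists (proj_cpx q ab), (inj_cpx q ab); split.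
- exact: proj_cpx_projective.
- by have [g gq] := proj_resolution ab Yab; exact: derived_iso_right gq.
- exact: nakayama_proj_inj.
- by have [g gq] := inj_coresolution ab H Xce; exact: derived_iso_left gq.
Qed.

(** The triple (d, a, b) stands for the interval module [a, b) placed in
    degree d. *)
Definition orbit_pos := (int * nat * nat)%type.
Implicit Types s : orbit_pos.

Definition pos_ok s := (s.1.2 < s.2 <= n)%N.

(** The action of F on the indecomposable objects. *)
Definition F_pos s : orbit_pos :=
  let: (d, a, b) := s in
  if (b < n)%N then (d - 1, a.+1, b.+1) else (d - 2, 0%N, a.+1).

Definition F_inv_pos s : orbit_pos :=
  let: (d, a, b) := s in
  if (0 < a)%N then (d + 1, a.-1, b.-1) else (d + 2, b.-1, n).

Lemma F_pos_ok s : pos_ok s -> pos_ok (F_pos s).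
Proof. by case: s => -[d a] b; rewrite /pos_ok /F_pos; case: ifP => /=; lia. Qed.

Lemma F_inv_pos_ok s : pos_ok s -> pos_ok (F_inv_pos s).
Proof. by case: s => -[d a] b; rewrite /pos_ok /F_inv_pos; case: ifP => /=; lia. Qed.

Lemma F_posK s : pos_ok s -> F_inv_pos (F_pos s) = s.
Proof.
case: s => -[d a] b; rewrite /pos_ok /F_inv_pos /F_pos /= => H.
by case: ifP => /= bn; congr (_, _, _); lia.
Qed.

Definition at_pos s X := stalk_interval X s.1.1 s.1.2 s.2.

Lemma is_F_pos s X Y : pos_ok s -> at_pos s Y -> at_pos (F_inv_pos s) X -> is_F X Y.
Proof.
case: s => -[d a] b ok; rewrite /at_pos /F_inv_pos /= => Yab.
have Yab' : stalk_interval Y (d - 1 + 1) a b by rewrite subrK.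
case: ifP => /= a0 Xab.
  apply: (@is_F_interval (d - 1) (d - 1) a b a.-1 b.-1 _ _ ok) => //; first by left.
  by do 2 apply: stalk_interval_shift; rewrite subrK.
apply: (@is_F_interval (d - 1) (d - 1 + 1) a b b.-1 n _ _ ok) => //.
  by right; split=> //; lia.
by do 2 apply: stalk_interval_shift; rewrite subrK -addrA.
Qed.

Definition orbit s (i : int) : orbit_pos :=
  match i with
  | Posz m => iter m F_pos s
  | Negz m => iter m.+1 F_inv_pos s
  end.

Lemma orbit_ok s i : pos_ok s -> pos_ok (orbit s i).
Proof.
move=> ok; case: i => m /=; last apply: F_inv_pos_ok.
  by elim: m => //= m IH; exact: F_pos_ok.
by elim: m => //= m IH; exact: F_inv_pos_ok.
Qed.

Lemma orbit_step s (i : int) : pos_ok s -> orbit s i = F_inv_pos (orbit s (i + 1)).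
Proof.
move=> ok; case: i => m.
  rewrite (_ : Posz m + 1 = Posz m.+1) /=; last by lia.
  by rewrite F_posK //; exact: (@orbit_ok s (Posz m)).
case: m => [|m]; first by rewrite (_ : Negz 0 + 1 = 0).
by rewrite (_ : Negz m.+1 + 1 = Negz m) //; lia.
Qed.

(** F lowers the degree by one or two at each step, so the orbit leaves the
    range of degrees in which morphisms from T can exist. *)
Lemma orbit_deg s (i : int) : ((0 <= i)%R -> ((orbit s i).1.1 <= s.1.1 - i)%R) /\
   ((i <= 0)%R -> ((orbit s i).1.1 >= s.1.1 - i)%R).
Proof.
case: i => m.
  have : ((iter m F_pos s).1.1 <= s.1.1 - Posz m)%R.
    elim: m => [|m] /=; first by lia.
    by case: (iter m F_pos s) => -[d a] b; rewrite /F_pos; case: ifP => /=; lia.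
  split=> [_|m0] //; have -> : m = 0%N by lia.
  by rewrite /=; lia.
have H : ((iter m.+1 F_inv_pos s).1.1 >= s.1.1 + Posz m.+1)%R.
  elim: m.+1 => [|{}m] /=; first by lia.
  by case: (iter m F_inv_pos s) => -[d a] b; rewrite /F_inv_pos; case: ifP => /=; lia.
by split=> [|_]; [lia|move: H; rewrite /orbit; lia].
Qed.

(** Only the members of the orbit of T [1] in the degree q + 1 of T, or in the
    degree q just below it, could receive a morphism.  In degree q this is T [1]
    itself, which vanishes at a - 1; in degree q + 1 it can only be [a-1, b-1),
    which vanishes at b - 1. *)
Lemma interval_rigid (q : int) a b (T : cpx k Q) : (a < b <= n)%N ->
  stalk_interval T (q + 1) a b -> rigid T.
Proof.
move=> ab Tab; pose s : orbit_pos := (q, a, b).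
have sok : pos_ok s by [].
pose M i := thin (k := k) (n := n) (fun j => (orbit s i).1.2 <= j < (orbit s i).2)%N.
exists (fun i => if i == 0 then shift T else stalk_at (M i) (orbit s i).1.1).
have orbP i : at_pos (orbit s i) (if i == 0 then shift T else stalk_at (M i) (orbit s i).1.1).
  case: eqP => [->|_]; first exact: stalk_interval_shift.
  by apply: stalk_interval_stalk_at; apply: interval_thin.
split.
  split=> // i; apply: is_F_pos (orbit_ok _ sok) (orbP _) _.
  by rewrite -orbit_step //; exact: orbP.
move=> i; set Y := (if _ then _ else _).
have [Y0 [Yd _]] : at_pos (orbit s i) Y := orbP i.
have [degp degn] := orbit_deg s i.
apply: (derived_hom_zero_interval ab Tab) => j jE.
  have [Eq|Nq] := eqVneq (q + 1) (orbit s i).1.1; last by apply: Y0; apply/eqP.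
  have iE : i = -1 by move: Eq degp degn => /=; lia.
  rewrite {1}Eq Yd; move: Eq; rewrite iE /=.
  by case: ifP => /=; lia.
have [Eq|Nq] := eqVneq q (orbit s i).1.1; last by apply: Y0; apply/eqP.
have iE : i = 0 by move: Eq degp degn => /=; lia.
by rewrite {1}Eq Yd iE /=; lia.
Qed.

End Rigidity.

(** * Indecomposable representations are interval modules *)

Section Split.
Context {k : fieldType} {n : nat} {Q : quiver n}.
Implicit Types (V M : rep k Q).

Lemma is_zeroP V : reflect (is_zero V) [forall i, rdim V i == 0%N].
Proof. by apply: (iffP forallP) => H i; apply/eqP. Qed.

(** A retract M of V gives V = M + K, where K is the image of the idempotent
    1 - rs; the bases of this image come from Gaussian elimination. *)
Lemma indecomposable_retract M V (s : mor M V) (r : mor V M) :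
  (forall i, s i *m r i = 1%:M) -> ~ is_zero M -> indecomposable V ->
  forall i, r i *m s i = 1%:M.
Proof.
move=> sr M0 [_ Vind].
pose E i := 1%:M - r i *m s i.
have sE i : s i *m E i = 0 by rewrite mulmxBr mulmx1 mulmxA sr mul1mx subrr.
have Er i : E i *m r i = 0 by rewrite mulmxBl mul1mx -mulmxA sr mulmx1 subrr.
have EE i : E i *m E i = E i by rewrite {2}/E mulmxBr mulmx1 mulmxA Er mul0mx subr0.
have EP i j (a : 'I_(Q i j)) : rmap V a *m E j = E i *m rmap V a.
  rewrite mulmxBr mulmxBl mulmx1 mul1mx; congr (_ - _).
  by rewrite mulmxA (mfunP r) -!mulmxA (mfunP s).
pose cb i := col_base (E i); pose rb i := row_base (E i).
have cbrb i : cb i *m rb i = E i := mulmx_base (E i).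
have rbK i p (A B : 'M_(p, \rank (E i))) : A *m rb i = B *m rb i -> A = B.
  by apply: row_free_inj; exact: row_base_free.
have cbK i p (A B : 'M_(\rank (E i), p)) : cb i *m A = cb i *m B -> A = B.
  by apply: row_full_inj; exact: col_base_full.
(* The bases are kept abstract: associativity of the product would otherwise
   rewrite inside their definition. *)
clearbody cb rb.
have scb i : s i *m cb i = 0 by apply: rbK; rewrite mul0mx -mulmxA cbrb.
have rbr i : rb i *m r i = 0 by apply: cbK; rewrite mulmx0 mulmxA cbrb.
have rbcb i : rb i *m cb i = 1%:M.
  apply: cbK; apply: rbK; rewrite mulmx1 cbrb mulmxA cbrb -mulmxA cbrb; exact: EE.
have Ecb i : E i *m cb i = cb i.
  by apply: rbK; rewrite -mulmxA cbrb EE.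
have rbE i : rb i *m E i = rb i.
  by apply: cbK; rewrite mulmxA cbrb EE.
have cbP i j (a : 'I_(Q i j)) : rmap V a *m cb j = cb i *m (rb i *m rmap V a *m cb j).
  by rewrite !mulmxA cbrb -EP -mulmxA Ecb.
have rbP i j (a : 'I_(Q i j)) : rb i *m rmap V a *m cb j *m rb j = rb i *m rmap V a.
  by rewrite -!mulmxA cbrb EP mulmxA rbE.
pose K : rep k Q := Rep (fun i => \rank (E i)) (fun i j a => rb i *m rmap V a *m cb j).
have fP : is_mor (M := V) (N := dsum M K) (fun i => row_mx (r i) (cb i)).
  move=> i j a /=; rewrite mul_mx_row mul_row_block !mulmx0 addr0 add0r (mfunP r).
  congr row_mx; exact: cbP.
have gP : is_mor (M := dsum M K) (N := V) (fun i => col_mx (s i) (rb i)).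
  move=> i j a; rewrite /K /= mul_block_col mul_col_mx !mul0mx addr0 add0r (mfunP s).
  congr col_mx; exact: rbP.
have iso : rep_iso V (dsum M K).
  exists (Mor fP), (Mor gP) => i /=; split.
    by rewrite mul_row_col cbrb addrC subrK.
  rewrite mul_col_row sr scb rbr rbcb; exact: (esym (scalar_mx_block _ _ _)).
case: (Vind _ _ iso) => // K0 i.
have /eqP := K0 i; rewrite mxrank_eq0 subr_eq0 => /eqP; exact: esym.
Qed.

End Split.

Section Classification.
Context {k : fieldType} {n : nat}.
Local Notation Q := (linearA n).
Implicit Types (V M N L : rep k Q).

(** Minimality of a makes the span of the transported vector w a submodule, and
    maximality of b makes the transported form u, cut off above b, a morphism
    to this submodule; w u = 1 says that it is a retraction. *)
Lemma indecomposable_interval V : indecomposable V ->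
  exists a b, (a < b <= n)%N /\ interval_rep V a b.
Proof.
move=> Vind; have [V0 _] := Vind.
have [a0 Va0] : exists i, rdim V i != 0%N.
  by apply/existsP; rewrite -negb_forall; apply/negP => /is_zeroP.
have [a Va amin] := arg_minnP (P := fun i : 'I_n => rdim V i != 0%N) (fun i : 'I_n => i : nat) Va0.
have Vlow (i : 'I_n) : (i < a)%N -> rdim V i = 0%N.
  move=> ia; apply/eqP; apply: contraTT ia => /amin; lia.
have [u [ua uP]] := path_cols_upto (const_mx 1 : 'cV_(rdim V a)) n.
have ua0 : (u a != 0) && (a <= a)%N.
  rewrite leqnn andbT ua; apply/eqP => /matrixP H.
  have d0 : (0 < rdim V a)%N by rewrite lt0n.
  by have := H (Ordinal d0) ord0; rewrite !mxE => /eqP; rewrite oner_eq0.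
have [b /andP[ub ab] bmax] := arg_maxnP (P := fun i : 'I_n => (u i != 0) && (a <= i)%N) (fun i :
  'I_n => i : nat) ua0.
have [x xu] : exists x : 'rV_(rdim V b), x *m u b = 1%:M.
  have /matrix0Pn[r [c rc]] := ub; rewrite (ord1 c) in rc.
  exists ((u b r 0)^-1 *: delta_mx 0 r); rewrite -scalemxAl -rowE.
  apply/matrixP => y z; rewrite !ord1 !mxE mulVf //.
have [w [wb wP]] := path_rows x.
have wu (i : 'I_n) : (a <= i <= b)%N -> w i *m u i = 1%:M.
  move=> /andP[ai ib]; have [d Hd] : exists d, (b = i + d :> nat)%N by exists (b - i)%N; lia.
  elim: d i ai ib Hd => [|d IH] i ai ib Hd.
    suff -> : i = b by rewrite wb.
    by apply/val_inj; rewrite /= Hd addn0.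
  have ib' : (i.+1 <= b)%N by lia.
  pose i' : 'I_n := Ordinal (leq_ltn_trans ib' (ltn_ord b)).
  rewrite -(wP i' i) // -mulmxA uP //; last by rewrite ai /=.
  by apply: IH => //=; [exact: leqW|rewrite addSnnS].
pose S (j : nat) := (a <= j <= b)%N.
have sP : is_mor (M := thin S) (N := V) (fun j => const_mx 1 *m w j).
  apply: row_mor => i j ij /andP[ai ib].
  have [aj|ja] := leqP a j; last first.
    by apply: etrans (esym _); apply: empty_col; exact: Vlow.
  rewrite (_ : S j) ?scale1r ?wP // /S; lia.
have rP : is_mor (M := V) (N := thin S) (fun j => u j *m const_mx 1).
  apply: col_mor => i j ij /andP[aj jb].
  rewrite uP ?aj ?ltn_ord //.
  have [ib|bi] := leqP i b; first by rewrite (_ : S i) ?scale1r // /S; lia.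
  suff -> : u i = 0 by rewrite scaler0.
  apply/eqP; apply: contraTT bi => ui; rewrite -leqNgt.
  by apply: bmax; rewrite ui; lia.
have sr i : Mor sP i *m Mor rP i = 1%:M.
  have [Si|nSi] := bool_or_not (S i).
    have d1 : rdim (thin (k := k) (n := n) S) i = 1%N by rewrite /= Si.
    rewrite /= mulmxA -[_ *m w i *m u i]mulmxA wu // mulmx1 const_mulmx.
    by rewrite scalar_const // -[in RHS](_ : 1%:R = 1).
  by apply: etrans (esym _); apply: empty_row; rewrite /= (negbTE nSi).
have S0 : ~ is_zero (thin (k := k) (n := n) S) by move/(_ a); rewrite /= /S leqnn ab.
have rs := indecomposable_retract sr S0 Vind.
exists a, b.+1; split; first by rewrite ltnS ab ltn_ord.
split=> [i|].
  have := mulmx1_min (sr i); have := mulmx1_min (rs i); rewrite /= ltnS /S.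
  by case: (_ && _) => /=; lia.
exists w, u; split=> [i|i j ij aj ib|i j ij aj ib].
- by rewrite ltnS; exact: wu.
- exact: wP.
- by rewrite uP ?aj ?ltn_ord.
Qed.

(** Compatibility with an arrow equates the values at its two ends, and an
    interval is connected. *)
Lemma thin_endo_const S a b (f : Defs.family (thin (k := k) (n := n) S) (thin S)) :
  (forall j : nat, (j < n)%N -> S j = (a <= j < b)%N) -> is_mor f ->
  forall i j : 'I_n, S i -> S j -> entry_sum (f i) = entry_sum (f j).
Proof.
move=> Sab /is_morE fP.
suff H d (i j : 'I_n) : S i -> S j -> i = (j + d)%N :> nat -> entry_sum (f i) = entry_sum (f j).
  move=> i j Si Sj; have [ij|ji] := leqP i j.
    by apply/esym/(H (j - i)%N); rewrite ?subnKC.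
  by apply: (H (i - j)%N); rewrite ?subnKC // ltnW.
elim: d i j => [|d IH] i j; rewrite !Sab // => Si Sj ij.
  by suff -> : i = j by []; apply/val_inj; rewrite /= ij addn0.
have jn : (j.+1 < n)%N by have := ltn_ord i; lia.
pose j' : 'I_n := Ordinal jn.
rewrite (IH i j') ?Sab //=; try lia.
have /(congr1 (@entry_sum _ _ _)) := fP j' j erefl.
rewrite !entry_sumM ?leq_b1 // !arrow_mx_thin //.
have d1 : rdim (thin (k := k) (n := n) S) j = 1%N by rewrite /= Sab // Sj.
have d2 : rdim (thin (k := k) (n := n) S) j' = 1%N by rewrite /= Sab //=; lia.
by rewrite !entry_sum_const1 // mulr1 mul1r.
Qed.

(** A decomposition would give a projector which is 1 at a vertex and 0 at
    another one, although it is a scalar. *)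
Lemma thin_indecomposable S a b : (a < b <= n)%N ->
  (forall j : nat, (j < n)%N -> S j = (a <= j < b)%N) ->
  indecomposable (thin (k := k) (n := n) S).
Proof.
move=> ab Sab; have an : (a < n)%N by lia.
split=> [/(_ (Ordinal an))|A B [f [g fg]]]; first by rewrite /= Sab //; lia.
have dims i : (rdim A i + rdim B i = S i)%N.
  have [h1 h2] := fg i; have := mulmx1_min h1; have := mulmx1_min h2 => /=; lia.
pose e i := f i *m (block_mx 1%:M 0 0 0 : 'M_(rdim A i + rdim B i)) *m g i.
have eP : is_mor e.
  move=> i j x; rewrite /e !mulmxA (mfunP f) -!mulmxA; congr (_ *m _).
  rewrite -(mfunP g) !mulmxA /= !mulmx_block.
  by rewrite !mulmx0 !mul0mx !mulmx1 !mul1mx !addr0.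
case: (boolP [forall i, rdim A i == 0%N]) => [/is_zeroP|A0]; first by left.
case: (boolP [forall i, rdim B i == 0%N]) => [/is_zeroP|B0]; first by right.
move: A0 B0; rewrite !negb_forall => /existsP[i Ai] /existsP[j Bj].
have Si : S i by have := dims i; case: (S i) => /=; lia.
have Sj : S j by have := dims j; case: (S j) => /=; lia.
have Bi : rdim B i = 0%N by have := dims i; rewrite Si /=; lia.
have Aj : rdim A j = 0%N by have := dims j; rewrite Sj /=; lia.
have := thin_endo_const Sab eP Si Sj.
have -> : e j = 0.
  rewrite /e (_ : block_mx _ _ _ _ = 0) ?mulmx0 ?mul0mx //.
  by rewrite (empty_row 1%:M Aj) block_mx0.
have -> : e i = 1%:M.
  rewrite /e (_ : block_mx _ _ _ _ = 1%:M) ?mulmx1; first by case: (fg i).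
  by rewrite [RHS]scalar_mx_block; congr block_mx; rewrite (empty_row 1%:M Bi).
rewrite entry_sum0 entry_sum1 /= ?Si // => /eqP; rewrite oner_eq0 //.
Qed.

End Classification.

(** * Euler characteristics of the empty variety and of a point *)

(** The Euler characteristic is chosen among the integers with the defining
    property, so its value is known once this integer is unique. *)
Lemma euler_char_unique (k : fieldType) l (X : variety k) c :
  is_euler_char l X c -> (forall c', is_euler_char l X c' -> c' = c) ->
  euler_char l X = c.
Proof.
move=> Xc uniq; apply: uniq; apply: epsilon_spec; by exists c.
Qed.

Section EmptyVariety.
Context (k : fieldType) (l : nat) (X : variety k).
Hypothesis X0 : X -> False.

Lemma empty_cover : exists U : covering X, cov_size U = 0%N.
Proof.
have Psurj : forall x : X, exists (c : 'I_0) t, on_chart (match c with Ordinal m H => False_rect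
  (chart X) (notF H) end) x t.
  by move=> x; case: (X0 x).
by exists (Covering Psurj).
Qed.

Lemma empty_refinement (U V : covering X) : cov_size U = 0%N -> inhabited (refinement U V).
Proof.
move=> U0; have none (c : 'I_(cov_size U)) : False by case: c; rewrite U0.
pose idx c : 'I_(cov_size V) := False_rect _ (none c).
have H1 c : reg_poly (chart_dom (cov_chart (c := U) c)) (fun _ : X => 0) by case: (none c).
have H2 c (x : X) t : on_chart (cov_chart (c := U) c) x t -> (0 : {poly k}).[t] != 0.
  by case: (none c).
have H3 (x : X) (s : cov_coord U) : Defs.over x s ->
   Defs.over x ((idx s.1, (0 : {poly k}).[s.2] / (0 : {poly k}).[s.2]) : cov_coord V).
  by case: (none s.1).
exact: inhabits (@Refinement k X U V idx (fun _ _ => 0) (fun _ _ => 0) H1 H1 H2 H3).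
Qed.

(** The covering without charts refines every covering. *)
Lemma empty_cohomologous p (U V : covering X) (phi : cochain l U p) (psi : cochain l V p) :
  cohomologous phi psi.
Proof.
have [W W0] := empty_cover.
have [r] := empty_refinement U W0; have [r'] := empty_refinement V W0.
exists W, r, r'; case: p phi psi => [|p] phi psi; first by move=> x; case: (X0 x).
by exists (fun _ _ => 0); split=> x; case: (X0 x).
Qed.

Lemma empty_betti p b : betti l X p b <-> b = 0%N.
Proof.
split=> [[U [phi [_ _ H]]]|->].
  case: b phi H => // b phi H.
  have := H (fun _ => 1) (empty_cohomologous _ _) ord0.
  by move/eqP; rewrite oner_eq0.
have [U U0] := empty_cover.
exists U, (fun i => fun _ _ => 0); split; [by case|move=> V psi _|by move=> c _ []].
by exists (fun _ => 0); exact: empty_cohomologous.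
Qed.

Lemma euler_char_empty : euler_char l X = 0.
Proof.
have H b : (forall p, betti l X p (b p)) -> forall N, \sum_(p < N.+1) (-1) ^+ p * (b p)%:Z = 0.
  move=> Hb N; rewrite big1 // => p _.
  by have /empty_betti -> := Hb p; rewrite mulr0.
apply: euler_char_unique => [|c [N [b [bP _ ->]]]]; last exact: H.
have bP p : betti l X p 0 by apply/empty_betti.
by exists 0%N, (fun=> 0%N); split=> //; rewrite (H (fun=> 0%N)).
Qed.

End EmptyVariety.

Section PointVariety.
Context (k : fieldType) (l : nat) (X : variety k) (x0 : X).
Hypothesis X1 : forall x : X, x = x0.
Hypothesis openT : is_open (fun _ : X => True).
Hypothesis regular_const : forall (D : X -> Prop) c, regular D (fun _ => c).

Lemma reg_poly_const D (P : {poly k}) : reg_poly D (fun _ : X => P).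
Proof. by split=> [|a]; [exists (size P)|exact: regular_const]. Qed.

Lemma reg_mpoly_const m D (P : {mpoly k[m]}) : reg_mpoly D (fun _ : X => P).
Proof. by split=> [|a]; [exists (msize P)|exact: regular_const]. Qed.

(** The trivial etale covering of a point: its only sheet is t = 0. *)
Definition point_chart : chart X :=
  Chart openT (reg_poly_const _ 'X) (reg_poly_const _ 1).

Lemma point_on_chart x t : on_chart point_chart x t <-> t = 0.
Proof.
split=> [[_ /=]|->]; first by rewrite rootX => /eqP.
split=> //=; first by rewrite rootX.
  by rewrite derivX root1.
by rewrite root1.
Qed.

Lemma point_surj x : exists (c : 'I_1) t, on_chart point_chart x t.
Proof. by exists ord0, 0; apply/point_on_chart. Qed.

Definition point_cover : covering X := Covering point_surj.

Definition const_simplex (U : covering X) p (s : cov_coord U) : simplex U p :=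
  [ffun _ => s].

Lemma const_in_nerve (U : covering X) p (s : cov_coord U) x :
  Defs.over x0 s -> in_nerve x (const_simplex p s).
Proof. by move=> Us a; rewrite ffunE (X1 x). Qed.

Lemma cover_point (U : covering X) : exists s : cov_coord U, Defs.over x0 s.
Proof. by have [c [t H]] := cov_surj U x0; exists (c, t). Qed.

(** The trivial covering refines every covering U, by the choice of a point s
    of U; hence all classes are detected on the trivial covering. *)
Lemma point_refinement (U : covering X) (s : cov_coord U) : Defs.over x0 s ->
  exists r : refinement point_cover U, forall x s', ref_map r x s' = s.
Proof.
move=> Us; case: s Us => c t Us.
have H1 (c' : 'I_1) : reg_poly (chart_dom (cov_chart (c := point_cover) c')) (fun _ : X => t%:P).
  exact: reg_poly_const.
have H2 (c' : 'I_1) : reg_poly (chart_dom (cov_chart (c := point_cover) c')) (fun _ : X => 1).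
  exact: reg_poly_const.
have H3 (c' : 'I_1) (x : X) t' : on_chart (cov_chart (c := point_cover) c') x t' ->
   (1 : {poly k}).[t'] != 0 by rewrite hornerC oner_eq0.
have H4 (x : X) (s : cov_coord point_cover) : Defs.over x s ->
   Defs.over x ((c, (t%:P).[s.2] / (1 : {poly k}).[s.2]) : cov_coord U).
  by move=> _; rewrite !hornerC divr1 (X1 x).
exists (@Refinement k X point_cover U (fun _ => c) (fun _ _ => t%:P) (fun _ _ => 1) H1 H2 H3 H4).
by move=> x s'; rewrite /ref_map /= !hornerC divr1.
Qed.

Lemma pullback_const p (U : covering X) (s : cov_coord U) (r : refinement point_cover U)
   (phi : cochain l U p) x s' : (forall x s', ref_map r x s' = s) ->
  pullback r phi x s' = phi x0 (const_simplex p s).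
Proof.
move=> rs; rewrite /pullback (X1 x); congr (phi _ _).
by apply/ffunP => a; rewrite !ffunE rs.
Qed.

Lemma const_locally_constant (U : covering X) p c :
  locally_constant (fun (_ : X) (_ : simplex U p) => c : 'F_l).
Proof.
move=> x s _; exists (fun _ => True), (fun _ => 1); split=> //.
  exact: reg_mpoly_const.
by rewrite meval1 oner_eq0.
Qed.

(** On a constant simplex all p + 2 faces agree, and their alternating sum is
    the common value or 0. *)
Lemma cech_diff_const p (U : covering X) (phi : cochain l U p) (s : cov_coord U) :
  cech_diff phi x0 (const_simplex p.+1 s) = (odd p)%:R * phi x0 (const_simplex p s).
Proof.
rewrite /cech_diff.
have E (a : 'I_p.+2) : phi x0 (face a (const_simplex p.+1 s)) = phi x0 (const_simplex p s).
  by congr (phi _ _); apply/ffunP => b; rewrite !ffunE.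
under eq_bigr do rewrite E; rewrite -mulr_suml; congr (_ * _).
elim: p {phi E} => [|p IH]; first by rewrite !big_ord_recl big_ord0 /= addr0 expr1 subrr.
rewrite big_ord_recr /= IH -signr_odd /=.
by case: (odd p); rewrite /= ?expr0 ?expr1 ?addr0 ?add0r ?subrr.
Qed.

Definition point_coord : cov_coord point_cover := (ord0 : 'I_1, 0).

Lemma over_point (s : cov_coord point_cover) : Defs.over x0 s -> s = point_coord.
Proof.
case: s => c t; rewrite /Defs.over /= => /point_on_chart ->; by rewrite (ord1 c).
Qed.

Lemma in_nerve_point p x (s : simplex point_cover p) :
  in_nerve x s -> s = const_simplex p point_coord.
Proof.
move=> H; apply/ffunP => a; rewrite ffunE; apply: over_point.
by rewrite -(X1 x); exact: H.
Qed.

Lemma point_over : Defs.over x0 point_coord.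
Proof. exact/point_on_chart. Qed.

(** After pullback to the trivial covering a cochain is its value on the constant
    simplex.  For odd p this value is a coboundary, for even p it vanishes by
    the cocycle condition. *)
Lemma point_cohomologous p (U V : covering X) (phi : cochain l U p.+1) :
  (forall x s, in_nerve x s -> cech_diff phi x s = 0) ->
  cohomologous phi ((fun _ _ => 0) : cochain l V p.+1).
Proof.
move=> dphi; have [s Us] := cover_point U; have [s' Vs'] := cover_point V.
have [r rs] := point_refinement Us; have [r' _] := point_refinement Vs'.
exists point_cover, r, r'; exists (fun _ _ => phi x0 (const_simplex p.+1 s)); split.
  exact: const_locally_constant.
move=> x t xt; rewrite (pullback_const _ _ _ rs) /pullback subr0.
rewrite (in_nerve_point xt) (X1 x) cech_diff_const.
have := dphi x0 _ (@const_in_nerve U p.+2 s x0 Us).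
rewrite cech_diff_const /=; case: (odd p) => /=; first by rewrite mul1r.
by rewrite mul1r mul0r.
Qed.

Lemma point_cohomologous0 (U V : covering X) (phi : cochain l U 0) (psi : cochain l V 0)
   (s : cov_coord U) (t : cov_coord V) :
  Defs.over x0 s -> Defs.over x0 t -> phi x0 (const_simplex 0 s) = psi x0 (const_simplex 0 t) ->
  cohomologous phi psi.
Proof.
move=> Us Vt E; have [r rs] := point_refinement Us; have [r' rt] := point_refinement Vt.
exists point_cover, r, r' => x y _.
by rewrite (pullback_const _ _ _ rs) (pullback_const _ _ _ rt) E subrr.
Qed.

Lemma cohomologous0_eq (U V : covering X) (phi : cochain l U 0) (psi : cochain l V 0) :
  cohomologous phi psi -> exists s t, [/\ Defs.over x0 s, Defs.over x0 t &
    phi x0 (const_simplex 0 s) = psi x0 (const_simplex 0 t)].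
Proof.
move=> [W [r [r' H]]]; have [w Ww] := cover_point W.
exists (ref_map r x0 w), (ref_map r' x0 w); split; try exact: ref_over.
have := H x0 _ (@const_in_nerve W 0 w x0 Ww) => /eqP; rewrite subr_eq0 => /eqP.
have E (Y : covering X) (q : refinement W Y) :
   [ffun a => ref_map q x0 (const_simplex 0 w a)] = const_simplex 0 (ref_map q x0 w).
  by apply/ffunP => a; rewrite !ffunE.
by rewrite /pullback !E.
Qed.

Lemma cech_diff_sum b p (U : covering X) (phi : 'I_b -> cochain l U p) (c : 'I_b -> 'F_l) x s :
  cech_diff (fun x s => \sum_i c i * phi i x s) x s =
  \sum_i c i * cech_diff (phi i) x s.
Proof.
rewrite /cech_diff; under eq_bigr do rewrite mulr_sumr.
rewrite exchange_big; apply: eq_bigr => i _; rewrite mulr_sumr.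
by apply: eq_bigr => a _; rewrite mulrCA.
Qed.

Lemma betti_pos p b : betti l X p.+1 b <-> b = 0%N.
Proof.
split=> [[U [phi [phiP _ H]]]|->].
  case: b phi phiP H => // b phi phiP H.
  suff /H/(_ ord0)/eqP : cohomologous (fun x s => \sum_i (1 : 'F_l) * phi i x s)
      ((fun _ _ => 0) : cochain l U p.+1) by rewrite oner_eq0.
  apply: point_cohomologous => x s xs.
  by rewrite cech_diff_sum big1 // => i _; rewrite (proj2 (phiP i)) // mulr0.
exists point_cover, (fun i => fun _ _ => 0); split;
  [by case|move=> V psi [_ dpsi]|by move=> c _ []].
exists (fun _ => 0).
have [W [r [r' H]]] := point_cohomologous point_cover dpsi.
exists W, r, r'; case: H => eta [etaP H]; exists eta; split=> // x s xs.
by rewrite -H // /pullback big_ord0.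
Qed.

(** Two classes of degree 0 over a point are proportional. *)
Lemma betti_0 b : betti l X 0 b <-> b = 1%N.
Proof.
split=> [[U [phi [phiP gen H]]]|->].
  have [s Us] := cover_point U.
  case: b phi phiP gen H => [|[|b]] phi phiP gen H //.
    have cc : cocycle ((fun _ _ => 1) : cochain l point_cover 0).
      split; first exact: const_locally_constant.
      move=> x t _; rewrite /cech_diff !big_ord_recl big_ord0 /= addr0 expr0 expr1.
      by rewrite mul1r mulN1r subrr.
    have [c /cohomologous0_eq[s' [t [_ _]]]] := gen _ _ cc.
    by rewrite big_ord0 => /eqP; rewrite oner_eq0.
  pose v i := phi i x0 (const_simplex 0 s).
  have H' c : \sum_i c i * v i = 0 -> forall i, c i = 0.
    by move=> cv; apply: H; apply: (point_cohomologous0 Us Us).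
  (* Two scalars v0, v1 satisfy v1 v0 - v0 v1 = 0, so there is one basis vector. *)
  pose i1 : 'I_b.+2 := lift ord0 ord0.
  have /(_ _ i1) /= H1 := H' (fun i => if i == ord0 then v i1 else if i == i1 then - v ord0 else 0).
  have v01 : \sum_i (if i == ord0 then v i1 else if i == i1 then - v ord0 else 0) * v i = 0.
    rewrite !big_ord_recl big1 => [|i _] /=; last by rewrite mul0r.
    by rewrite addr0 mulNr mulrC subrr.
  have /eqP := H1 v01; rewrite oppr_eq0 => /eqP v0.
  have /(_ _ ord0) /= H0 := H' (fun i => if i == ord0 then 1 else 0).
  have v02 : \sum_i (if i == ord0 then 1 else 0) * v i = 0.
    rewrite big_ord_recl big1 => [|i _] /=; last by rewrite mul0r.
    by rewrite v0 mulr0 addr0.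
  by have /eqP := H0 v02; rewrite oner_eq0.
exists point_cover, (fun _ _ _ => 1); split.
- move=> _; split; first exact: const_locally_constant.
  move=> x t _; rewrite /cech_diff !big_ord_recl big_ord0 /= addr0 expr0 expr1.
  by rewrite mul1r mulN1r subrr.
- move=> V psi [_ dpsi]; have [s Vs] := cover_point V.
  exists (fun _ => psi x0 (const_simplex 0 s)).
  by apply: (point_cohomologous0 Vs point_over); rewrite big_ord1 mulr1.
- move=> c /cohomologous0_eq[s [t [_ _]]].
  by rewrite big_ord1 mulr1 => c0 i; rewrite ord1.
Qed.

Lemma euler_char_point : euler_char l X = 1.
Proof.
apply: euler_char_unique => [|c [N [b [bP _ ->]]]]; last first.
  have /betti_0 b0 := bP 0%N.
  rewrite big_ord_recl big1 => [|p _]; first by rewrite b0 expr0 mul1r addr0.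
  by have /betti_pos := bP (lift ord0 p) => ->; rewrite mulr0.
exists 0%N, (fun p => (p == 0%N) : nat); split=> [p|p|].
- by case: p => [|p]; [apply/betti_0|apply/betti_pos].
- by case: p.
- by rewrite big_ord1.
Qed.

End PointVariety.

(** * Grassmannians of interval modules *)

Section IntervalGrassmannian.
Context {k : fieldType} {n : nat}.
Local Notation Q := (linearA n).
Variables (V : rep k Q) (a b : nat) (e : 'I_n -> nat).
Hypothesis Vab : interval_rep V a b.
Hypothesis abn : (a <= b <= n)%N.
Hypothesis eV : forall r, (e r <= rdim V r)%N.

Lemma gr_dim_le1 r : (rdim V r <= 1)%N.
Proof. by rewrite (proj1 Vab) leq_b1. Qed.

Lemma gr_full (W : gr_pt V e) r : e r = rdim V r -> val W r = fullv.
Proof.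
move=> er; have /andP[_ /forallP/(_ r)/eqP Wr] := valP W.
apply/eqP; rewrite eqEdim subvf /= Wr er dimvf /dim /= mul1n; exact: leqnn.
Qed.

Lemma gr_zero (W : gr_pt V e) r : e r = 0%N -> val W r = 0%VS.
Proof.
move=> er; have /andP[_ /forallP/(_ r)/eqP Wr] := valP W.
by apply/eqP; rewrite -dimv_eq0 Wr er.
Qed.

(** Each subspace is zero or everything, as its dimension prescribes. *)
Lemma gr_unique (W W' : gr_pt V e) : W = W'.
Proof.
apply/val_inj/ffunP => r.
have [e0|e1] : e r = 0%N \/ e r = rdim V r by have := eV r; have := gr_dim_le1 r; lia.
  exact: etrans (gr_zero W e0) (esym (gr_zero W' e0)).
exact: etrans (gr_full W e1) (esym (gr_full W' e1)).
Qed.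

Lemma frame_eval_const c (A : frame V e) : frame_eval c%:MP A = c.
Proof. by rewrite /frame_eval mevalC. Qed.

Lemma gr_openT : is_open (v := quiver_grassmannian V e) (fun _ => True).
Proof. by move=> W A _ _; exists 1%:MP; rewrite frame_eval_const oner_eq0. Qed.

Lemma gr_regular_const (D : quiver_grassmannian V e -> Prop) c :
  regular D (fun _ => c).
Proof.
move=> W A _ _; exists c%:MP, 1%:MP; rewrite frame_eval_const oner_eq0; split=> // W' A' _ _ _.
by rewrite !frame_eval_const divr1.
Qed.

Definition lower_set c := [forall r : 'I_n, e r == (a <= r < c)%N].

Lemma lower_set_point c : (c <= b)%N -> lower_set c -> gr_pt V e.
Proof.
move=> cb /forallP ec.
pose W : subspaces V := [ffun r : 'I_n => if (a <= r < c)%N then fullv else 0%VS].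
exists W; apply/andP; split; last first.
  apply/forallP => r; rewrite (eqP (ec r)) ffunE; case: ifP => rc.
    by rewrite dimvf /dim /= mul1n (proj1 Vab); lia.
  by rewrite dimv0.
apply/forallP => i; apply/forallP => j; apply/forallP => x; rewrite !ffunE.
have ij : i = j.+1 :> nat.
  by have := ltn_ord x; rewrite {2}/linearA; case: eqP.
have [aj|ja] := leqP a j; last first.
  apply/subvP => v _; rewrite (empty_col v) ?mem0v //.
  by rewrite (proj1 Vab); lia.
case: (ltnP j c) => jc; first exact: subvf.
by case: ifP => ic; [lia|rewrite limg0 sub0v].
Qed.

(** The arrows of an interval module are isomorphisms, so the vertices of a
    submodule are closed under going down. *)
Lemma point_lower_set : gr_pt V e -> exists c, (a <= c <= b)%N /\ lower_set c.
Proof.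
move=> W; have [Vd [w [u [wu wP uP]]]] := Vab.
have ele r : (e r <= (a <= r < b))%N by rewrite -Vd.
have down (i j : 'I_n) : i = j.+1 :> nat -> (a <= j)%N -> e i = 1%N -> e j = 1%N.
  move=> ij aj ei; have iab : (a <= i < b)%N by have := ele i; rewrite ei; lia.
  have jab : (a <= j < b)%N by lia.
  suff : e j <> 0%N by have := ele j; lia.
  move=> ej; have /andP[/forallP/(_ i)/forallP/(_ j) Wsub _] := valP W.
  have [x] := arrow_exists ij; have /forallP/(_ x)/subvP Wx := Wsub.
  have : w i *m rmap V x \in (linfun (mulmxr (rmap V x)) @: val W i)%VS.
    rewrite -[w i *m _]/(mulmxr (rmap V x) (w i)) -lfunE memv_img //.
    by rewrite (gr_full W) ?memvf // ei Vd iab.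
  move=> /Wx; rewrite (gr_zero W ej) memv0 arrow_mxE wP //; last by case/andP: iab.
  move=> /eqP w0; have /(congr1 (@entry_sum _ _ _)) := wu j jab.
  by rewrite w0 mul0mx entry_sum0 entry_sum1 // => /eqP; rewrite eq_sym oner_eq0.
have [/existsP[i0 ei0]|/existsPn e0] := boolP [exists i, e i == 1%N]; last first.
  exists a; split; first by lia.
  by apply/forallP => r; have := e0 r; have := ele r; lia.
have [m em mmax] := arg_maxnP (P := fun i : 'I_n => e i == 1%N) (fun i : 'I_n => i : nat) ei0.
have := ele m; rewrite (eqP em) => mab.
exists m.+1; split; first by lia.
suff lower (r : 'I_n) : e r == (a <= r < m.+1)%N by apply/forallP.
have [rm|mr] := leqP r m; last first.
  have er : e r <> 1%N by move/eqP/mmax; rewrite /= leqNgt mr.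
  by have := ele r; lia.
have [ar|ra] := leqP a r; last by have := ele r; lia.
have [d Hd] : exists d, (m = r + d :> nat)%N by exists (m - r)%N; lia.
rewrite ltnS rm /=.
elim: d r ar rm Hd => [|d IH] r ar rm Hd.
  suff -> : r = m by [].
  by apply/val_inj; rewrite /= Hd addn0.
have rm' : (r.+1 <= m)%N by lia.
pose r' : 'I_n := Ordinal (leq_ltn_trans rm' (ltn_ord m)).
apply/eqP; apply: (down r' r) => //; apply/eqP; apply: IH => //=; lia.
Qed.

(** At most one term of the sum is nonzero; writing the Euler characteristic as a
    sum over c allows the summation over e to be exchanged with it. *)
Lemma euler_char_gr l :
  euler_char l (quiver_grassmannian V e) =
  \sum_(c < b.+1 | (a <= c)%N) (lower_set c)%:Z.
Proof.
have [[c /andP[ac ec]]|nc] : (exists c : 'I_b.+1, (a <= c)%N && lower_set c) \/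
    ~ (exists c : 'I_b.+1, (a <= c)%N && lower_set c).
- by case: (boolP [exists c : 'I_b.+1, (a <= c)%N && lower_set c]) => [/existsP|/existsP];
  [left|right].
- have cb : (c <= b)%N by have := ltn_ord c.
  have W0 := lower_set_point cb ec.
  rewrite (@euler_char_point k l (quiver_grassmannian V e) W0); first last.
  + exact: gr_regular_const.
  + exact: gr_openT.
  + by move=> W; apply: gr_unique.
  rewrite (bigD1 c) //= ec big1 ?addr0 // => c' /andP[ac' cc'].
  suff -> : lower_set c' = false by [].
  apply/negP => ec'; move/eqP: cc'; apply; apply/val_inj => /=.
  have cb' : (c' <= b)%N by have := ltn_ord c'.
  move/forallP: ec => ec; move/forallP: ec' => ec'.
  case: (ltngtP c' c) => // cc.
    have xn : (c' < n)%N by lia.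
    have := ec (Ordinal xn); have := ec' (Ordinal xn) => /= /eqP ->; lia.
  have xn : (c < n)%N by lia.
  have := ec (Ordinal xn); have := ec' (Ordinal xn) => /= /eqP ->; lia.
rewrite euler_char_empty; last first.
  move=> W; have [c [cab ec]] := point_lower_set W; apply: nc.
  have cb : (c < b.+1)%N by lia.
  by exists (Ordinal cb); rewrite /= ec; lia.
rewrite big1 // => c ac; suff -> : lower_set c = false by [].
by apply/negP => ec; apply: nc; exists c; rewrite ac.
Qed.

End IntervalGrassmannian.

(** * Triangulations of a polygon and their flips *)

Section Polygon.
Variable n : nat.
Implicit Types (D : 'I_n -> nat * nat) (e : nat * nat).

(** The diagonals D i together with the sides of the polygon with vertices
    0, ..., n + 2. *)
Definition edge D (x y : nat) : bool :=
  [&& x < y, y <= n.+2 &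
      [|| y == x.+1, (x == 0) && (y == n.+2) | [exists i, D i == (x, y)]]]%N.

Record diagonals D : Prop := Diagonals {
  diag_ok : forall i, [/\ (D i).1.+1 < (D i).2, (D i).2 <= n.+2 & D i <> (0, n.+2)]%N;
  diag_inj : injective D;
  diag_nc : forall i j, ~~ [&& (D i).1 < (D j).1, (D j).1 < (D i).2 & (D i).2 < (D j).2]%N }.

Lemma edge_diag D i : diagonals D -> edge D (D i).1 (D i).2.
Proof.
move=> H; have [h1 h2 _] := diag_ok H i; rewrite /edge h2 (ltnW h1) /=.
by apply/orP; right; apply/orP; right; apply/existsP; exists i; rewrite -surjective_pairing.
Qed.

Lemma edgeP D x y : edge D x y ->
  (x < y <= n.+2)%N /\ [\/ y = x.+1, x = 0%N /\ y = n.+2 | exists i, D i = (x, y)].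
Proof.
case/and3P=> xy yn H; rewrite xy yn; split=> //.
case/or3P: H => [/eqP H|/andP[/eqP H1 /eqP H2]|/existsP[i /eqP H]].
- by constructor 1.
- by constructor 2.
- by constructor 3; exists i.
Qed.

Lemma edge_nc D x y x' y' : diagonals D -> edge D x y -> edge D x' y' ->
  ~ (x < x' < y /\ y < y')%N.
Proof.
move=> H /edgeP[b1 E1] /edgeP[b2 E2].
case: E1 => [E1|[E1 E1']|[i E1]]; try lia.
case: E2 => [E2|[E2 E2']|[j E2]]; try lia.
by have := diag_nc H i j; rewrite E1 E2 /=; lia.
Qed.

(** A chord (p, q) is a side of a triangle whose third vertex lies between p and
    q, and of one whose third vertex does not. *)
Definition inner D e m := [&& e.1 < m, m < e.2, edge D e.1 m & edge D m e.2]%N.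
Definition outer D e m :=
  [&& e.2 < m, edge D e.1 m & edge D e.2 m]%N ||
  [&& m < e.1, edge D m e.1 & edge D m e.2]%N.

(** Two triangles on the same side of a chord would have crossing sides. *)
Lemma inner_uniq D e m m' : diagonals D -> inner D e m -> inner D e m' -> m = m'.
Proof.
move=> H /and4P[? ? e1 e2] /and4P[? ? e1' e2'].
have := edge_nc H e1 e2'; have := edge_nc H e1' e2; lia.
Qed.

Lemma outer_uniq D e m m' : diagonals D -> (e.1 < e.2)%N ->
  outer D e m -> outer D e m' -> m = m'.
Proof.
move=> H pq.
case/orP=> /and3P[lt1 e1 e2]; case/orP=> /and3P[lt1' e1' e2'].
- have := edge_nc H e1 e2'; have := edge_nc H e1' e2; lia.
- have := edge_nc H e2' e1; lia.
- have := edge_nc H e2 e1'; lia.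
- have := edge_nc H e1 e2'; have := edge_nc H e1' e2; lia.
Qed.

Definition flip D r e : 'I_n -> nat * nat := fun s => if s == r then e else D s.

Lemma flip_same D r e : flip D r e r = e.
Proof. by rewrite /flip eqxx. Qed.

Lemma flip_other D r e s : s <> r -> flip D r e s = D s.
Proof. by rewrite /flip => /eqP/negbTE ->. Qed.

Lemma edge_flip D r e x y : edge D x y -> (x, y) <> D r -> edge (flip D r e) x y.
Proof.
move=> /edgeP[/andP[xy yn] H] ne; rewrite /edge xy yn /=.
case: H => [->|[-> ->]|[i Di]]; rewrite ?eqxx ?orbT //.
apply/orP; right; apply/orP; right; apply/existsP; exists i.
by rewrite flip_other ?Di // => ir; apply: ne; rewrite -Di ir.
Qed.

Lemma edge_flip_new D r e : (e.1 < e.2 <= n.+2)%N -> edge (flip D r e) e.1 e.2.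
Proof.
move=> ok; rewrite /edge andbA ok /=; apply/orP; right; apply/orP; right; apply/existsP.
by exists r; rewrite flip_same -surjective_pairing.
Qed.

(** The four sides only; one of the diagonals ac and bd belongs to D as well. *)
Record quad D (a b c d : nat) : Prop := Quad {
  quad_ab : edge D a b; quad_bc : edge D b c;
  quad_cd : edge D c d; quad_ad : edge D a d }.

(** The boolean t tells which of the two diagonals belongs to the triangulation,
    so that a flip negates t. *)
Definition qdiag (t : bool) (a b c d : nat) := if t then (a, c) else (b, d).

Definition crossing e f := (e.1 < f.1 < e.2)%N && (e.2 < f.2)%N.

Lemma edge_crossing D e f : diagonals D -> edge D e.1 e.2 -> edge D f.1 f.2 ->
  ~~ crossing e f.
Proof. by move=> H e1 e2; apply/negP => /andP ef; exact: edge_nc H e1 e2 ef. Qed.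

(** An end of e strictly between two consecutive vertices of the quadrilateral
    would force e to cross the side between them. *)
Lemma crossing_quad a b c d t e : (a < b)%N -> (b < c)%N -> (c < d)%N ->
  (forall f, f \in [:: (a, b); (b, c); (c, d); (a, d)] -> ~~ crossing e f && ~~ crossing f e) ->
  crossing e (qdiag (~~ t) a b c d) || crossing (qdiag (~~ t) a b c d) e ->
  e = qdiag t a b c d.
Proof.
move=> ab bc cd nc; have := nc (a, b); have := nc (b, c); have := nc (c, d); have := nc (a, d).
rewrite !inE !eqxx !orbT => /(_ isT) + /(_ isT) + /(_ isT) + /(_ isT).
case: e {nc} => x y; rewrite /crossing /qdiag; case: t => /= h1 h2 h3 h4.
  by case/orP => h5; congr (_, _); lia.
by case/orP => h5; congr (_, _); lia.
Qed.

Section Flip.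
Variables (D : 'I_n -> nat * nat) (r : 'I_n) (a b c d : nat) (t : bool).
Hypothesis geoD : diagonals D.
Hypothesis qD : quad D a b c d.
Hypothesis Dr : D r = qdiag t a b c d.
Let D' := flip D r (qdiag (~~ t) a b c d).

Lemma quad_lt : [/\ a < b, b < c, c < d & d <= n.+2]%N.
Proof.
have [/edgeP[? _] /edgeP[? _] /edgeP[? _] _] := qD; split; lia.
Qed.

Lemma new_not_edge : ~ edge D (qdiag (~~ t) a b c d).1 (qdiag (~~ t) a b c d).2.
Proof.
have [ab bc cd dn] := quad_lt.
have := edge_diag r geoD; rewrite Dr; case: t => /= e1 e2.
  have := edge_nc geoD e1 e2; lia.
have := edge_nc geoD e2 e1; lia.
Qed.

Lemma quad_ndiag x y : (x, y) \in [:: (a, b); (b, c); (c, d); (a, d)] -> (x, y) <> D r.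
Proof.
have [ab bc cd dn] := quad_lt; rewrite Dr !inE /qdiag.
by case: t; case/or4P=> /eqP[-> ->] [] *; lia.
Qed.

Lemma diagonals_flip : diagonals D'.
Proof.
have [ab bc cd dn] := quad_lt.
have newok : edge D' (qdiag (~~ t) a b c d).1 (qdiag (~~ t) a b c d).2.
  by apply: edge_flip_new; case: (t) => /=; lia.
split.
- move=> i; rewrite /D'; have [->|/eqP ir] := eqVneq i r.
    rewrite flip_same /qdiag; case: (t) => /=; split; try lia; case; lia.
  by rewrite flip_other //; exact: diag_ok.
- have new i : D i <> qdiag (~~ t) a b c d.
    by move=> E; apply: new_not_edge; rewrite -E; exact: edge_diag.
  move=> i j; rewrite /D'.
  have [->|/eqP ir] := eqVneq i r; have [->|/eqP jr] := eqVneq j r => //.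
  + by rewrite flip_same flip_other // => /esym/new.
  + by rewrite flip_same flip_other // => /new.
  + by rewrite !flip_other //; exact: diag_inj.
- have nc i e : edge D e.1 e.2 -> ~~ crossing (D i) e && ~~ crossing e (D i).
    by move=> ee; rewrite !(@edge_crossing D) //; exact: edge_diag.
  have ncn i : i <> r -> ~~ (crossing (D i) (qdiag (~~ t) a b c d) ||
       crossing (qdiag (~~ t) a b c d) (D i)).
    move=> ir; apply/negP => /(crossing_quad ab bc cd) H; apply: ir; apply: (diag_inj geoD).
    rewrite Dr; apply: H => f; rewrite !inE => Hf; apply: nc.
    by have [e1 e2 e3 e4] := qD; case/or4P: Hf => /eqP ->.
  suff H i j : ~~ crossing (D' i) (D' j) by move=> i j; have := H i j; rewrite /crossing andbA.
  rewrite /D'; have [->|/eqP ir] := eqVneq i r; have [->|/eqP jr] := eqVneq j r.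
  + by rewrite flip_same /crossing ltnn.
  + by rewrite flip_same flip_other //; have := ncn j jr; rewrite negb_or => /andP[].
  + by rewrite flip_same flip_other //; have := ncn i ir; rewrite negb_or => /andP[].
  + by rewrite !flip_other //; have := diag_nc geoD i j; rewrite /crossing andbA.
Qed.

Lemma quad_flip : quad D' a b c d.
Proof.
by have [e1 e2 e3 e4] := qD; split; apply: edge_flip => //; apply: quad_ndiag;
  rewrite !inE eqxx ?orbT.
Qed.

Lemma inner_diag : inner D (D r) (if t then b else c).
Proof.
by have [? ? ? ?] := quad_lt; have [*] := qD; rewrite Dr /inner; case: (t); apply/and4P.
Qed.

Lemma outer_diag : outer D (D r) (if t then d else a).
Proof.
have [? ? ? ?] := quad_lt; have [*] := qD; rewrite Dr /outer.
by case: (t) => /=; apply/orP; [left|right]; apply/and3P.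
Qed.

Definition not_qdiag f := f <> D r /\ f <> qdiag (~~ t) a b c d.

Lemma old_edge x y : edge D x y -> (x, y) <> D r -> edge D' x y /\ not_qdiag (x, y).
Proof.
move=> e1 ne; split; first exact: edge_flip.
by split=> // E; apply: new_not_edge; rewrite -E.
Qed.

Lemma new_edge : edge D' (qdiag (~~ t) a b c d).1 (qdiag (~~ t) a b c d).2.
Proof.
have [ab bc cd dn] := quad_lt.
by apply: edge_flip_new; case: (t) => /=; lia.
Qed.

(** The triangle inside a chord s is affected by the flip only if s is the long
    side ad of the quadrilateral.  Otherwise the flipped diagonal would be a
    side of a further triangle, against the uniqueness of the triangles at a
    chord. *)
Lemma inner_step s m : s <> r -> inner D (D s) m ->
  (inner D' (D s) m /\ not_qdiag ((D s).1, m) /\ not_qdiag (m, (D s).2)) \/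
  [/\ D s = (a, d), m = (if t then c else b) & inner D' (D s) (if t then b else c)].
Proof.
have [ab bc cd dn] := quad_lt.
have ac := ltn_trans ab bc; have bd := ltn_trans bc cd; have ne := new_edge;
  have [q1 q2 q3 q4] := quad_flip.
move=> sr; have es := edge_diag s geoD.
case: (D s) es => p q /= es /and4P[/= pm mq e1 e2].
have Dr2 : ((D r).1 < (D r).2)%N by have [] := diag_ok geoD r; lia.
have [Ep|np] := eqVneq (p, m) (D r).
  have /(outer_uniq geoD Dr2 outer_diag) : outer D (D r) q.
    by rewrite -Ep /outer mq es e2.
  move: Ep; rewrite Dr /qdiag; case: (t) ne => /= ne [Ep Em] Eq;
    last by clear - Ep Em Eq mq pm ab bc cd; lia.
  right; rewrite Ep Em -Eq; split=> //; by rewrite /inner /= q1 ne ab bd.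
have [Ep|nq] := eqVneq (m, q) (D r).
  have /(outer_uniq geoD Dr2 outer_diag) : outer D (D r) p.
    by rewrite -Ep /outer /= pm es e1 orbT.
  move: Ep; rewrite Dr /qdiag; case: (t) ne => /= ne [Ep Em] Eq;
    first by clear - Ep Em Eq mq pm ab bc cd; lia.
  right; rewrite Ep Em -Eq; split=> //; by rewrite /inner /= q3 ne ac cd.
have [e1' n1] := old_edge e1 (elimN eqP np); have [e2' n2] := old_edge e2 (elimN eqP nq).
by left; rewrite /inner /= pm mq e1' e2'.
Qed.

(** The triangle outside a chord s is affected by the flip only if s is one of
    the sides ab, bc, cd of the quadrilateral. *)
Lemma outer_step s m : s <> r -> outer D (D s) m ->
  (exists m', outer D' (D s) m' /\
    [\/ [/\ m' = m, not_qdiag ((D s).1, m) /\ not_qdiag (m, (D s).1) &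
                  not_qdiag ((D s).2, m) /\ not_qdiag (m, (D s).2)],
       [/\ D s = (a, b), m = (if t then c else d) & m' = if t then d else c],
       [/\ D s = (b, c), m = (if t then a else d) & m' = if t then d else a] |
       [/\ D s = (c, d), m = (if t then a else b) & m' = if t then b else a]]).
Proof.
have [ab bc cd dn] := quad_lt.
have ac := ltn_trans ab bc; have bd := ltn_trans bc cd; have ne := new_edge;
  have [q1 q2 q3 q4] := quad_flip.
move=> sr; have es := edge_diag s geoD.
have [ps _ _] := diag_ok geoD s.
have Drlt : ((D r).1 < (D r).2)%N by have [] := diag_ok geoD r; lia.
have newlt : ((qdiag (~~ t) a b c d).1 < (qdiag (~~ t) a b c d).2)%N by case: (t) => /=; lia.
have gt_not x y : (y < x)%N -> not_qdiag (x, y).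
  by move=> yx; split=> E; [move: Drlt|move: newlt]; rewrite -E /=; lia.
case: (D s) es ps => p q /= es /ltnW pq /orP[] /and3P[/= lt e1 e2].
  have [E1|n1] := eqVneq (q, m) (D r).
    have /(outer_uniq geoD Drlt outer_diag) : outer D (D r) p.
      by rewrite -E1 /outer /= es e1 pq orbT.
    move: E1; rewrite Dr /qdiag; case: (t) ne => /= ne [E1 E2] E3;
      first by clear - E1 E2 E3 pq ab bc cd; lia.
    exists c; rewrite -E3 E1 E2 /outer /= ne q2 bc; split=> //.
    by constructor 2.
  have [E1|n2] := eqVneq (p, m) (D r).
    have /(inner_uniq geoD inner_diag) : inner D (D r) q.
      by rewrite -E1 /inner /= es e2 pq lt.
    move: E1; rewrite Dr /qdiag; case: (t) ne => /= ne [E1 E2] E3.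
      exists d; rewrite -E3 E1 E2 /outer /= ne q4 bd; split=> //.
      by constructor 2.
    exists a; rewrite -E3 E1 E2 /outer /= ne q1 ab orbT; split=> //.
    by constructor 3.
  have [e1' m1] := old_edge e1 (elimN eqP n2); have [e2' m2] := old_edge e2 (elimN eqP n1).
  exists m; split; first by rewrite /outer /= lt e1' e2'.
  by constructor 1; split=> //; split=> //; apply: gt_not; rewrite ?lt ?(ltn_trans pq lt).
have [E1|n1] := eqVneq (m, p) (D r).
  have /(outer_uniq geoD Drlt outer_diag) : outer D (D r) q.
    by rewrite -E1 /outer /= es e2 pq.
  move: E1; rewrite Dr /qdiag; case: (t) ne => /= ne [E1 E2] E3;
    last by clear - E1 E2 E3 pq ab bc cd; lia.
  exists b; rewrite -E3 E1 E2 /outer /= ne q2 bc orbT; split=> //.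
  by constructor 4.
have [E1|n2] := eqVneq (m, q) (D r).
  have /(inner_uniq geoD inner_diag) : inner D (D r) p.
    by rewrite -E1 /inner /= es e1 pq lt.
  move: E1; rewrite Dr /qdiag; case: (t) ne => /= ne [E1 E2] E3.
    exists d; rewrite -E3 E1 E2 /outer /= ne q3 cd; split=> //.
    by constructor 3.
  exists a; rewrite -E3 E1 E2 /outer /= ne q4 ac orbT; split=> //.
  by constructor 4.
have [e1' m1] := old_edge e1 (elimN eqP n1); have [e2' m2] := old_edge e2 (elimN eqP n2).
exists m; split; first by rewrite /outer /= lt e1' e2' orbT.
by constructor 1; split=> //; split=> //; apply: gt_not; rewrite ?lt ?(ltn_trans lt pq).
Qed.

End Flip.
End Polygon.

(** * Arrow numbers as tropical cross-ratios *)

Section Weights.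
Variable n : nat.
Implicit Types (D : 'I_n -> nat * nat) (e : nat * nat) (w : 'I_(n + (n + n))).

(** The exponents of the frozen variables.  They come from splitting each
    monomial of the cluster character of [a, b): in the term of the submodule
    [a, c) the exponent of y_r is [r < c] - [r < a] and that of z_r is
    [r < b] - [r < c], where [_] is 1 or 0. *)
Definition wt_y (r p q : nat) : int := (r.+1 < p)%N%:Z.
Definition wt_z (r p q : nat) : int := - ((0 < p) && (r.+2 < q))%N%:Z.

(** The function g_w on chords; the vertices of the quiver, frozen or not, are
    treated alike. *)
Definition wt D w (p q : nat) : int :=
  match split w with
  | inl i => (D i == (p, q))%:Z
  | inr w' => match split w' with inl r => wt_y r p q | inr r => wt_z r p q end
  end.

Lemma wt_x D i p q : wt D (vx i) p q = (D i == (p, q))%:Z.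
Proof. by rewrite /wt /vx (unsplitK (inl i)). Qed.

Lemma wt_yE D i p q : wt D (vy i) p q = wt_y i p q.
Proof. by rewrite /wt /vy (unsplitK (inr _)) (unsplitK (inl i)). Qed.

Lemma wt_zE D i p q : wt D (vz i) p q = wt_z i p q.
Proof. by rewrite /wt /vz (unsplitK (inr _)) (unsplitK (inr i)). Qed.

Lemma vertexP w : [\/ exists i, w = vx i, exists i, w = vy i | exists i, w = vz i].
Proof.
case: (split_ordP w) => [i ->|w' ->]; first by constructor 1; exists i.
by case: (split_ordP w') => i ->; [constructor 2|constructor 3]; exists i.
Qed.

(** This is g_w(ac) + g_w(bd) for the frozen w.  The value 0 at the non-frozen w
    is the same sum, except at the flipped diagonal itself
    ([wt_min_other]). *)
Definition wt_min w (a b c d : nat) : int :=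
  match split w with
  | inl i => 0
  | inr w' => match split w' with
    | inl r => wt_y r a c + wt_y r b d
    | inr r => wt_z r a c + wt_z r b d end
  end.

(** The tropical Ptolemy relation.  For a non-frozen w it says that a diagonal
    is at most one of the four sides. *)
Lemma wt_minE D w a b c d : diagonals D -> quad D a b c d ->
  wt_min w a b c d =
  Num.min (wt D w a b + wt D w c d) (wt D w a d + wt D w b c).
Proof.
move=> geoD qD; have [ab bc cd dn] := quad_lt qD.
rewrite /wt_min /wt; case: (split w) => [i|w'].
  have ne : ((D i == (a, b)) || (D i == (c, d))) && ((D i == (a, d)) || (D i == (b, c))) = false.
    by case: (D i) => p q; apply/negP; case/andP=> /orP[] /eqP[-> ->] /orP[] /eqP[]; lia.
  have ne1 : (D i == (a, b)) && (D i == (c, d)) = false.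
    by case: (D i) => p q; apply/negP; case/andP=> /eqP[-> ->] /eqP[]; lia.
  move: ne ne1; do 4 case: (D i == _) => //=.
case: (split w') => r; rewrite /wt_y /wt_z; lia.
Qed.

Lemma wt_min_other D w a b c d i : w <> vx i ->
  (forall j, j <> i -> D j <> (a, c) /\ D j <> (b, d)) ->
  wt_min w a b c d = wt D w a c + wt D w b d.
Proof.
move=> wi Di; rewrite /wt_min /wt.
case: (split_ordP w) wi => [j -> ji|w' _ _]; last by case: (split w').
have ji' : j <> i by move=> E; apply: ji; rewrite E.
by have [/eqP/negbTE -> /eqP/negbTE ->] := Di j ji'.
Qed.

(** The contributions of the two triangles at a chord e to the tropical
    cross-ratio; m is the third vertex of the triangle. *)
Definition inner_side (g : nat -> nat -> int) e m := g e.1 m - g m e.2.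
Definition outer_side (g : nat -> nat -> int) e m :=
  if (e.2 < m)%N then g e.2 m - g e.1 m else g m e.2 - g m e.1.

Section Flip.
Variables (D : 'I_n -> nat * nat) (r : 'I_n) (a b c d : nat) (t : bool).
Hypothesis geoD : diagonals D.
Hypothesis qD : quad D a b c d.
Hypothesis Dr : D r = qdiag t a b c d.
Let D' := flip D r (qdiag (~~ t) a b c d).

(** In the seed of the triangulation this tropical cross-ratio is the number of
    arrows from r to w minus the number of arrows from w to r. *)
Definition balance w : int :=
  (-1) ^+ (~~ t) * (wt D w a b + wt D w c d - (wt D w a d + wt D w b c)).

(** The change, under mutation at r, of the balance between a vertex and w,
    where s is the balance between this vertex and r, and v the one between r
    and w. *)
Definition exchange_shift (s v : int) : int :=
  if 0 <= s then s * Num.max v 0 else - s * Num.min v 0.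

Lemma wt_flip_other w p q : w <> vx r -> wt D' w p q = wt D w p q.
Proof.
rewrite /wt; case: (split_ordP w) => [j -> ji|//].
by rewrite /D' flip_other // => E; apply: ji; rewrite E.
Qed.

Lemma wt_flip_same p q : wt D' (vx r) p q = (qdiag (~~ t) a b c d == (p, q))%:Z.
Proof. by rewrite wt_x /D' flip_same. Qed.

Lemma wt_not_qdiag p q : not_qdiag D r a b c d t (p, q) ->
  wt D (vx r) p q = 0 /\ wt D' (vx r) p q = 0.
Proof.
by move=> [n1 n2]; rewrite wt_flip_same wt_x ![_ == (p, q)]eq_sym; do 2 case: eqP.
Qed.

Lemma wt_min_flip w : w <> vx r -> wt_min w a b c d = wt D w a c + wt D w b d.
Proof.
move=> wr; apply: (wt_min_other wr) => j jr.
have h1 : D j <> qdiag t a b c d by rewrite -Dr => /(diag_inj geoD).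
have h2 : D j <> qdiag (~~ t) a b c d.
  by move=> E; apply: (new_not_edge geoD qD Dr); rewrite -E; exact: edge_diag.
by move: h1 h2; case: (t).
Qed.

(** The contribution of each triangle transforms according to the mutation rule;
    ep is the part of the balance between s and r which is due to this
    triangle. *)
Lemma inner_side_flip s m : s <> r -> inner D (D s) m -> exists n ep,
  [/\ inner D' (D s) n, inner_side (wt D (vx r)) (D s) m = ep, inner_side (wt D' (vx r)) (D s) n
    = - ep,
      ep <> 0 -> D s = (a, d) &
      forall w, w <> vx r ->
        inner_side (wt D' w) (D s) n = inner_side (wt D w) (D s) m + exchange_shift ep (balance w)].
Proof.
have [ab bc cd dn] := quad_lt qD.
move=> sr /(inner_step geoD qD Dr sr) [[in' [/wt_not_qdiag[n1 n1'] /wt_not_qdiag[n2 n2']]]|[Ds ->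
  in']].
  exists m, 0; rewrite /inner_side n1 n2 n1' n2'; split=> // w wr.
  by rewrite !wt_flip_other // /exchange_shift lexx mul0r addr0.
exists (if t then b else c), (if t then 1 else -1).
split=> //.
- rewrite /inner_side Ds !wt_x Dr /qdiag; case: (t) => /=; rewrite !xpair_eqE; lia.
- rewrite /inner_side Ds !wt_flip_same /qdiag; case: (t) => /=; rewrite !xpair_eqE; lia.
- move=> w wr; rewrite /inner_side !wt_flip_other // Ds /balance.
  have := wt_minE w geoD qD; rewrite wt_min_flip // /exchange_shift.
  by case: (t); rewrite /= ?expr0 ?expr1; lia.
Qed.

Lemma outer_side_flip s m : s <> r -> outer D (D s) m -> exists n ep,
  [/\ outer D' (D s) n, outer_side (wt D (vx r)) (D s) m = ep, outer_side (wt D' (vx r)) (D s) n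
    = - ep,
      ep <> 0 -> D s <> (a, d) &
      forall w, w <> vx r ->
        outer_side (wt D' w) (D s) n = outer_side (wt D w) (D s) m + exchange_shift ep (balance w)].
Proof.
have [ab bc cd dn] := quad_lt qD.
have ltF x y : (x < y)%N -> (y < x)%N = false by lia.
have ad : (a < d)%N by lia.
have bd : (b < d)%N by lia.
have ac : (a < c)%N by lia.
move=> sr /(outer_step geoD qD Dr sr) [m' [out' [[Em far1 far2]|[Ds Em En]|[Ds Em En]|[Ds Em En]]]].
- have [/wt_not_qdiag[n1 n1'] /wt_not_qdiag[n2 n2']] := far1.
  have [/wt_not_qdiag[n3 n3'] /wt_not_qdiag[n4 n4']] := far2.
  exists m', 0; rewrite Em in out' *; rewrite /outer_side n1 n2 n1' n2' n3 n4 n3' n4'.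
  rewrite !subr0 if_same; split=> // w wr.
  by rewrite !wt_flip_other // /exchange_shift lexx mul0r addr0.
- exists m', (if t then -1 else 1); split=> //.
  + rewrite /outer_side Ds Em !wt_x Dr /qdiag; case: (t) => /=; rewrite ?bc ?bd !xpair_eqE; lia.
  + rewrite /outer_side Ds En !wt_flip_same /qdiag; case: (t) => /=; rewrite ?bc ?bd !xpair_eqE;
    lia.
  + by move=> _; rewrite Ds => -[]; lia.
  + move=> w wr; rewrite /outer_side !wt_flip_other // Ds /balance Em En.
    have := wt_minE w geoD qD; rewrite wt_min_flip // /exchange_shift.
    by case: (t); rewrite /= ?bc ?bd ?expr0 ?expr1; lia.
- exists m', (if t then 1 else -1); split=> //.
  + rewrite /outer_side Ds Em !wt_x Dr /qdiag; case: (t) => /=;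
    rewrite ?cd ?(ltF _ _ ac) !xpair_eqE; lia.
  + rewrite /outer_side Ds En !wt_flip_same /qdiag; case: (t) => /=;
    rewrite ?cd ?(ltF _ _ ac) !xpair_eqE; lia.
  + by move=> _; rewrite Ds => -[]; lia.
  + move=> w wr; rewrite /outer_side !wt_flip_other // Ds /balance Em En.
    have := wt_minE w geoD qD; rewrite wt_min_flip // /exchange_shift.
    by case: (t); rewrite /= ?cd ?(ltF _ _ ac) ?expr0 ?expr1; lia.
- exists m', (if t then -1 else 1); split=> //.
  + rewrite /outer_side Ds Em !wt_x Dr /qdiag; case: (t) => /=;
    rewrite ?(ltF _ _ ad) ?(ltF _ _ bd) !xpair_eqE; lia.
  + rewrite /outer_side Ds En !wt_flip_same /qdiag; case: (t) => /=;
    rewrite ?(ltF _ _ ad) ?(ltF _ _ bd) !xpair_eqE; lia.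
  + by move=> _; rewrite Ds => -[]; lia.
  + move=> w wr; rewrite /outer_side !wt_flip_other // Ds /balance Em En.
    have := wt_minE w geoD qD; rewrite wt_min_flip // /exchange_shift.
    by case: (t); rewrite /= ?(ltF _ _ ad) ?(ltF _ _ bd) ?expr0 ?expr1; lia.
Qed.

End Flip.
End Weights.

(** * Seeds attached to triangulations *)

Section Values.
Variables (K : fieldType) (n : nat) (x y z : 'I_n -> K).
Implicit Types (D : 'I_n -> nat * nat).

(** The variable attached to the chord (0, c), which is 1 on the sides (0, 1) and
    (0, n + 2). *)
Definition x_at (c : nat) : K := \prod_(i < n | i.+2 == c) x i.
Definition frozen_weight (p q : nat) : K :=
  (\prod_r y r ^ wt_y r p q) * (\prod_r z r ^ wt_z r p q).

(** The terms are chosen such that the sides (c, c + 1) get the value 1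
    ([chord_side]). *)
Definition gap (q : nat) : K := \sum_(1 <= c < q) frozen_weight c c.+1 / (x_at c * x_at c.+1).

(** The area of the parallelogram spanned by the vectors x_at p (1, gap p) and
    x_at q (1, gap q); the vertex 0 corresponds to (0, -1). *)
Definition lambda_length (p q : nat) : K :=
  if p == 0%N then x_at q else x_at p * x_at q * (gap q - gap p).
Definition chord (p q : nat) : K := lambda_length p q / frozen_weight p q.

Hypothesis x_neq0 : forall i, x i != 0.
Hypothesis y_neq0 : forall i, y i != 0.
Hypothesis z_neq0 : forall i, z i != 0.
Hypothesis gap_neq0 : forall p q, (0 < p < q)%N -> gap q - gap p != 0.

Lemma x_at_neq0 c : x_at c != 0.
Proof. by apply/prodf_neq0. Qed.

Lemma x_at_boundary c : (c < 2)%N || (n.+1 < c)%N -> x_at c = 1.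
Proof. by move=> H; rewrite /x_at big_pred0 // => i; have := ltn_ord i; lia. Qed.

Lemma x_at_vertex (i : 'I_n) : x_at i.+2 = x i.
Proof. by rewrite /x_at (big_pred1 i) // => j; rewrite !eqSS. Qed.

Lemma frozen_weight_neq0 p q : frozen_weight p q != 0.
Proof.
by rewrite mulf_neq0 //; apply/prodf_neq0 => i _; rewrite expfz_neq0.
Qed.

Lemma frozen_weight0 q : frozen_weight 0 q = 1.
Proof. by rewrite /frozen_weight !big1 ?mulr1 // => i _; rewrite /wt_y /wt_z /= expr0z. Qed.

Lemma lambda_length_neq0 p q : (p < q)%N -> lambda_length p q != 0.
Proof.
rewrite /lambda_length; case: (p =P 0%N) => [_ _|p0 pq]; first exact: x_at_neq0.
by rewrite !mulf_neq0 ?x_at_neq0 ?gap_neq0 //; lia.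
Qed.

Lemma chord_neq0 p q : (p < q)%N -> chord p q != 0.
Proof. by move=> pq; rewrite mulf_neq0 ?invr_eq0 ?frozen_weight_neq0 ?lambda_length_neq0. Qed.

Lemma chord_side p : chord p p.+1 = 1.
Proof.
rewrite /chord /lambda_length; case: (p =P 0%N) => [->|p0];
  first by rewrite x_at_boundary // frozen_weight0 divr1.
have p1 : (1 <= p)%N by lia.
rewrite /gap big_nat_recr //= [_ + _ - _]addrAC subrr add0r.
have := x_at_neq0 p; have := x_at_neq0 p.+1; have := frozen_weight_neq0 p p.+1.
by move=> h1 h2 h3; field; rewrite h1 h2 h3.
Qed.

Lemma chord_long : chord 0 n.+2 = 1.
Proof. by rewrite /chord /lambda_length /= frozen_weight0 x_at_boundary ?divr1 // ltnSn orbT. Qed.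

(** The Pluecker relation between four vectors of the plane. *)
Lemma ptolemy a b c d : (a < b)%N -> (b < c)%N -> (c < d)%N ->
  lambda_length a c * lambda_length b d =
  lambda_length a b * lambda_length c d + lambda_length a d * lambda_length b c.
Proof.
move=> ab bc cd; rewrite /lambda_length.
have -> : (b == 0%N) = false by lia.
have -> : (c == 0%N) = false by lia.
by case: (a =P 0%N) => _; ring.
Qed.

Lemma prod_vertices (f : 'I_(n + (n + n)) -> K) :
  \prod_w f w = (\prod_i f (vx i)) * ((\prod_i f (vy i)) * (\prod_i f (vz i))).
Proof. by rewrite big_split_ord big_split_ord. Qed.

Section Seeds.
Variables (u : 'I_(n + (n + n)) -> K) (D : 'I_n -> nat * nat).
Hypothesis geoD : diagonals D.
Hypothesis ux : forall i, u (vx i) = chord (D i).1 (D i).2.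
Hypothesis uy : forall i, u (vy i) = y i.
Hypothesis uz : forall i, u (vz i) = z i.

Lemma var_neq0 w : u w != 0.
Proof.
case: (vertexP w) => -[i ->]; rewrite ?ux ?uy ?uz //.
by apply: chord_neq0; have [h _ _] := diag_ok geoD i; lia.
Qed.

(** The frozen factors in the product cancel the denominator of chord p q. *)
Lemma prod_edge p q : edge D p q -> \prod_w u w ^ wt D w p q = lambda_length p q.
Proof.
move=> pq; rewrite prod_vertices.
under eq_bigr do rewrite wt_x ux.
under [X in _ * (X * _)]eq_bigr do rewrite wt_yE uy.
under [X in _ * (_ * X)]eq_bigr do rewrite wt_zE uz.
rewrite -/(frozen_weight p q).
suff -> : \prod_i chord (D i).1 (D i).2 ^ (D i == (p, q))%:Z = chord p q.
  by rewrite divfK ?frozen_weight_neq0.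
have [pqn H] := edgeP pq.
have [[i Di]|none] : (exists i, D i = (p, q)) \/ (forall i, D i <> (p, q)).
  have [/existsP[i /eqP]|/existsPn none] := boolP [exists i, D i == (p, q)].
    by left; exists i.
  by right=> i; apply/eqP/none.
  rewrite (bigD1 i) //= Di eqxx expr1z big1 ?mulr1 // => j ji.
  by case: eqP => [E|_]; [case/eqP: ji; apply: (diag_inj geoD); rewrite E Di|rewrite expr0z].
rewrite big1 => [|i _]; last by case: eqP => [/none//|_]; rewrite expr0z.
case: H => [->|[-> ->]|[i /none//]]; first by rewrite chord_side.
by rewrite chord_long.
Qed.

Lemma prod_min a b c d : \prod_w u w ^ wt_min w a b c d = frozen_weight a c * frozen_weight b d.
Proof.
rewrite prod_vertices big1 ?mul1r => [|i _]; last first.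
  by rewrite /wt_min /vx (unsplitK (inl i)) expr0z.
under eq_bigr => i _ do rewrite /wt_min /vy (unsplitK (inr _)) (unsplitK (inl i)) uy expfzDr
  ?y_neq0 //.
under [X in _ * X]eq_bigr => i _ do rewrite /wt_min /vz (unsplitK (inr _)) (unsplitK (inr i)) uz
  expfzDr ?z_neq0 //.
by rewrite !big_split /= /frozen_weight; ring.
Qed.

Variables (r : 'I_n) (a b c d : nat) (t : bool).
Hypothesis qD : quad D a b c d.
Hypothesis Dr : D r = qdiag t a b c d.
Variable Q : quiver (n + (n + n)).
Hypothesis acyc : forall w, Q (vx r) w = 0%N \/ Q w (vx r) = 0%N.
Hypothesis Qbal : forall w, (Q (vx r) w)%:Z - (Q w (vx r))%:Z = balance D a b c d t w.

(** Both terms of the exchange relation have the denominator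
    frozen_weight a c * frozen_weight b d, by the tropical Ptolemy relation, so
    that their sum is given by the Ptolemy relation. *)
Lemma exchange_value :
  (\prod_w u w ^+ Q w (vx r) + \prod_w u w ^+ Q (vx r) w) / u (vx r) =
  chord (qdiag (~~ t) a b c d).1 (qdiag (~~ t) a b c d).2.
Proof.
have [ab bc cd dn] := quad_lt qD; have [q1 q2 q3 q4] := qD.
have prodA : \prod_w u w ^ (wt D w a b + wt D w c d - wt_min w a b c d) =
   lambda_length a b * lambda_length c d / (frozen_weight a c * frozen_weight b d).
  rewrite -prod_min -!prod_edge // -prodfV -!big_split; apply: eq_bigr => w _ /=.
  by rewrite !expfzDr ?var_neq0 // invr_expz.
have prodB : \prod_w u w ^ (wt D w a d + wt D w b c - wt_min w a b c d) =
   lambda_length a d * lambda_length b c / (frozen_weight a c * frozen_weight b d).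
  rewrite -prod_min -!prod_edge // -prodfV -!big_split; apply: eq_bigr => w _ /=.
  by rewrite !expfzDr ?var_neq0 // invr_expz.
have Qout w : (Q (vx r) w)%:Z = (if t then wt D w a b + wt D w c d else wt D w a d + wt D w b c)
  - wt_min w a b c d.
  have := Qbal w; have := acyc w; rewrite (wt_minE w geoD qD) /balance.
  by case: (t); rewrite /= ?expr0 ?expr1; lia.
have Qin w : (Q w (vx r))%:Z = (if t then wt D w a d + wt D w b c else wt D w a b + wt D w c d) -
  wt_min w a b c d.
  have := Qbal w; have := acyc w; rewrite (wt_minE w geoD qD) /balance.
  by case: (t); rewrite /= ?expr0 ?expr1; lia.
have -> : \prod_w u w ^+ Q w (vx r) + \prod_w u w ^+ Q (vx r) w =
   lambda_length a c * lambda_length b d / (frozen_weight a c * frozen_weight b d).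
  under eq_bigr do rewrite exprnP Qin.
  under [X in _ + X]eq_bigr do rewrite exprnP Qout.
  rewrite (ptolemy ab bc cd) mulrDl -prodA -prodB.
  by case: (t) => //; rewrite addrC.
rewrite ux Dr /chord.
have := frozen_weight_neq0 a c; have := frozen_weight_neq0 b d.
have := @lambda_length_neq0 a c (ltn_trans ab bc);
  have := @lambda_length_neq0 b d (ltn_trans bc cd).
by move=> h1 h2 h3 h4; case: (t) => /=; field; rewrite ?h1 ?h2 ?h3 ?h4.
Qed.

End Seeds.
End Values.

Section Mutation.
Variables (m : nat) (r : 'I_m) (Q : quiver m).
Hypothesis acyc : forall w, Q r w = 0%N \/ Q w r = 0%N.

Lemma mutq_acyc v w : mutq r Q v w = 0%N \/ mutq r Q w v = 0%N.
Proof. by rewrite /mutq; lia. Qed.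

Lemma mutq_out w : (mutq r Q r w)%:Z - (mutq r Q w r)%:Z = (Q w r)%:Z - (Q r w)%:Z.
Proof.
rewrite /mutq !eqxx /= orbT; have := acyc r; have := acyc w; nia.
Qed.

Lemma mutq_other v w : v <> r -> w <> r ->
  (mutq r Q v w)%:Z - (mutq r Q w v)%:Z =
  (Q v w)%:Z - (Q w v)%:Z + (Q v r * Q r w)%:Z - (Q w r * Q r v)%:Z.
Proof.
move=> /eqP/negbTE vr /eqP/negbTE wr; rewrite /mutq vr wr /=; lia.
Qed.

End Mutation.

Section GoodSeeds.
Variables (K : fieldType) (n : nat) (x y z : 'I_n -> K).
Hypothesis x_neq0 : forall i, x i != 0.
Hypothesis y_neq0 : forall i, y i != 0.
Hypothesis z_neq0 : forall i, z i != 0.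
Hypothesis gap_neq0 : forall p q, (0 < p < q)%N -> gap x y z q - gap x y z p != 0.
Implicit Types (S : seed K n (n + n)) (D : 'I_n -> nat * nat).

(** The correspondence between seeds and triangulations; the third vertices m
    and m' exist because the diagonals form a triangulation. *)
Record triangulated S D : Prop := Triangulated {
  tri_geo : diagonals D;
  tri_x : forall i, seed_var S (vx i) = chord x y z (D i).1 (D i).2;
  tri_y : forall i, seed_var S (vy i) = y i;
  tri_z : forall i, seed_var S (vz i) = z i;
  tri_acyc : forall i w, seed_quiver S (vx i) w = 0%N \/ seed_quiver S w (vx i) = 0%N;
  tri_arrows : forall i, exists m m', [/\ inner D (D i) m, outer D (D i) m' &
     forall w, (seed_quiver S (vx i) w)%:Z - (seed_quiver S w (vx i))%:Z =
       inner_side (wt D w) (D i) m + outer_side (wt D w) (D i) m'] }.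

Lemma triangulated_quad S D i : triangulated S D -> exists a b c d t,
  quad D a b c d /\ D i = qdiag t a b c d.
Proof.
move=> [geo _ _ _ _ /(_ i) [m [m' [/and4P[h1 h2 e1 e2] out _]]]].
have ed := edge_diag i geo.
case: (D i) h1 h2 e1 e2 out ed => p q /= h1 h2 e1 e2 /orP[] /and3P[/= lt e3 e4] ed.
  by exists p, m, q, m', true.
by exists m', p, m, q, false.
Qed.

Lemma triangulated_balance S D r a b c d t : triangulated S D -> quad D a b c d ->
  D r = qdiag t a b c d -> forall w,
  (seed_quiver S (vx r) w)%:Z - (seed_quiver S w (vx r))%:Z = balance D a b c d t w.
Proof.
move=> [geo _ _ _ _ /(_ r) [m [m' [hin hout H]]]] qD Dr w; rewrite H.
have [ab bc cd dn] := quad_lt qD.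
have Drlt : ((D r).1 < (D r).2)%N by have [] := diag_ok geo r; lia.
rewrite (inner_uniq geo hin (inner_diag qD Dr)) (outer_uniq geo Drlt hout (outer_diag qD Dr)).
have da : (d < a)%N = false by lia.
by rewrite Dr /inner_side /outer_side /balance /qdiag; case: (t);
  rewrite /= ?cd ?da ?expr0 ?expr1; ring.
Qed.

(** At most one of the two triangles at a chord s <> r changes, so that the
    contributions to the mutation rule add up. *)
Lemma triangulated_flip S D r a b c d t : triangulated S D -> quad D a b c d ->
  D r = qdiag t a b c d ->
  triangulated (mut_seed S r) (flip D r (qdiag (~~ t) a b c d)).
Proof.
move=> T qD Dr; have [geo Sx Sy Sz acyc arrows] := T.
have balance_r := triangulated_balance T qD Dr.
have geo' := diagonals_flip geo qD Dr; have qD' := quad_flip qD Dr.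
have neq_vx (i j : 'I_n) : i <> j -> vx i <> vx j by move=> ij /lshift_inj.
split=> //.
- move=> i /=; rewrite -/(vx r) -/(vx i).
  have [->|/eqP ir] := eqVneq i r.
    rewrite eqxx flip_same.
    exact: (exchange_value x_neq0 y_neq0 z_neq0 gap_neq0 geo Sx Sy Sz qD Dr (acyc r) balance_r).
  by rewrite flip_other // (negbTE (introN eqP (neq_vx _ _ ir))).
- by move=> i /=; rewrite -Sy; case: eqP => // /eqP; rewrite /vy eq_rlshift.
- by move=> i /=; rewrite -Sz; case: eqP => // /eqP; rewrite /vz eq_rlshift.
- by move=> i w; exact: mutq_acyc.
move=> s; have [->|/eqP sr] := eqVneq s r.
  have Dr' : flip D r (qdiag (~~ t) a b c d) r = qdiag (~~ t) a b c d by rewrite flip_same.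
  exists (if ~~ t then b else c), (if ~~ t then d else a).
  have in' := inner_diag qD' Dr'; have out' := outer_diag qD' Dr'.
  split=> // w; rewrite /= -/(vx r) (mutq_out (acyc r)).
  have [ab bc cd dn] := quad_lt qD.
  have da : (d < a)%N = false by lia.
  have -> : (seed_quiver S w (vx r))%:Z - (seed_quiver S (vx r) w)%:Z = - balance D a b c d t w.
    by rewrite -balance_r opprB.
  have side p q : (p, q) \in [:: (a, b); (b, c); (c, d); (a, d)] ->
      wt (flip D r (qdiag (~~ t) a b c d)) w p q = wt D w p q.
    move=> pq; case: (w =P vx r) => [->|wr]; last exact: wt_flip_other.
    have n1 := quad_ndiag qD Dr pq; have n2 := quad_ndiag qD' Dr' pq.
    by rewrite !wt_x -[D r == _]eq_sym -[_ r == _]eq_sym (negbTE (introN eqP n1)) (negbTE (introN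
      eqP n2)).
  rewrite Dr' /inner_side /outer_side /balance /qdiag; case: (t) side; rewrite /= ?cd ?da => side;
  by rewrite !side ?inE ?eqxx ?orbT // ?expr0 ?expr1; ring.
have [m [m' [hin hout H]]] := arrows s.
have [k [ep [in' e1 e1' E hk]]] := inner_side_flip geo qD Dr sr hin.
have [k' [ep' [out' e2 e2' E' hk']]] := outer_side_flip geo qD Dr sr hout.
exists k, k'; rewrite flip_other //; split=> // w.
have Hr := H (vx r); rewrite e1 e2 in Hr.
(* The inner triangle changes for s = ad only, the outer one for ab, bc, cd. *)
have sep : ep = 0 \/ ep' = 0.
  case: (ep =P 0) => [|n1]; [by left|right]; case: (ep' =P 0) => // n2.
  by case: (E' n2 (E n1)).
rewrite /= -/(vx r); case: (w =P vx r) => [->|wr].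
  have := mutq_out (acyc r) (vx s); rewrite e1' e2'; lia.
rewrite mutq_other //; last exact: neq_vx.
have := acyc r w; have := acyc r (vx s); have := balance_r w.
rewrite (hk w wr) (hk' w wr); have := H w.
move: (balance _ _ _ _ _ _ _) (inner_side _ _ _) (outer_side _ _ _) => B I O Hsw HB Hrs Hrw.
rewrite !PoszM Hsw.
have shift0 : exchange_shift 0 B = 0 by rewrite /exchange_shift lexx mul0r.
have key e : (seed_quiver S (vx s) (vx r))%:Z - (seed_quiver S (vx r) (vx s))%:Z = e ->
    (seed_quiver S (vx s) (vx r))%:Z * (seed_quiver S (vx r) w)%:Z -
    (seed_quiver S w (vx r))%:Z * (seed_quiver S (vx r) (vx s))%:Z = exchange_shift e B.
  have -> : (seed_quiver S (vx r) w)%:Z = Num.max B 0 by move: HB Hrw; lia.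
  have -> : (seed_quiver S w (vx r))%:Z = - Num.min B 0 by move: HB Hrw; lia.
  move=> <-; rewrite /exchange_shift; case: Hrs => ->.
    by rewrite subr0 lez_nat leq0n mulr0 subr0.
  case: (seed_quiver S (vx r) (vx s)) => [|m0].
    by rewrite subr0 lexx !mul0r mulr0 subr0.
  rewrite sub0r oppr_ge0 lez_nat ltn0 opprK mul0r sub0r mulNr opprK; exact: mulrC.
have := key _ Hr; case: sep => ->; rewrite ?add0r ?addr0 shift0; lia.
Qed.

End GoodSeeds.

(** * The cluster variables of the biframed linear quiver *)

Section Positive.
Variable N : nat.
Local Notation K := {fraction {mpoly rat[N]}}.
Implicit Types u v : K.

(** A subtraction-free argument for the nonvanishing of denominators: these
    quotients are positive at the point (1, ..., 1). *)
Definition positive u : Prop := exists f g : {mpoly rat[N]},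
  [/\ u = FracField.tofrac f / FracField.tofrac g, 0 < f.@[fun _ => 1] & 0 < g.@[fun _ => 1]].

Lemma tofrac_pos_neq0 (f : {mpoly rat[N]}) : 0 < f.@[fun _ => 1] -> FracField.tofrac f != 0 :> K.
Proof. by apply: contraTneq => /eqP; rewrite tofrac_eq0 => /eqP ->; rewrite meval0 ltxx. Qed.

Lemma positive_neq0 u : positive u -> u != 0.
Proof.
by move=> [f [g [-> f0 g0]]]; rewrite mulf_neq0 ?invr_eq0 ?tofrac_pos_neq0.
Qed.

Lemma positive1 : positive 1.
Proof. by exists 1, 1; rewrite meval1 !tofrac1 divr1. Qed.

Lemma positiveD u v : positive u -> positive v -> positive (u + v).
Proof.
move=> [f [g [-> f0 g0]]] [f' [g' [-> f0' g0']]].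
exists (f * g' + f' * g), (g * g'); rewrite mevalD !mevalM addr_gt0 ?mulr_gt0 //; split=> //.
rewrite tofracD !tofracM addf_div ?tofrac_pos_neq0 //.
Qed.

Lemma positiveM u v : positive u -> positive v -> positive (u * v).
Proof.
move=> [f [g [-> f0 g0]]] [f' [g' [-> f0' g0']]].
exists (f * f'), (g * g'); rewrite !mevalM !mulr_gt0 //; split=> //.
by rewrite !tofracM mulf_div.
Qed.

Lemma positiveV u : positive u -> positive u^-1.
Proof. by move=> [f [g [-> f0 g0]]]; exists g, f; rewrite invf_div. Qed.

Lemma positive_expz u (m : int) : positive u -> positive (u ^ m).
Proof.
move=> pu; have pn (a : nat) : positive (u ^+ a).
  by elim: a => [|a IH]; rewrite ?expr0 ?exprS; [exact: positive1|exact: positiveM].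
by case: m => a; [exact: pn|apply: positiveV; exact: pn].
Qed.

Lemma positive_prod (I : finType) (P : pred I) (F : I -> K) :
  (forall i, P i -> positive (F i)) -> positive (\prod_(i | P i) F i).
Proof. by move=> PF; apply: big_ind => //; [exact: positive1|exact: positiveM]. Qed.

Lemma positive_var i : positive (FracField.tofrac 'X_i).
Proof. by exists 'X_i, 1; rewrite mevalXU meval1 tofrac1 divr1. Qed.

End Positive.

Section BiframedA.
Variable n : nat.
Local Notation K := (ratfun n).
Local Notation S0 := (biframed_seed (linearA n)).
Local Notation x := (fun i : 'I_n => rvar (vx i)).
Local Notation y := (fun i : 'I_n => rvar (vy i)).
Local Notation z := (fun i : 'I_n => rvar (vz i)).
Local Notation chordA := (chord x y z).
Implicit Types D : 'I_n -> nat * nat.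

Lemma rvar_neq0 w : rvar w != 0 :> K.
Proof. exact: positive_neq0 (positive_var _). Qed.

Lemma gap_ratfun_neq0 p q : (0 < p < q)%N -> gap x y z q - gap x y z p != 0.
Proof.
case/andP=> p0 pq; apply: positive_neq0; rewrite /gap (big_cat_nat (n := p)) //=; last exact: ltnW.
rewrite [_ + _ - _]addrAC subrr add0r.
have term c : positive (frozen_weight y z c c.+1 / (x_at x c * x_at x c.+1)).
  by apply: positiveM; [apply: positiveM; apply: positive_prod => i _; apply: positive_expz|
    apply: positiveV; apply: positiveM; apply: positive_prod => i _]; exact: positive_var.
(* the sum from p to q has at least one term *)
have -> : q = (p + (q - p).-1.+1)%N by lia.
elim: (q - p).-1 => [|d IH]; first by rewrite addn1 big_nat1.
by rewrite addnS big_nat_recr; [exact: positiveD|exact: leq_addr].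
Qed.

Definition fan (i : 'I_n) : nat * nat := (0%N, i.+2).

Lemma biframed_xx Q (i j : 'I_n) : biframed Q (vx i) (vx j) = Q i j.
Proof. by rewrite /biframed /vx !(unsplitK (inl _)). Qed.
Lemma biframed_xy (Q : quiver n) (i j : 'I_n) : biframed Q (vx i) (vy j) = (i == j).
Proof. by rewrite /biframed /vx /vy (unsplitK (inl _)) (unsplitK (inr _)) (unsplitK (inl _)). Qed.
Lemma biframed_xz (Q : quiver n) (i j : 'I_n) : biframed Q (vx i) (vz j) = 0%N.
Proof. by rewrite /biframed /vx /vz (unsplitK (inl _)) (unsplitK (inr _)) (unsplitK (inr _)). Qed.
Lemma biframed_yx (Q : quiver n) (i j : 'I_n) : biframed Q (vy i) (vx j) = 0%N.
Proof. by rewrite /biframed /vx /vy (unsplitK (inr _)) (unsplitK (inl _)) (unsplitK (inl _)). Qed.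
Lemma biframed_zx (Q : quiver n) (i j : 'I_n) : biframed Q (vz i) (vx j) = (i == j).
Proof. by rewrite /biframed /vx /vz (unsplitK (inr _)) (unsplitK (inr _)) (unsplitK (inl _)). Qed.

Lemma fan_edge (q : nat) : (0 < q <= n.+2)%N -> edge fan 0 q.
Proof.
move=> qn; rewrite /edge; case/andP: (qn) => -> -> /=; rewrite orbA.
have [->|q1] := eqVneq q 1%N; first by [].
have [->|qn2] := eqVneq q n.+2; first by rewrite orbT.
apply/orP; right; apply/existsP.
have qi : (q - 2 < n)%N by lia.
by exists (Ordinal qi); rewrite /fan xpair_eqE /=; lia.
Qed.

Lemma side_edge D p : (p < n.+2)%N -> edge D p p.+1.
Proof. by move=> pn; rewrite /edge leqnn pn eqxx. Qed.

Lemma fan_diagonals : diagonals fan.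
Proof.
split=> [i|i j []|i j] //=; last by move=> /ord_inj.
by have i_n := ltn_ord i; split=> //; [lia|case; lia].
Qed.

Lemma fan_triangulated : triangulated x y z S0 fan.
Proof.
split=> //.
- exact: fan_diagonals.
- by move=> i; rewrite /chord /lambda_length /fan /= frozen_weight0 divr1 x_at_vertex.
- move=> i w /=; case: (vertexP w) => -[j ->].
  + by rewrite !biframed_xx /linearA; case: eqP => ?; case: eqP => ?; lia.
  + by rewrite biframed_yx; right.
  + by rewrite biframed_xz; left.
move=> i; exists i.+1, i.+3; split.
- have := ltn_ord i; rewrite /inner /= ltnSn => i_n.
  rewrite fan_edge; last by lia.
  by rewrite side_edge //; lia.
- have := ltn_ord i; rewrite /outer /= ltnSn => i_n.
  rewrite fan_edge; last by lia.
  by rewrite side_edge //; lia.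
move=> w /=; rewrite /inner_side /outer_side /= ltnSn; case: (vertexP w) => -[j ->].
- rewrite !biframed_xx !wt_x /fan /linearA !xpair_eqE; lia.
- by rewrite biframed_xy biframed_yx !wt_yE /wt_y -val_eqE /=; lia.
- by rewrite biframed_xz biframed_zx !wt_zE /wt_z -val_eqE /=; lia.
Qed.

Lemma flip_step S D r a b c d t : triangulated x y z S D -> quad D a b c d ->
  D r = qdiag t a b c d ->
  triangulated x y z (mut_seed S r) (flip D r (qdiag (~~ t) a b c d)).
Proof.
by apply: triangulated_flip; [move=> i; exact: rvar_neq0..|exact: gap_ratfun_neq0].
Qed.

Lemma all_triangulated rs : exists D, triangulated x y z (foldl (@mut_seed _ n (n + n)) S0 rs) D.
Proof.
elim/last_ind: rs => [|rs r [D T]]; first by exists fan; exact: fan_triangulated.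
have [a [b [c [d [t [qD Dr]]]]]] := triangulated_quad r T.
by rewrite foldl_rcons; exists (flip D r (qdiag (~~ t) a b c d)); exact: flip_step.
Qed.

(** The flips at (0, p + 1), (0, p + 2), ... produce the diagonals (p, p + 2),
    (p, p + 3), ... of the fan with apex p. *)
Lemma reach p t : (0 < p)%N -> (p + t <= n.+1)%N -> exists rs D,
  triangulated x y z (foldl (@mut_seed _ n (n + n)) S0 rs) D /\
  forall i : 'I_n, D i = if (p <= i.+1 < p + t)%N then (p, i.+3) else (0%N, i.+2).
Proof.
move=> p0; elim: t => [|t IH] ptn.
  exists [::], fan; split=> [|i]; first exact: fan_triangulated.
  by case: ifP => //; lia.
have [|rs [D [T HD]]] := IH; first by lia.
have rn : ((p + t).-1 < n)%N by lia.
pose r : 'I_n := Ordinal rn.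
have rE : r.+1 = (p + t)%N by rewrite /=; lia.
have diag_edge (i : 'I_n) : edge D (D i).1 (D i).2 by apply: edge_diag; case: T.
have qD : quad D 0 p r.+2 r.+3.
  split.
  - have [->|p1] := eqVneq p 1%N; first exact: side_edge.
    have pn : (p - 2 < n)%N by lia.
    have := diag_edge (Ordinal pn); rewrite HD /= ifF; last by lia.
    by rewrite (_ : (p - 2).+2 = p) //; lia.
  - have [t0|t0] := posnP t.
      by rewrite rE t0 addn0; apply: side_edge; lia.
    have pn : (r.-1 < n)%N by lia.
    have := diag_edge (Ordinal pn); rewrite HD /= ifT; last by lia.
    by rewrite (_ : (p + t).-2.+3 = (p + t).-1.+2) //; lia.
  - apply: side_edge; lia.
  - have [r1n|r1n] := ltnP r.+1 n.
      by have := diag_edge (Ordinal r1n); rewrite HD /= ifF //; lia.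
    by rewrite /edge /=; apply/andP; split; [lia|rewrite (_ : r.+3 == n.+2) ?orbT //; lia].
have Dr : D r = qdiag true 0 p r.+2 r.+3 by rewrite HD ifF //; lia.
exists (rcons rs r), (flip D r (qdiag (~~ true) 0 p r.+2 r.+3)).
rewrite foldl_rcons; split; first exact: flip_step.
move=> i; have [->|/eqP ir] := eqVneq i r.
  by rewrite flip_same /= ifT //; lia.
rewrite flip_other // HD.
have ir' : val i <> val r by move=> /val_inj.
by congr (if _ then _ else _); rewrite /= in ir' *; lia.
Qed.

(** Each mutation is a flip, and each diagonal is reached by flips. *)
Lemma cluster_variable_chord u : cluster_variable S0 u <->
  exists p q, [/\ (p.+1 < q <= n.+2)%N, (p, q) <> (0, n.+2)%N & u = chordA p q].
Proof.
split=> [[rs [i ->]]|[p [q [pq pq0 ->]]]].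
  have [D [geo Tx _ _ _ _]] := all_triangulated rs.
  have [h1 h2 h3] := diag_ok geo i.
  exists (D i).1, (D i).2; split; [by rewrite h1|by rewrite -surjective_pairing|exact: Tx].
have [p0|p0] := posnP p.
  have qn : (q - 2 < n)%N.
    have : q <> n.+2 by move=> E; apply: pq0; rewrite p0 E.
    lia.
  exists [::], (Ordinal qn); rewrite /= p0.
  have /= := tri_x fan_triangulated (Ordinal qn) => ->.
  by rewrite (_ : (q - 2).+2 = q) //; lia.
have [|rs [D [T HD]]] := @reach p (q.-1 - p) p0; first by lia.
have qn : (q - 3 < n)%N by lia.
exists rs, (Ordinal qn); rewrite -/(vx _) (tri_x T) HD ifT /=; last by lia.
by rewrite (_ : (q - 3).+3 = q) //; lia.
Qed.

End BiframedA.

(** * The cluster character of an interval module *)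

Section Character.
Variable n : nat.
Local Notation K := (ratfun n).
Local Notation x := (fun i : 'I_n => rvar (vx i)).
Local Notation y := (fun i : 'I_n => rvar (vy i)).
Local Notation z := (fun i : 'I_n => rvar (vz i)).
Hypothesis rvar_neq0 : forall w, @rvar n w != 0.

Lemma sum_at (m : nat) (g : nat -> int) : ((n <= m)%N -> g m = 0) ->
  \sum_(i < n) (nat_of_bool (m == i))%:Z * g i = g m.
Proof.
move=> gm; have [mn|nm] := ltnP m n; last first.
  rewrite gm // big1 // => i _; have := ltn_ord i.
  by case: eqP => [mi|_]; [lia|rewrite mul0r].
rewrite (bigD1 (Ordinal mn)) //= eqxx mul1r big1 ?addr0 // => i ni.
case: eqP => [mi|_]; last by rewrite mul0r.
by case/eqP: ni; apply/val_inj.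
Qed.

(** The hypothesis g n = 0 takes care of the last vertex, which has no
    successor. *)
Lemma euler_form_simple_r (g : nat -> int) (r : 'I_n) : (g n = 0) ->
  euler_form (linearA n) (fun i => g i) (simple_dim r) = g r - g r.+1.
Proof.
move=> gn; rewrite /euler_form /simple_dim; congr (_ - _).
  rewrite (bigD1 r) //= eqxx mulr1 big1 ?addr0 // => i ir.
  by rewrite (negbTE ir) mulr0.
transitivity (\sum_(i < n) (nat_of_bool (r.+1 == i))%:Z * g i).
  apply: eq_bigr => i _; rewrite (bigD1 r) //= eqxx mulr1 big1 ?addr0.
    by rewrite /linearA [_ == _.+1]eq_sym.
  by move=> j jr; rewrite (negbTE jr) !mulr0.
rewrite sum_at // => h; have -> : r.+1 = n by have := ltn_ord r; lia.
exact: gn.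
Qed.

Lemma euler_form_simple_l (g : nat -> int) (r : 'I_n) :
  euler_form (linearA n) (simple_dim r) (fun i => g i) =
  g r - (if (r : nat) is m.+1 then g m else 0).
Proof.
rewrite /euler_form /simple_dim; congr (_ - _).
  rewrite (bigD1 r) //= eqxx mul1r big1 ?addr0 // => i ir.
  by rewrite (negbTE ir) mul0r.
rewrite (bigD1 r) //= [X in _ + X]big1 ?addr0; last first.
  by move=> i ir; rewrite big1 // => j _; rewrite (negbTE ir) mul0r mulr0.
under eq_bigr do rewrite eqxx mul1r /linearA.
case E : (r : nat) => [|m]; first by rewrite big1 // => j _; rewrite mul0r.
under eq_bigr do rewrite eqSS.
by rewrite sum_at //; have := ltn_ord r; lia.
Qed.

Lemma prod_indicator (u : 'I_n -> K) (P : pred 'I_n) :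
  \prod_i u i ^ (P i)%:Z = \prod_(i | P i) u i.
Proof. by rewrite [RHS]big_mkcond; apply: eq_bigr => i _; case: (P i). Qed.

(** The Euler form gives the exponent [r + 1 = a] + [r = b] - [r + 1 = c] - [r = c]
    of x_r, where [_] is 1 or 0. *)
Lemma interval_term (a b c : nat) : (a <= c <= b)%N -> (b <= n)%N ->
  \prod_(r < n) (x r ^ (- euler_form (linearA n) (fun i => (a <= i < c)%N%:Z) (simple_dim r)
      - euler_form (linearA n) (simple_dim r) (fun i => (a <= i < b)%N%:Z - (a <= i < c)%N%:Z))
    * y r ^+ (a <= r < c)%N * z r ^+ ((a <= r < b)%N - (a <= r < c)%N)) =
  x_at x a.+1 * x_at x b.+2 * (frozen_weight y z c.+1 c.+2 / (x_at x c.+1 * x_at x c.+2)) /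
    frozen_weight y z a.+1 b.+2.
Proof.
move=> acb bn; rewrite !big_split /=.
have nz f : (forall i : 'I_n, exists w, f i = @rvar n w) -> forall i, f i != 0.
  by move=> H i; have [w ->] := H i; exact: rvar_neq0.
have -> : x_at x a.+1 * x_at x b.+2 * (frozen_weight y z c.+1 c.+2 / (x_at x c.+1 * x_at x c.+2))
  / frozen_weight y z a.+1 b.+2
   = (x_at x a.+1 * x_at x b.+2 / (x_at x c.+1 * x_at x c.+2)) * (frozen_weight y z c.+1 c.+2 /
     frozen_weight y z a.+1 b.+2).
  by rewrite [RHS]mulrACA !mulrA.
rewrite -mulrA; congr (_ * _).
  have xiE e : x_at x e = \prod_(i < n) x i ^ (i.+2 == e)%:Z by rewrite prod_indicator.
  have xiV e : (x_at x e)^-1 = \prod_(i < n) x i ^ (- (i.+2 == e)%:Z).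
    by rewrite xiE -prodfV; apply: eq_bigr => i _; rewrite invr_expz.
  rewrite invfM !xiV !xiE -2!big_split -big_split; apply: eq_bigr => r _ /=.
  rewrite -!expfzDr ?rvar_neq0 //; congr (_ ^ _).
  rewrite (@euler_form_simple_r (fun i => (a <= i < c)%N%:Z)); last by lia.
  rewrite (@euler_form_simple_l (fun i => (a <= i < b)%N%:Z - (a <= i < c)%N%:Z)).
  have := ltn_ord r; case: (nat_of_ord r) => [|m]; lia.
rewrite /frozen_weight -mulf_div; congr (_ * _).
  rewrite -prodfV -big_split; apply: eq_bigr => r _ /=.
  rewrite invr_expz -expfzDr ?rvar_neq0 // exprnP; congr (_ ^ _).
  by rewrite /wt_y; lia.
rewrite -prodfV -big_split; apply: eq_bigr => r _ /=.
rewrite invr_expz -expfzDr ?rvar_neq0 // exprnP; congr (_ ^ _).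
by rewrite /wt_z; lia.
Qed.

(** The dimension vectors with a nonempty Grassmannian are the indicator
    functions of the intervals [a, c), so that the sum over e becomes the sum
    over c which defines the difference of the values of gap. *)
Lemma char_module_interval (k : fieldType) l (V : rep k (linearA n)) a b :
  (a < b <= n)%N -> interval_rep V a b ->
  char_module l V = chord x y z a.+1 b.+2.
Proof.
move=> ab Vab; have abn : (a <= b <= n)%N by lia.
have Vd := proj1 Vab.
pose term (e : 'I_n -> nat) : K := \prod_(r < n)
   (x r ^ (- euler_form (linearA n) (fun i => (e i)%:Z) (simple_dim r)
          - euler_form (linearA n) (simple_dim r) (fun i => (rdim V i)%:Z - (e i)%:Z))
       * y r ^+ e r * z r ^+ (rdim V r - e r)).
transitivity (\sum_(c < b.+1 | (a <= c)%N) term (fun r => (a <= r < c)%N : nat)).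
  pose ec (c : nat) : {dffun forall r : 'I_n, 'I_(rdim V r).+1} :=
    [ffun r : 'I_n => inord (a <= r < c)%N].
  have ecE (c : 'I_b.+1) r : ec c r = (a <= r < c)%N :> nat.
    by rewrite ffunE inordK // Vd; have := ltn_ord c; lia.
  rewrite /char_module.
  transitivity (\sum_(e : {dffun forall r : 'I_n, 'I_(rdim V r).+1})
     \sum_(c < b.+1 | (a <= c)%N) (e == ec c)%:R * term (fun r => e r : nat)).
    apply: eq_bigr => e _; rewrite -mulr_suml; congr (_ * _).
    rewrite (euler_char_gr Vab abn) => [|r]; last by rewrite -ltnS ltn_ord.
    rewrite rmorph_sum; apply: eq_bigr => c _ /=.
    have -> : lower_set a (fun r => e r : nat) c = (e == ec c).
      apply/forallP/eqP => [H|-> r]; last by rewrite ecE.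
      by apply/ffunP => r; apply/val_inj; rewrite /= (eqP (H r)) ecE.
    by case: (_ == _).
  rewrite exchange_big; apply: eq_bigr => c ac /=.
  rewrite (bigD1 (ec c)) //= eqxx mul1r big1 ?addr0 => [|e /negbTE ->]; last by rewrite mul0r.
  rewrite /term; apply: eq_bigr => r _; rewrite ecE; congr (_ ^ _ * _ * _).
  by rewrite /euler_form; congr (- (_ - _) - (_ - _)); apply: eq_bigr => i _; rewrite ?ecE //;
    apply: eq_bigr => j _; rewrite ?ecE.
rewrite /chord /lambda_length /= /gap.
rewrite (big_cat_nat (n := a.+1)) //=; last by lia.
rewrite [_ + _ - _]addrAC subrr add0r mulr_sumr mulr_suml.
rewrite big_add1 /= -(big_mkord (fun c => (a <= c)%N) (fun c => term (fun r => (a <= r < c)%N :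
  nat))).
rewrite [RHS]big_nat_cond [LHS]big_mkcond (big_cat_nat (n := a)) //=; last by lia.
rewrite big_nat_cond big1 ?add0r; last by move=> c; case: ifP => //; lia.
rewrite -big_mkcond big_nat_cond; apply: eq_big => [c|c]; first by lia.
move=> H; rewrite -interval_term; try lia.
rewrite /term; apply: eq_bigr => r _; rewrite Vd; congr (_ ^ _ * _ * _).
rewrite /euler_form; congr (- (_ - _) - (_ - _)); apply: eq_bigr => i _; rewrite ?Vd //.
by apply: eq_bigr => j _; rewrite ?Vd.
Qed.

End Character.

(** * The cluster variables are the cluster characters *)

Lemma chord_fan n (i : 'I_n) :
  chord (fun i => rvar (vx i)) (fun i => rvar (vy i)) (fun i => rvar (vz i)) 0 i.+2
  = rvar (vx i).
Proof. by rewrite /chord /lambda_length /= frozen_weight0 divr1 x_at_vertex. Qed.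

Lemma interval_module_rigid (k : fieldType) n (V : rep k (linearA n)) a b :
  (a < b <= n)%N -> interval_rep V a b -> rigid (stalk V).
Proof.
move=> ab Vab; apply: (@interval_rigid _ _ (-1) a b) => //.
by rewrite addNr; exact: stalk_interval_stalk.
Qed.

(** P_i is the interval module [0, i + 1). *)
Lemma shifted_projective_rigid (k : fieldType) n (i : 'I_n) :
  rigid (shift (stalk (proj_mod (k := k) i))).
Proof.
apply: (@interval_rigid _ _ (-2) 0 i.+1); first by rewrite /= ltn_ord.
apply: stalk_interval_shift; rewrite (_ : -2 + 1 + 1 = 0 :> int) //.
by apply: stalk_interval_stalk; apply: (interval_thin (S := fun j => (j <= i)%N)).
Qed.

Theorem theoremA (k : closedFieldType)
    (l : nat) (l_prime : prime l) (l_neq0 : l%:R != 0 :> k)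
    (n : nat) (n_ge1 : (1 <= n)%N) (x : ratfun n) :
  cluster_variable (biframed_seed (linearA n)) x <->
  exists T : cobject k n, rigid (cobject_cpx T) /\ x = cluster_character l T.
Proof.
rewrite cluster_variable_chord; split=> [[p [q [pq pq0 ->]]]|[[V Vind|i] [_ ->]]].
- have [p0|p0] := posnP p.
    have qn : (q - 2 < n)%N.
      by have : q <> n.+2 by [move=> E; apply: pq0; rewrite p0 E]; lia.
    exists (CShift (Ordinal qn)); split; first exact: shifted_projective_rigid.
    rewrite [RHS]/= -(chord_fan (Ordinal qn)) p0; congr (chord _ _ _ _ _).
    by rewrite /=; lia.
  have ab : (p.-1 < q - 2 <= n)%N by lia.
  have Vind := @thin_indecomposable k n (fun j => p.-1 <= j < q - 2)%N _ _ ab (fun j _ => erefl).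
  have Vab := @interval_thin k n (fun j => p.-1 <= j < q - 2)%N _ _ (fun j _ => erefl).
  exists (CMod Vind); split; first exact: interval_module_rigid Vab.
  rewrite [RHS]/= (char_module_interval (@rvar_neq0 n) l ab Vab).
  by congr (chord _ _ _ _ _); lia.
- have [a [b [ab Vab]]] := indecomposable_interval Vind.
  exists a.+1, b.+2; split; [lia|by case|].
  exact: (char_module_interval (@rvar_neq0 n) l ab Vab).
- exists 0%N, i.+2; rewrite chord_fan; split=> //; have := ltn_ord i; first by lia.
  by move=> ? [] ?; lia.
Qed.
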